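(* Let $\mu=\sum_{n\in\mathbb Z}a_n\delta_n$ be a probability distribution concentrated on $\mathbb Z$. Then $\mu$ is quasi-infinitely divisible if and only if its characteristic function $\widehat\mu$ does not have zeroes on $\mathbb R$. In that case, the Gaussian variance of $\mu$ is $0$, the quasi-Lévy measure $\nu$ of $\mu$ is finite and concentrated on $\mathbb Z$, and the drift of $\mu$ lies in $\mathbb Z$. More precisely, if $g:\mathbb R\to\mathbb C$ is the distinguished logarithm of $\widehat\mu$, then the drift of $\mu$ is $k=(2\pi \mathrm i)^{-1}g(2\pi)\in\mathbb Z$, the function $\widetilde g:\mathbb R\to\mathbb C$ defined by $\widetilde g(z)=g(z)-\mathrm i kz$ is $2\pi$-periodic, and the quasi-Lévy measure of $\mu$ is given by $\nu=\sum_{n\in\mathbb Z,\,n\neq0}b_n\delta_n$, where $$b_n=b_n(\widetilde g)=\frac kn+\frac1{2\pi}\int_0^{2\pi}\mathrm e^{-\mathrm i nz}g(z)\,\mathrm dz\in\mathbb R,\qquad n\in\mathbb Z\setminus\{0\},$$ is the $n$-th Fourier coefficient of $\widetilde g$.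
   Context: $\delta_b$ is the Dirac measure at $b$; $\widehat\mu(z)=\int_{\mathbb R}\mathrm e^{\mathrm i zx}\mu(\mathrm dx)$. A representation function is a bounded Borel measurable function $c:\mathbb R\to\mathbb R$ with $\lim_{x\to0}(c(x)-x)/x^2=0$. Put $g_c(x,z)=(\mathrm e^{\mathrm i zx}-1-\mathrm i zc(x))/(1\wedge x^2)$ for $x\ne0$ and $g_c(0,z)=-z^2/2$. A probability distribution $\mu$ on $\mathbb R$ is quasi-infinitely divisible if, for a fixed representation function $c$, there are $\gamma\in\mathbb R$ and a finite signed Borel measure $\zeta$ on $\mathbb R$ with $\widehat\mu(z)=\exp(\mathrm i\gamma z+\int_{\mathbb R}g_c(x,z)\,\zeta(\mathrm dx))$ for all $z\in\mathbb R$. (This property does not depend on $c$; for given $c$ the pair $(\zeta,\gamma)$ is unique, and $\zeta$ does not depend on $c$.) The Gaussian variance of $\mu$ is $a=\zeta(\{0\})$. The quasi-Lévy measure of $\mu$ is the function $\nu(B)=\int_B(1\wedge x^2)^{-1}\zeta(\mathrm dx)$ on Borel sets $B$ bounded away from $0$. For every $r>0$ its restriction to Borel subsets of $\mathbb R\setminus(-r,r)$ is a finite signed measure; $|\nu|$ is the measure on $\mathbb R$ with $|\nu|(\{0\})=0$ that coincides on these subsets with the total variation of the restriction, for each $r>0$. If $\nu$ extends to a signed measure on all Borel sets it is identified with this extension and $\nu(\{0\})=0$; $\nu$ is finite if $|\nu|(\mathbb R)<\infty$; it is concentrated on a set $A$ if $|\nu|(\mathbb R\setminus A)=0$. If $\int_{|x|<1}|x|\,|\nu|(\mathrm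 dx)<\infty$, the drift of $\mu$ is the unique $\gamma_0\in\mathbb R$ with $\widehat\mu(z)=\exp(\mathrm i\gamma_0z-az^2/2+\int_{\mathbb R}(\mathrm e^{\mathrm i zx}-1)\,\nu(\mathrm dx))$ for all $z\in\mathbb R$. The distinguished logarithm of a continuous function $f:\mathbb R\to\mathbb C$ without zeroes and with $f(0)=1$ is the unique continuous $g:\mathbb R\to\mathbb C$ with $g(0)=0$ and $\mathrm e^{g}=f$. The $n$-th Fourier coefficient of a $2\pi$-periodic locally integrable $f$ is $b_n(f)=\frac1{2\pi}\int_0^{2\pi}\mathrm e^{-\mathrm i nz}f(z)\,\mathrm dz$. *)

(* Defs.v *)
From HB Require Import structures.
From mathcomp Require Import all_boot all_order all_algebra.
From mathcomp Require Import all_classical all_reals all_analysis.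
From mathcomp Require Import measurable_realfun complex.

Set Implicit Arguments.
Unset Strict Implicit.
Unset Printing Implicit Defensive.

Import Order.TTheory GRing.Theory Num.Theory.
Import numFieldNormedType.Exports.

Local Open Scope classical_set_scope.
Local Open Scope ring_scope.
Local Open Scope complex_scope.

Notation borelR R := (measurableTypeR R).

Section complex_analysis.
Context {R : realType}.

Definition cexp (w : R[i]) : R[i] :=
  (expR (complex.Re w))%:C * (cos (complex.Im w) +i* sin (complex.Im w)).

(* Real and imaginary parts are integrated with [Rintegral], whose value is
   junk on non-integrable functions. *)
Definition cintegral (m : {measure set (borelR R) -> \bar R})
    (D : set R) (f : R -> R[i]) : R[i] :=
  (\int[m]_(x in D) complex.Re (f x)) +i* (\int[m]_(x in D) complex.Im (f x)).

Definition charfun (mu : {measure set (borelR R) -> \bar R}) (z : R) : R[i] :=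
  cintegral mu setT (fun x => cexp ('i%C * (z * x)%:C)).

(* [R[i]^o] carries the topology given by the modulus. *)
Definition distinguished_log (f : R -> R[i]) (g : R -> R[i]^o) : Prop :=
  [/\ continuous g, g 0 = 0 & forall z, cexp (g z) = f z].

Definition fourier_coef (f : R -> R[i]) (n : int) : R[i] :=
  ((2 * pi)^-1)%:C *
  cintegral lebesgue_measure `[0, 2 * pi]
    (fun z => cexp (- ('i%C * (n%:~R * z)%:C)) * f z).

End complex_analysis.

Section signed_measures.
Context {R : realType}.
Implicit Types (zeta : {charge set (borelR R) -> \bar R}) (B : set R).

Lemma hahn_subproof zeta :
  exists PN : set R * set R, hahn_decomposition zeta PN.1 PN.2.
Proof. by have [P [N PN]] := Hahn_decomposition zeta; exists (P, N). Qed.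

Definition hahn zeta : set R * set R := projT1 (cid (hahn_subproof zeta)).

Lemma hahnP zeta : hahn_decomposition zeta (hahn zeta).1 (hahn zeta).2.
Proof. exact: projT2 (cid (hahn_subproof zeta)). Qed.

(* The Jordan decomposition does not depend on the choice made in [hahn], see
   [Hahn_decomposition_uniq]. *)
Definition pos_part zeta : {measure set (borelR R) -> \bar R} :=
  jordan_pos (hahnP zeta).

Definition neg_part zeta : {measure set (borelR R) -> \bar R} :=
  jordan_neg (hahnP zeta).

Definition charge_tv zeta : {measure set (borelR R) -> \bar R} :=
  charge_variation (hahnP zeta).

Definition scintegral zeta (D : set R) (f : R -> R[i]) : R[i] :=
  cintegral (pos_part zeta) D f - cintegral (neg_part zeta) D f.

(* [nu] is the signed measure sum_(n in D) b_n delta_n, with absolute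
   convergence of sum_n b_n. *)
Definition is_dirac_series (D : set int) (b : int -> R)
    (nu : set (borelR R) -> \bar R) : Prop :=
  summable D (fun n => (b n)%:E) /\
  forall B : set (borelR R), measurable B ->
    let w n := ((b n)%:E * \d_(n%:~R : R) B)%E in
    nu B = (\esum_(n in D) w^\+ n - \esum_(n in D) w^\- n)%E.

End signed_measures.

Section quasi_infinitely_divisible.
Context {R : realType}.
Implicit Types (c : R -> R) (mu : probability (borelR R) R)
  (zeta : {charge set (borelR R) -> \bar R}).

Definition representation_function c : Prop :=
  [/\ measurable_fun setT (c : borelR R -> R),
      exists M : R, forall x, `|c x| <= M &
      (c x - x) / x ^+ 2 @[x --> 0^'] --> (0 : R)].

Definition g_ c (x z : R) : R[i] :=
  if x == 0 then (- (z ^+ 2 / 2))%:C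
  else (cexp ('i%C * (z * x)%:C) - 1 - 'i%C * (z * c x)%:C) /
       (Num.min 1 (x ^+ 2))%:C.

Definition characteristic_pair c mu zeta (gamma : R) : Prop :=
  forall z, charfun mu z =
    cexp ('i%C * (gamma * z)%:C + scintegral zeta setT (fun x => g_ c x z)).

Definition quasi_infinitely_divisible c mu : Prop :=
  exists gamma zeta, characteristic_pair c mu zeta gamma.

Definition gaussian_variance zeta : R := fine (zeta [set (0 : R)]).

End quasi_infinitely_divisible.

Section quasi_Levy_measure.
Context {R : realType}.
Implicit Types (zeta : {charge set (borelR R) -> \bar R})
  (r : {posnum R}) (B : set (borelR R)).

Definition outside r : set (borelR R) := [set x | r%:num <= `|x|].

Definition levy_density (x : R) : R := (Num.min 1 (x ^+ 2))^-1.

(* Meaningful on Borel sets bounded away from 0. *)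
Definition quasi_Levy zeta B : \bar R :=
  (\int[pos_part zeta]_(x in B) (levy_density x)%:E
   - \int[neg_part zeta]_(x in B) (levy_density x)%:E)%E.

Definition quasi_Levy_restr zeta r B : \bar R := quasi_Levy zeta (B `&` outside r).

Lemma measurable_outside r : measurable (outside r).
Proof.
have -> : outside r = ~` [set x : R | `|x| < r%:num].
  by apply/seteqP; split => x /=; rewrite /outside/= leNgt => /negP.
apply: measurableC.
have -> : [set x : R | `|x| < r%:num] = `](- r%:num), r%:num[%classic.
  by apply/seteqP; split => x /=; rewrite in_itv/= ltr_norml.
exact: measurable_itv.
Qed.

Lemma density_ge0 (x : R) : (0 <= (levy_density x)%:E)%E.
Proof. by rewrite lee_fin invr_ge0 le_min ler01 sqr_ge0. Qed.

Lemma measurable_density (D : set (borelR R)) :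
  measurable_fun D (EFin \o (levy_density : borelR R -> R)).
Proof.
apply: measurable_funTS; apply/measurable_EFinP.
rewrite (_ : levy_density = (fun y => y `^ (-1)) \o (fun x => Num.min 1 (x ^+ 2))).
  apply: measurableT_comp; first exact: measurable_powR.
  by apply: measurable_minr => //; exact: exprn_measurable.
apply/funext => x /=; rewrite /levy_density powR_inv1//.
by rewrite le_min ler01 sqr_ge0.
Qed.

#[local] Hint Resolve measurable_outside density_ge0 measurable_density : core.

Lemma integrable_density (m : {measure set (borelR R) -> \bar R}) r :
  (m setT < +oo)%E -> m.-integrable (outside r) (fun x => (levy_density x)%:E).
Proof.
move=> moo; apply: (@measurable_bounded_integrable _ _ _ m levy_density) => //.
- by apply: le_lt_trans moo; apply: le_measure; rewrite ?inE//;
    exact: measurable_outside.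
- exact/measurable_EFinP.
- exists (Num.min 1 (r%:num ^+ 2))^-1; split; first exact: num_real.
  move=> M rM x /= rx; apply: le_trans (ltW rM).
  rewrite ger0_norm; last by rewrite -lee_fin; exact: density_ge0.
  have r2x2 : r%:num ^+ 2 <= x ^+ 2.
    by rewrite -(real_normK (num_real x)) ler_sqr ?nnegrE.
  have r2_gt0 : 0 < r%:num ^+ 2 by exact: exprn_gt0.
  rewrite lef_pV2 ?posrE ?lt_min ?ltr01 ?r2_gt0 ?(lt_le_trans r2_gt0)//.
  by rewrite le_min ge_min lexx/= ge_min r2x2 orbT.
Qed.

Lemma finite_part zeta :
  (pos_part zeta setT < +oo)%E * (neg_part zeta setT < +oo)%E.
Proof.
split; rewrite ltey_eq; apply/orP; left.
  exact: (fin_num_measure (jordan_pos (hahnP zeta))).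
exact: (fin_num_measure (jordan_neg (hahnP zeta))).
Qed.

Lemma fin_density (m : {measure set (borelR R) -> \bar R}) r B :
  (m setT < +oo)%E -> measurable B ->
  (\int[m]_(x in B `&` outside r) (levy_density x)%:E)%E \is a fin_num.
Proof.
move=> moo mB; apply: integrable_fin_num.
  by apply: measurableI => //; exact: measurable_outside.
apply: integrableS (integrable_density r moo) => //.
- by apply: measurableI => //; exact: measurable_outside.
Qed.

Lemma quasi_Levy_restr0 zeta r : quasi_Levy_restr zeta r set0 = 0%E.
Proof. by rewrite /quasi_Levy_restr /quasi_Levy set0I !integral_set0 subee. Qed.

Lemma quasi_Levy_restr_fin zeta r B : measurable B ->
  quasi_Levy_restr zeta r B \is a fin_num.
Proof.
by move=> mB; rewrite /quasi_Levy_restr /quasi_Levy fin_numB;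
  rewrite !fin_density//; apply finite_part.
Qed.

Lemma quasi_Levy_restr_additive zeta r :
  semi_sigma_additive (quasi_Levy_restr zeta r).
Proof.
have key (m : {measure set (borelR R) -> \bar R}) :
    semi_sigma_additive (fun B => \int[m]_(x in B `&` outside r) (levy_density x)%:E)%E.
  move=> F mF tF mUF; rewrite setI_bigcupl.
  apply: (@semi_sigma_additive_nng_induced _ _ _ m (fun x => (levy_density x)%:E)) => //.
  - by move=> i; apply: measurableI => //; exact: measurable_outside.
  - exact: trivIset_setIr.
  - by apply: bigcupT_measurable => i; apply: measurableI => //; exact: measurable_outside.
move=> F mF tF mUF.
rewrite (_ : (fun n => _) = (fun n =>
    \sum_(0 <= i < n) \int[pos_part zeta]_(x in F i `&` outside r) (levy_density x)%:E -
    \sum_(0 <= i < n) \int[neg_part zeta]_(x in F i `&` outside r) (levy_density x)%:E)%E);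
    last first.
  apply/funext => n; rewrite big_split/= sumeN// => i j _ _.
  by rewrite fin_num_adde_defl// fin_density//; apply finite_part.
apply: cvgeB; [|exact: key|exact: key].
by rewrite fin_num_adde_defl// fin_numN fin_density//; apply finite_part.
Qed.

HB.instance Definition _ zeta r := isCharge.Build _ _ _ (quasi_Levy_restr zeta r)
  (quasi_Levy_restr0 zeta r) (@quasi_Levy_restr_fin zeta r)
  (@quasi_Levy_restr_additive zeta r).

(* [m] is the measure on R with [m {0} = 0] that agrees, for each [r], with
   [v r] on the Borel subsets of the complement of ]-r, r[. *)
Definition glues (v : {posnum R} -> set (borelR R) -> \bar R)
    (m : {measure set (borelR R) -> \bar R}) : Prop :=
  m [set (0 : R)] = 0%E /\
  forall r B, measurable B -> B `<=` outside r -> m B = v r B.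

Lemma glues_unique v m1 m2 : glues v m1 -> glues v m2 ->
  forall B, measurable B -> m1 B = m2 B.
Proof.
move=> g1 g2 B mB.
have n_gt0 n : 0 < (n.+1%:R^-1 : R) by rewrite invr_gt0.
pose F n := B `&` outside (PosNum (n_gt0 n)).
have mF n : measurable (F n) by apply: measurableI => //; exact: measurable_outside.
have F_cvg m : glues v m -> (m \o F) n @[n --> \oo] --> m B.
  move=> [m0 _]; have m10 : measurable ([set 0] : set (borelR R)).
    exact: measurable_set1.
  have UF : \bigcup_n F n = B `\` [set 0].
    apply/seteqP; split=> [x [n _ [Bx nx]]|x [Bx /eqP x0]].
      split=> // /= x0; move: nx; rewrite /outside/= x0 normr0.
      by rewrite leNgt invr_gt0 ltr0n.
    have x_gt0 : 0 < `|x| by rewrite normr_gt0.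
    have [n _ nx] := near_infty_natSinv_lt (PosNum x_gt0).
    by exists n => //; split=> //; apply: ltW; exact: (nx n (leqnn n)).
  have <- : m (\bigcup_n F n) = m B.
    have mBD : m (B `&` [set 0]) = 0%E.
      apply/eqP; rewrite eq_le measure_ge0 andbT -m0.
      by apply: le_measure; rewrite ?inE//; exact: measurableI.
    have mI : measurable (B `&` [set 0]) by exact: measurableI.
    have mD : measurable (B `\` [set 0]) by exact: measurableD.
    rewrite UF -[in RHS](setUIDK B [set 0]) measureU//.
      by rewrite [X in (X + _)%E]mBD add0e.
    by rewrite setDE setIACA setICr setI0.
  apply: nondecreasing_cvg_mu => //; first exact: bigcupT_measurable.
  apply/nondecreasing_seqP => n; apply/subsetPset; apply: setIS => x.
  rewrite /outside/=; apply: le_trans.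
  by rewrite lef_pV2 ?posrE// ler_nat.
have FE m n : glues v m -> m (F n) = v (PosNum (n_gt0 n)) (F n).
  by move=> [_ gl]; apply: gl => //; exact: subIsetr.
have eq12 : m1 \o F = m2 \o F by apply/funext => n /=; rewrite !FE.
have := F_cvg _ g1; rewrite eq12 => c1.
exact: (cvg_unique _ c1 (F_cvg _ g2)).
Qed.

Section existence.
Variable zeta : {charge set (borelR R) -> \bar R}.
Local Notation P := (hahn zeta).1.
Local Notation N := (hahn zeta).2.

Lemma mP : measurable (P : set (borelR R)). Proof. by have [[]] := hahnP zeta. Qed.
Lemma mN : measurable (N : set (borelR R)). Proof. by have [_ []] := hahnP zeta. Qed.

#[local] Hint Resolve mP mN : core.

Lemma pos_partE z B : measurable B -> pos_part z B = z (B `&` (hahn z).1).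
Proof.
by move=> mB; rewrite -[LHS]/(jordan_pos (hahnP z) B) jordan_posE cjordan_posE;
  rewrite /crestr0 mem_set.
Qed.

Lemma neg_partE z B : measurable B -> neg_part z B = (- z (B `&` (hahn z).2))%E.
Proof.
by move=> mB; rewrite -[LHS]/(jordan_neg (hahnP z) B) jordan_negE cjordan_negE;
  rewrite /crestr0 mem_set.
Qed.

Lemma pos_part_neg B : measurable B -> B `<=` N -> pos_part zeta B = 0%E.
Proof.
move=> mB BN; have [_ _ _ PN0] := hahnP zeta.
rewrite pos_partE//.
suff -> : B `&` (hahn zeta).1 = set0 by rewrite charge0.
by rewrite -subset0 -PN0 => x [/BN].
Qed.

Lemma neg_part_pos B : measurable B -> B `<=` P -> neg_part zeta B = 0%E.
Proof.
move=> mB BP; have [_ _ _ PN0] := hahnP zeta.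
rewrite neg_partE//.
suff -> : B `&` (hahn zeta).2 = set0 by rewrite charge0 oppe0.
by rewrite -subset0 -PN0 => x [/BP].
Qed.

Lemma quasi_Levy_onP B : measurable B -> B `<=` P ->
  quasi_Levy zeta B = (\int[pos_part zeta]_(x in B) (levy_density x)%:E)%E.
Proof.
move=> mB BP; rewrite /quasi_Levy [X in (_ - X)%E]null_set_integral ?sube0//.
exact: neg_part_pos.
Qed.

Lemma quasi_Levy_onN B : measurable B -> B `<=` N ->
  quasi_Levy zeta B = (- \int[neg_part zeta]_(x in B) (levy_density x)%:E)%E.
Proof.
move=> mB BN; rewrite /quasi_Levy [X in (X - _)%E]null_set_integral ?add0e//.
exact: pos_part_neg.
Qed.

Lemma hahn_restr r : hahn_decomposition (quasi_Levy_restr zeta r) P N.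
Proof.
have [_ _ PNT PN0] := hahnP zeta; split => //; split => // A mA sA.
- rewrite -[X in (_ <= X)%E]/(quasi_Levy zeta (A `&` outside r)).
  rewrite quasi_Levy_onP ?integral_ge0//.
    by apply: measurableI => //; exact: measurable_outside.
  by apply: subset_trans sA; exact: subIsetl.
- rewrite -[X in (X <= _)%E]/(quasi_Levy zeta (A `&` outside r)).
  rewrite quasi_Levy_onN ?oppe_le0 ?integral_ge0//.
    by apply: measurableI => //; exact: measurable_outside.
  by apply: subset_trans sA; exact: subIsetl.
Qed.

Lemma split_integral (m : {measure set (borelR R) -> \bar R}) A1 A2 B :
  measurable B -> measurable A1 -> measurable A2 ->
  A1 `|` A2 = setT -> A1 `&` A2 = set0 -> m A2 = 0%E ->
  (\int[m]_(x in B `&` A1) (levy_density x)%:E =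
   \int[m]_(x in B) (levy_density x)%:E)%E.
Proof.
move=> mB mA1 mA2 AT A0 mA20; rewrite -[in RHS](setIT B) -AT setIUr.
rewrite ge0_integral_setU//; try exact: measurableI; last first.
  by apply/disj_setPS; rewrite setIACA A0 setI0.
rewrite [X in (_ + X)%E]null_set_integral ?adde0//; first exact: measurableI.
apply/eqP; rewrite eq_le measure_ge0 andbT -mA20.
by apply: le_measure; rewrite ?inE//; exact: measurableI.
Qed.

Lemma pos_part_restr r B : measurable B -> B `<=` outside r ->
  pos_part (quasi_Levy_restr zeta r) B =
  (\int[pos_part zeta]_(x in B) (levy_density x)%:E)%E.
Proof.
move=> mB Br; have [_ _ PNT PN0] := hahnP zeta.
rewrite pos_partE//.
have [-> _] := Hahn_decomposition_uniq (hahnP (quasi_Levy_restr zeta r))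
  (hahn_restr r) mB.
rewrite -[LHS]/(quasi_Levy zeta (B `&` P `&` outside r)).
rewrite setIAC (setIidl Br) quasi_Levy_onP//; last exact: measurableI.
by apply: (@split_integral _ _ N) => //; exact: pos_part_neg.
Qed.

Lemma neg_part_restr r B : measurable B -> B `<=` outside r ->
  neg_part (quasi_Levy_restr zeta r) B =
  (\int[neg_part zeta]_(x in B) (levy_density x)%:E)%E.
Proof.
move=> mB Br; have [_ _ PNT PN0] := hahnP zeta.
rewrite neg_partE//.
have [_ ->] := Hahn_decomposition_uniq (hahnP (quasi_Levy_restr zeta r))
  (hahn_restr r) mB.
rewrite -[X in (- X)%E]/(quasi_Levy zeta (B `&` N `&` outside r)).
rewrite setIAC (setIidl Br) quasi_Levy_onN ?oppeK//; last exact: measurableI.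
apply: (@split_integral _ _ P) => //; rewrite 1?setUC 1?setIC//.
exact: neg_part_pos.
Qed.

Lemma density_measure (m : {measure set (borelR R) -> \bar R}) :
  exists m' : {measure set (borelR R) -> \bar R},
    forall B, m' B = (\int[m]_(x in B) (levy_density x)%:E)%E.
Proof.
pose f B := (\int[m]_(x in B) (levy_density x)%:E)%E.
have f0 : f set0 = 0%E by exact: integral_set0.
have f_ge0 B : (0 <= f B)%E by exact: integral_ge0.
have fS : semi_sigma_additive f by exact: semi_sigma_additive_nng_induced.
pose M := isMeasure.Build _ _ _ f f0 f_ge0 fS.
by exists (HB.pack_for {measure set (borelR R) -> \bar R} f M).
Qed.

Lemma density_set0 (m : {measure set (borelR R) -> \bar R}) :
  (\int[m]_(x in [set 0%R : R]) (levy_density x)%:E)%E = 0%E.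
Proof.
apply: integral0_eq => x ->.
by rewrite /levy_density expr0n/= min_r// invr0.
Qed.

Lemma quasi_Levy_pos_subproof :
  exists m, glues (fun r => pos_part (quasi_Levy_restr zeta r)) m.
Proof.
have [m mE] := density_measure (pos_part zeta); exists m.
split=> [|r B mB Br]; rewrite mE; first exact: density_set0.
by rewrite pos_part_restr.
Qed.

Lemma quasi_Levy_neg_subproof :
  exists m, glues (fun r => neg_part (quasi_Levy_restr zeta r)) m.
Proof.
have [m mE] := density_measure (neg_part zeta); exists m.
split=> [|r B mB Br]; rewrite mE; first exact: density_set0.
by rewrite neg_part_restr.
Qed.

Lemma quasi_Levy_tv_subproof :
  exists m, glues (fun r => charge_tv (quasi_Levy_restr zeta r)) m.
Proof.
have [m1 [m10 m1E]] := quasi_Levy_pos_subproof.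
have [m2 [m20 m2E]] := quasi_Levy_neg_subproof.
exists (measure_add m1 m2); split=> [|r B mB Br].
  by rewrite -[LHS]/(measure_add m1 m2 [set 0]) measure_addE m10 m20 adde0.
by rewrite -[LHS]/(measure_add m1 m2 B) measure_addE (m1E r)// (m2E r).
Qed.

End existence.

Definition quasi_Levy_pos zeta := projT1 (cid (quasi_Levy_pos_subproof zeta)).

Definition quasi_Levy_neg zeta := projT1 (cid (quasi_Levy_neg_subproof zeta)).

Definition quasi_Levy_tv zeta := projT1 (cid (quasi_Levy_tv_subproof zeta)).

Lemma quasi_Levy_posP zeta :
  glues (fun r => pos_part (quasi_Levy_restr zeta r)) (quasi_Levy_pos zeta).
Proof. exact: projT2 (cid (quasi_Levy_pos_subproof zeta)). Qed.

Lemma quasi_Levy_negP zeta :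
  glues (fun r => neg_part (quasi_Levy_restr zeta r)) (quasi_Levy_neg zeta).
Proof. exact: projT2 (cid (quasi_Levy_neg_subproof zeta)). Qed.

Lemma quasi_Levy_tvP zeta :
  glues (fun r => charge_tv (quasi_Levy_restr zeta r)) (quasi_Levy_tv zeta).
Proof. exact: projT2 (cid (quasi_Levy_tv_subproof zeta)). Qed.

Definition quasi_Levy_cintegral zeta (D : set R) (f : R -> R[i]) : R[i] :=
  cintegral (quasi_Levy_pos zeta) D f - cintegral (quasi_Levy_neg zeta) D f.

Definition quasi_Levy_finite zeta : Prop := (quasi_Levy_tv zeta setT < +oo)%E.

Definition quasi_Levy_concentrated zeta (A : set (borelR R)) : Prop :=
  quasi_Levy_tv zeta (~` A) = 0%E.

(* [nu] is the signed measure on all Borel sets with which the quasi-Levy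
   measure is identified when it extends. *)
Definition quasi_Levy_extension zeta (nu : {charge set (borelR R) -> \bar R}) :
    Prop :=
  nu [set (0 : R)] = 0%E /\
  forall r B, measurable B -> B `<=` outside r -> nu B = quasi_Levy zeta B.

(* [zeta] is meant to be the signed measure of a characteristic pair of [mu]. *)
Definition is_drift (mu : probability (borelR R) R) zeta : R -> Prop :=
  fun gamma0 =>
  (\int[quasi_Levy_tv zeta]_(x in [set x : R | (`|x| < 1)%R]) `|x|%:E < +oo)%E /\
  unique (fun gamma0 => forall z, charfun mu z =
    cexp ('i%C * (gamma0 * z)%:C - (gaussian_variance zeta * z ^+ 2 / 2)%:C +
          quasi_Levy_cintegral zeta setT (fun x => cexp ('i%C * (z * x)%:C) - 1)))
    gamma0.

End quasi_Levy_measure.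

(* Main.v *)
Require Import Defs.
From HB Require Import structures.
From mathcomp Require Import all_boot all_order all_algebra.
From mathcomp Require Import all_classical all_reals all_analysis.
From mathcomp Require Import measurable_realfun complex.
From mathcomp Require Import ring lra.

Set Implicit Arguments.
Unset Strict Implicit.
Unset Printing Implicit Defensive.

Import Order.TTheory GRing.Theory Num.Theory.
Import numFieldNormedType.Exports.

Local Open Scope classical_set_scope.
Local Open Scope ring_scope.
Local Open Scope complex_scope.

(** Let [f] be the characteristic function of the lattice distribution [mu].  It is
    the sum of the absolutely convergent Fourier series with coefficients
    [mu {n}].  If [mu] is quasi-infinitely divisible then [f] is an exponential and
    has no zeros.  Conversely, if [f] has no zeros then, by the theorem of Wiener and
    Levy for the logarithm ([wiener_levy_log]), [f z = C e^(ikz) e^(G z)] where [G]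
    has an absolutely convergent Fourier series as well.  Since [f 0 = 1] and
    [f (- z)] is the conjugate of [f z], the normalized logarithm [G - G 0] is the sum
    of [b_n (e^(inz) - 1)] over [n <> 0], with real summable [b_n]
    ([wiener_hermitian_measures], [lattice_charfun_exponent]).  This is a
    Levy-Khintchine exponent without Gaussian part, with drift [k] and with the signed
    measure of masses [b_n] as quasi-Levy measure
    ([lattice_characteristic_pair]).

    The theorem of Wiener and Levy is obtained without Banach algebra theory.
    The predicate [wiener M F] bounds the sum of the moduli of the Fourier coefficients
    of [F] by [M], through approximation by trigonometric polynomials.  If [P] is a
    trigonometric polynomial close to [f] in this sense, then [P] extends to a Laurent
    polynomial without zeros in an annulus around the unit circle, and Cauchy's
    estimates on that annulus show that the norms of [P^-n] grow essentially like the
    powers of [1 / min |P|] ([wiener_inv_exp]).  Hence the powers of [u = (f - P) / P]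
    have geometrically decreasing norms, the logarithmic series of [1 + u] converges,
    and the logarithm of [P] is explicit because [P] factors into linear terms.

    All claims about an arbitrary characteristic pair of [mu] follow from the
    uniqueness of the signed measure in it ([characteristic_pair_unique]).  Two
    exponents of [f] differ by a continuous function with values in the multiples of
    [2 i pi], hence coincide ([continuous_cexp_eq1]).  Second differences in [z] turn
    them into the Fourier transforms of two weighted measures, and these measures are
    determined by their trigonometric moments ([weighted_measure_inj]): polynomials in
    [sin (h (x - a))] approximate its sign, which for small [h] is that of [x - a], so
    that the measures agree on rays.  The weights are positive near any given
    point for small [h], and can be removed ([positive_density_inj]).

    The same continuity argument shows that the distinguished logarithm is
    [i k z + G z - G 0] ([distinguished_logE]); its value at [2 pi] is [2 i pi k], and
    the summand [i k z] accounts for the term [k / n] in the formula for [b_n]. *)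

(** * The complex exponential *)

Section complex_exponential.
Context {R : realType}.
Implicit Types (w v : R[i]) (x y : R).

Local Notation cabs := (ComplexField.Normc.normc).

Lemma cabsE w : cabs w = Num.sqrt (complex.Re w ^+ 2 + complex.Im w ^+ 2).
Proof. by case: w. Qed.

Lemma cabs_sqr w : cabs w ^+ 2 = complex.Re w ^+ 2 + complex.Im w ^+ 2.
Proof. by rewrite cabsE sqr_sqrtr// addr_ge0 ?sqr_ge0. Qed.

Lemma cabs_ge0 w : 0 <= cabs w.
Proof. by rewrite cabsE sqrtr_ge0. Qed.

Lemma cabs0 : cabs (0 : R[i]) = 0. Proof. exact: ComplexField.Normc.normc0. Qed.

Lemma cabs1 : cabs (1 : R[i]) = 1. Proof. exact: ComplexField.Normc.normc1. Qed.

Lemma cabsM w v : cabs (w * v) = cabs w * cabs v.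
Proof. exact: ComplexField.Normc.normcM. Qed.

Lemma cabsV w : cabs w^-1 = (cabs w)^-1.
Proof. exact: ComplexField.Normc.normcV. Qed.

Lemma cabsN w : cabs (- w) = cabs w.
Proof. exact: (normrN (w : Rcomplex R)). Qed.

Lemma cabsD w v : cabs (w + v) <= cabs w + cabs v.
Proof. exact: le_normcD. Qed.

Lemma cabsB w v : cabs (w - v) <= cabs w + cabs v.
Proof. by rewrite -(cabsN v); exact: cabsD. Qed.

Lemma cabs_distC w v : cabs (w - v) = cabs (v - w).
Proof. by rewrite -cabsN opprB. Qed.

Lemma cabs_distD v w u : cabs (w - u) <= cabs (w - v) + cabs (v - u).
Proof. by rewrite -[w](subrK v) -addrA [w - v + v]subrK; exact: cabsD. Qed.

Lemma cabs_eq0 w : (cabs w == 0) = (w == 0).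
Proof.
apply/eqP/eqP => [|->]; [exact: ComplexField.Normc.eq0_normc|exact: cabs0].
Qed.

Lemma cabs_gt0 w : (0 < cabs w) = (w != 0).
Proof. by rewrite lt_neqAle cabs_ge0 andbT eq_sym cabs_eq0. Qed.

Lemma cabsX w n : cabs (w ^+ n) = cabs w ^+ n.
Proof. by elim: n => [|n IH]; rewrite ?expr0 ?cabs1// !exprS cabsM IH. Qed.

Lemma cabs_real x : cabs x%:C = `|x|.
Proof. by rewrite cabsE/= expr0n addr0 sqrtr_sqr. Qed.

Lemma cabs_i : cabs ('i%C : R[i]) = 1.
Proof. by rewrite cabsE/= expr0n/= expr1n add0r sqrtr1. Qed.

Lemma cabs_Re w : `|complex.Re w| <= cabs w.
Proof.
by rewrite -[`|_|]sqrtr_sqr cabsE ler_wsqrtr// lerDl sqr_ge0.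
Qed.

Lemma cabs_Im w : `|complex.Im w| <= cabs w.
Proof.
by rewrite -[`|_|]sqrtr_sqr cabsE ler_wsqrtr// lerDr sqr_ge0.
Qed.

Lemma cabs_leD w : cabs w <= `|complex.Re w| + `|complex.Im w|.
Proof.
rewrite -(ler_sqr (x := cabs w)) ?nnegrE ?addr_ge0 ?cabs_ge0// cabs_sqr.
rewrite sqrrD !real_normK ?num_real//.
by rewrite -addrA lerD2l lerDr mulrn_wge0// mulr_ge0.
Qed.

Lemma cabs_sum (I : Type) (s : seq I) (P : pred I) (F : I -> R[i]) :
  cabs (\sum_(i <- s | P i) F i) <= \sum_(i <- s | P i) cabs (F i).
Proof. exact: (@ler_norm_sum _ (Rcomplex R)). Qed.

Lemma cabs_prod (I : Type) (s : seq I) (P : pred I) (F : I -> R[i]) :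
  cabs (\prod_(i <- s | P i) F i) = \prod_(i <- s | P i) cabs (F i).
Proof. by elim/big_rec2: _ => [|i a b _ <-]; rewrite ?cabs1 ?cabsM. Qed.

Lemma cReD w v : complex.Re (w + v) = complex.Re w + complex.Re v.
Proof. by case: w v => [? ?] []. Qed.
Lemma cImD w v : complex.Im (w + v) = complex.Im w + complex.Im v.
Proof. by case: w v => [? ?] []. Qed.
Lemma cReN w : complex.Re (- w) = - complex.Re w. Proof. by case: w. Qed.
Lemma cImN w : complex.Im (- w) = - complex.Im w. Proof. by case: w. Qed.
Lemma cReM w v : complex.Re (w * v) =
  complex.Re w * complex.Re v - complex.Im w * complex.Im v.
Proof. by case: w v => [? ?] []. Qed.
Lemma cImM w v : complex.Im (w * v) =
  complex.Re w * complex.Im v + complex.Im w * complex.Re v.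
Proof. by case: w v => [? ?] []. Qed.

Lemma complex_eqP w v :
  complex.Re w = complex.Re v -> complex.Im w = complex.Im v -> w = v.
Proof. by case: w v => [? ?] [? ?] /= -> ->. Qed.

Lemma cexpE w : cexp w =
  (expR (complex.Re w) * cos (complex.Im w)) +i*
  (expR (complex.Re w) * sin (complex.Im w)).
Proof. by apply: complex_eqP; rewrite /cexp ?cReM ?cImM /= mul0r ?subr0 ?addr0. Qed.

Lemma cexp_i x : cexp ('i%C * x%:C) = cos x +i* sin x.
Proof. by rewrite cexpE cReM cImM/= !mul0r mulr0 subr0 add0r mul1r expR0 !mul1r. Qed.

Lemma cexpD w v : cexp (w + v) = cexp w * cexp v.
Proof.
rewrite !cexpE cReD cImD; apply: complex_eqP; rewrite ?cReM ?cImM /=.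
  by rewrite expRD cosD; ring.
by rewrite expRD sinD; ring.
Qed.

Lemma cexp0 : cexp (0 : R[i]) = 1.
Proof. by rewrite cexpE/= expR0 cos0 sin0 mulr1 mulr0. Qed.

Lemma cabs_cexp w : cabs (cexp w) = expR (complex.Re w).
Proof.
rewrite cexpE cabsE/= !exprMn -mulrDr cos2Dsin2 mulr1 sqrtr_sqr ger0_norm// expR_ge0.
Qed.

Lemma cabs_cexp_i x : cabs (cexp ('i%C * x%:C)) = 1.
Proof. by rewrite cabs_cexp cReM/= !mul0r mulr0 subr0 expR0. Qed.

Lemma cexp_neq0 w : cexp w != 0.
Proof. by rewrite -cabs_gt0 cabs_cexp expR_gt0. Qed.

Lemma cexpN w : cexp (- w) = (cexp w)^-1.
Proof.
by apply: (mulfI (cexp_neq0 w)); rewrite -cexpD subrr cexp0 divff ?cexp_neq0.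
Qed.

Lemma cexpB w v : cexp (w - v) = cexp w / cexp v.
Proof. by rewrite cexpD cexpN. Qed.

Lemma cexp_sum (I : Type) (s : seq I) (P : pred I) (F : I -> R[i]) :
  cexp (\sum_(i <- s | P i) F i) = \prod_(i <- s | P i) cexp (F i).
Proof. by apply: (big_morph cexp); [exact: cexpD|exact: cexp0]. Qed.

Lemma cexpX w n : cexp w ^+ n = cexp (w *+ n).
Proof. by elim: n => [|n IH]; rewrite ?expr0 ?mulr0n ?cexp0// exprS mulrS cexpD IH. Qed.

Lemma cexpXz w (n : int) : cexp w ^ n = cexp (w *~ n).
Proof.
case: n => n; first by rewrite -exprnP cexpX pmulrn.
by rewrite NegzE -exprnN cexpX -cexpN mulrNz pmulrn.
Qed.

Lemma abs_sin_le x : `|sin x| <= `|x|.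
Proof.
wlog x0 : x / 0 <= x.
  move=> H; have [/H//|x0] := leP 0 x.
  by rewrite -normrN -sinN -[leRHS]normrN; apply: H; rewrite oppr_ge0 ltW.
have [->|xn0] := eqVneq x 0; first by rewrite sin0.
have xgt0 : 0 < x by rewrite lt_neqAle eq_sym xn0.
have [t _] : exists2 t, t \in `]0, x[%R & sin x - sin 0 = cos t * (x - 0).
  by apply: MVT => // *; apply: continuous_subspaceT => ?; exact: continuous_sin.
rewrite sin0 !subr0 => ->; rewrite normrM.
by rewrite ler_piMl// cos_max.
Qed.

Lemma abs_cos1_le x : `|cos x - 1| <= x ^+ 2 / 2.
Proof.
have -> : cos x - 1 = - 2 * sin (x / 2) ^+ 2.
  by rewrite [in LHS](splitr x) cosD; have := cos2Dsin2 (x / 2); lra.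
rewrite mulNr normrN normrM normrX ger0_norm//.
have : `|sin (x / 2)| ^+ 2 <= `|x / 2| ^+ 2.
  by rewrite ler_sqr ?nnegrE// abs_sin_le.
rewrite !real_normK ?num_real// => h.
by apply: (le_trans (ler_wpM2l _ h)) => //; rewrite exprMn; lra.
Qed.

Lemma abs_sinB_le x : `|sin x - x| <= 2 * x ^+ 2.
Proof.
have [x1|x1] := lerP 1 `|x|.
  have : `|x| <= `|x| ^+ 2 by rewrite expr2 ler_peMl.
  rewrite real_normK ?num_real// => h.
  by apply: (le_trans (ler_normB _ _)); have := abs_sin_le x; lra.
wlog x0 : x x1 / 0 <= x.
  move=> H; have [/H->//|x0] := leP 0 x.
  have -> : `|sin x - x| = `|sin (- x) - - x| by rewrite sinN -opprD normrN.
  by rewrite -sqrrN; apply: H; rewrite ?normrN ?oppr_ge0 ?ltW.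
have [->|xn0] := eqVneq x 0; first by rewrite sin0 subrr normr0 expr0n/= mulr0.
have xgt0 : 0 < x by rewrite lt_neqAle eq_sym xn0.
have [t] : exists2 t, t \in `]0, x[%R & sin x - sin 0 = cos t * (x - 0).
  by apply: MVT => // *; apply: continuous_subspaceT => ?; exact: continuous_sin.
rewrite in_itv/= sin0 !subr0 => /andP[t0 tx] ->.
have -> : cos t * x - x = (cos t - 1) * x by ring.
rewrite normrM (ger0_norm x0).
have := abs_cos1_le t => h.
rewrite ger0_norm// in x1.
have t2 : t ^+ 2 <= x by apply: le_trans (ltW tx); rewrite expr2 ler_piMr ?ltW//; lra.
have : `|cos t - 1| * x <= x * x by rewrite ler_wpM2r//; lra.
by rewrite -expr2; have := sqr_ge0 x; lra.
Qed.

Lemma expR_le_half x : `|x| <= 2^-1 ->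
  [/\ expR x <= 2, `|expR x - 1| <= 2 * `|x| & `|expR x - 1 - x| <= 2 * x ^+ 2].
Proof.
move=> xh; have xl : x <= 2^-1 by apply: le_trans xh; exact: ler_norm.
have xl' : - 2^-1 <= x by move: xh; rewrite ler_norml => /andP[].
have h1 := expR_ge1Dx x.
have h2 := expR_ge1Dx (- x).
have h3 : expR x * (1 - x) <= 1.
  have := ler_wpM2l (expR_ge0 x) h2; rewrite expRxMexpNx_1; lra.
have e2 : expR x <= 2.
  have p : 0 < 1 - x by lra.
  rewrite -ler_pdivlMr// in h3; apply: (le_trans h3).
  by rewrite ler_pdivrMr//; lra.
have q : expR x - 1 - x <= 2 * x ^+ 2.
  have : (expR x - 1 - x) <= expR x * x ^+ 2.
    have : expR x * (1 - x) * (1 + x) <= 1 * (1 + x) by rewrite ler_wpM2r//; lra.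
    by nra.
  move/le_trans; apply; rewrite ler_wpM2r ?sqr_ge0//.
split => //; last by rewrite ger0_norm//; lra.
have [x0|x0] := leP 0 x.
  rewrite !ger0_norm//; last by lra.
  by nra.
rewrite (ltr0_norm x0) ler0_norm; first by lra.
by rewrite subr_le0 expR_le1 ltW.
Qed.

Lemma cabs_cexpB1D w : cabs w <= 2^-1 ->
  cabs (cexp w - 1 - w) <= 8 * cabs w ^+ 2.
Proof.
move=> wh; set a := complex.Re w; set b := complex.Im w.
have ah : `|a| <= 2^-1 by apply: le_trans wh; exact: cabs_Re.
have [e2 e1 e0] := expR_le_half ah.
have c1 := abs_cos1_le b; have s1 := abs_sinB_le b.
apply: (le_trans (cabs_leD _)); rewrite cabs_sqr -/a -/b.
rewrite cexpE !cReD !cImD !cReN !cImN/= -/a -/b subr0.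
have -> : expR a * cos b - 1 - a = expR a * (cos b - 1) + (expR a - 1 - a) by ring.
have -> : expR a * sin b - b = expR a * (sin b - b) + (expR a - 1) * b by ring.
have h1 : `|expR a * (cos b - 1)| <= 2 * (b ^+ 2 / 2).
  by rewrite normrM ler_pM// ger0_norm ?expR_ge0.
have h2 : `|expR a * (sin b - b)| <= 2 * (2 * b ^+ 2).
  by rewrite normrM ler_pM// ger0_norm ?expR_ge0.
have h3 : `|(expR a - 1) * b| <= 2 * `|a| * `|b| by rewrite normrM ler_pM.
have h4 : 2 * `|a| * `|b| <= a ^+ 2 + b ^+ 2.
  rewrite -(real_normK (num_real a)) -(real_normK (num_real b)).
  by have := sqr_ge0 (`|a| - `|b|); rewrite sqrrB -mulr_natl; lra.
have := sqr_ge0 a; have := sqr_ge0 b.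
have := ler_normD (expR a * (cos b - 1)) (expR a - 1 - a).
have := ler_normD (expR a * (sin b - b)) ((expR a - 1) * b).
lra.
Qed.

Lemma cabs_cexpB1 w : cabs w <= 2^-1 -> cabs (cexp w - 1) <= 5 * cabs w.
Proof.
move=> wh; have h := cabs_cexpB1D wh.
have := cabsD (cexp w - 1 - w) w; rewrite subrK.
have : cabs w ^+ 2 <= 2^-1 * cabs w by rewrite expr2 ler_wpM2r ?cabs_ge0.
lra.
Qed.

(** Its real part vanishes, and its imaginary part cannot leave 0 without taking
    some value strictly between 0 and [2 * pi] in modulus. *)
Lemma continuous_cexp_eq1 (D : R -> R[i]) :
  continuous (fun z => complex.Im (D z)) -> D 0 = 0 ->
  (forall z, cexp (D z) = 1) -> forall z, D z = 0.
Proof.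
move=> cD D0 D1 z.
have r0 y : complex.Re (D y) = 0.
  by apply: expR_inj; rewrite -cabs_cexp D1 cabs1 expR0.
have c1 y : cos (complex.Im (D y)) = 1.
  by have := D1 y; rewrite cexpE r0 expR0 !mul1r => -[].
apply: complex_eqP; rewrite ?r0//=.
apply/eqP/negPn/negP => y0.
set t := Num.min `|complex.Im (D z)| pi.
have t0 : 0 < t by rewrite lt_min normr_gt0 y0 pi_gt0.
have tpi : t <= pi by rewrite ge_min lexx orbT.
have ht : exists y, complex.Im (D y) = t \/ complex.Im (D y) = - t.
  have tz : t <= `|complex.Im (D z)| by rewrite ge_min lexx.
  have H (a b : R) (v : R) : a <= b -> Num.min (complex.Im (D a)) (complex.Im (D b)) <= v
       <= Num.max (complex.Im (D a)) (complex.Im (D b)) ->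
       exists y, complex.Im (D y) = v.
    move=> ab vab.
    have [|y _ <-] := @IVT R (fun z => complex.Im (D z)) a b v ab _ vab; last by exists y.
    exact: continuous_subspaceT.
  have D0' : complex.Im (D 0) = 0 by rewrite D0.
  have [v [vt vb]] : exists v : R, (v = t \/ v = - t) /\
     Num.min (complex.Im (D 0)) (complex.Im (D z)) <= v <=
     Num.max (complex.Im (D 0)) (complex.Im (D z)).
    rewrite D0'; have [zp|zn] := leP 0 (complex.Im (D z)).
      exists t; split; first by left.
      by rewrite (ger0_norm zp) in tz; rewrite (ltW t0).
    exists (- t); split; first by right.
    by rewrite (ltr0_norm zn) in tz; lra.
  have [z0|z0] := leP 0 z.
    by have [y yv] := H _ _ _ z0 vb; exists y; rewrite yv.
  rewrite minC maxC in vb.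
  by have [y yv] := H _ _ _ (ltW z0) vb; exists y; rewrite yv.
have ct : cos t = 1.
  by case: ht => y [|] e; have := c1 y; rewrite e ?cosN.
have : t = 0.
  apply: cos_inj; rewrite ?in_itv/= ?lexx ?pi_ge0 ?(ltW t0)//.
  by rewrite ct cos0.
by move=> t00; rewrite t00 ltxx in t0.
Qed.

(** * The logarithmic series *)

Definition logser (N : nat) (u : R[i]) : R[i] :=
  \sum_(k < N) (-1) ^+ k * (k.+1%:R^-1)%:C * u ^+ k.+1.

(** The factors are exchanged one at a time. *)
Lemma cabs_prodB (n : nat) (x y : nat -> R[i]) (B e : R) : 0 <= e -> 0 <= B ->
  (forall j, (j < n)%N -> cabs (x j) <= B) ->
  (forall j, (j < n)%N -> cabs (y j) <= B) ->
  (forall j, (j < n)%N -> cabs (x j - y j) <= e) -> 1 <= B ->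
  cabs (\prod_(j < n) x j - \prod_(j < n) y j) <= n%:R * e * B ^+ n.
Proof.
move=> e0 B0; elim: n => [|n IH] xB yB xy B1.
  by rewrite !big_ord0 subrr cabs0 !mul0r.
rewrite !big_ord_recr/=.
set X := \prod_(j < n) x j; set Y := \prod_(j < n) y j.
have -> : X * x n - Y * y n = X * (x n - y n) + (X - Y) * y n by ring.
have XB : cabs X <= B ^+ n.
  have -> : B ^+ n = \prod_(j < n) B by rewrite prodr_const card_ord.
  rewrite cabs_prod.
  by apply: ler_prod => i _; rewrite cabs_ge0 xB// ltnS ltnW.
apply: (le_trans (cabsD _ _)); rewrite !cabsM.
have h1 : cabs X * cabs (x n - y n) <= B ^+ n * e.
  by apply: ler_pM; rewrite ?cabs_ge0// xy.
have h2 : cabs (X - Y) * cabs (y n) <= (n%:R * e * B ^+ n) * B.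
  apply: ler_pM; rewrite ?cabs_ge0 ?yB//.
  by apply: IH => // j jn; rewrite ?xB ?yB ?xy// ltnS ltnW.
apply: (le_trans (lerD h1 h2)).
have h3 : B ^+ n <= B ^+ n.+1 by rewrite exprS ler_peMl// exprn_ge0.
have : B ^+ n * e <= B ^+ n.+1 * e by rewrite ler_wpM2r.
rewrite -!natr1 !exprS.
lra.
Qed.

(** The increment of [x ^ k.+1] over a step lies between the step times the values
    of [k.+1 * x ^ k] at its two ends, and the increments telescope. *)
Lemma riemann_sum_pow (n k : nat) : (0 < n)%N ->
  `|n%:R^-1 * \sum_(j < n) (j%:R / n%:R) ^+ k - k.+1%:R^-1| <= n%:R^-1 :> R.
Proof.
move=> n0; have n0' : 0 < n%:R :> R by rewrite ltr0n.
have step j : k.+1%:R * j%:R ^+ k <= (j.+1%:R ^+ k.+1 - j%:R ^+ k.+1 : R)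
    <= k.+1%:R * j.+1%:R ^+ k.
  have j1 : j.+1%:R = 1 + j%:R :> R by rewrite addrC natr1.
  rewrite j1 subrXX addrK mul1r.
  have b (i : 'I_k.+1) : (j%:R : R) ^+ k <= (1 + j%:R) ^+ (k - i) * j%:R ^+ i
       <= (1 + j%:R : R) ^+ k.
    have ik : (i <= k)%N by rewrite -ltnS.
    have jj : (j%:R : R) <= 1 + j%:R by rewrite lerDr.
    have e (y : R) : y ^+ k = y ^+ (k - i) * y ^+ i by rewrite -exprD subnK.
    apply/andP; split.
      by rewrite [leLHS]e ler_wpM2r ?exprn_ge0 ?lerXn2r ?nnegrE ?addr_ge0.
    by rewrite [leRHS]e ler_wpM2l ?exprn_ge0 ?lerXn2r ?nnegrE ?addr_ge0.
  have := @ler_sum R _ (index_enum 'I_k.+1) xpredT _ _ (fun i _ => proj1 (andP (b i))).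
  have := @ler_sum R _ (index_enum 'I_k.+1) xpredT _ _ (fun i _ => proj2 (andP (b i))).
  by rewrite !sumr_const card_ord !mulr_natl => -> ->.
pose S := \sum_(j < n) (j%:R : R) ^+ k.
have tel : \sum_(j < n) (j.+1%:R ^+ k.+1 - j%:R ^+ k.+1 : R) = n%:R ^+ k.+1.
  by rewrite -(big_mkord xpredT (fun j => j.+1%:R ^+ k.+1 - j%:R ^+ k.+1 : R))
     telescope_sumr// expr0n subr0.
have lo : k.+1%:R * S <= n%:R ^+ k.+1.
  rewrite -tel mulr_sumr; apply: ler_sum => j _.
  by have /andP[] := step j.
have hi : n%:R ^+ k.+1 <= k.+1%:R * (S + n%:R ^+ k).
  have -> : S + n%:R ^+ k = 0 ^+ k + \sum_(j < n) (j.+1%:R : R) ^+ k.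
    have := @big_ord_recl R 0 +%R n (fun j : 'I_n.+1 => (j : nat)%:R ^+ k).
    by rewrite big_ord_recr/= => ->.
  rewrite mulrDr -tel; apply: (@le_trans _ _ (k.+1%:R * \sum_(j < n) j.+1%:R ^+ k)).
    by rewrite mulr_sumr; apply: ler_sum => j _; have /andP[] := step j.
  by rewrite lerDr mulr_ge0// exprn_ge0.
have -> : n%:R^-1 * \sum_(j < n) (j%:R / n%:R) ^+ k = S / n%:R ^+ k.+1.
  rewrite /S mulr_sumr mulr_suml; apply: eq_bigr => j _.
  by rewrite expr_div_n exprS invfM; ring.
have nk : 0 < (n%:R : R) ^+ k by rewrite exprn_gt0.
have nk1 : 0 < (n%:R : R) ^+ k.+1 by rewrite exprn_gt0.
have k0 : 0 < (k.+1%:R : R) by rewrite ltr0n.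
rewrite ler_norml; apply/andP; split.
  rewrite lerBrDr -(ler_pM2r nk1) mulrDl -[X in _ <= X]mulrA mulVf ?gt_eqF// mulr1.
  rewrite -(ler_pM2l k0) mulrDr mulNr (mulrA k.+1%:R k.+1%:R^-1) divff ?gt_eqF// mul1r.
  by rewrite exprS mulrA mulVf ?gt_eqF// mul1r -exprS; lra.
rewrite lerBlDr.
apply: (@le_trans _ _ k.+1%:R^-1); last by rewrite lerDr invr_ge0 ltW.
by rewrite ler_pdivrMr// mulrC ler_pdivlMr// mulrC.
Qed.

(** The Riemann sums of [int_0^1 u / (1 + t u) dt] are sums of logarithms of
    factors of a telescoping product equal to [1 + u], and expanding the
    integrand in powers of [t] turns them into the logarithmic series.  This
    gives [exp (log (1 + u)) = 1 + u] without differentiating anything. *)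
Lemma cexp_logser_cvg (q : R) : 0 <= q -> q < 1 -> forall e, 0 < e ->
  exists N0, forall N, (N0 <= N)%N -> forall u, cabs u <= q ->
    cabs (cexp (logser N u) - (1 + u)) <= e.
Proof.
move=> q0 q1.
have p0 : 0 < 1 - q by lra.
pose K := (1 - q)^-1.
have K1 : 1 <= K by rewrite invf_ge1// lerBlDr lerDl.
have key N u : (0 < N)%N -> cabs u <= q -> K / N%:R <= 2^-1 ->
    (q ^+ N + N%:R^-1) * K <= 2^-1 ->
    cabs (cexp (logser N u) - (1 + u)) <=
    (expR K * (8 * K ^+ 2 / N%:R) + 2) * (5 * ((q ^+ N + N%:R^-1) * K)) +
    expR K * (8 * K ^+ 2 / N%:R).
  move=> N0 uq KN small.
  have N0' : 0 < N%:R :> R by rewrite ltr0n.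
  have Nn0 : N%:R != 0 :> R[i] by rewrite pnatr_eq0 -lt0n.
  pose t (j : nat) : R := j%:R / N%:R.
  have t0 j : 0 <= t j by rewrite divr_ge0.
  have t1 j : (j <= N)%N -> t j <= 1 by move=> jN; rewrite ler_pdivrMr// mul1r ler_nat.
  pose d (j : nat) := 1 + (t j)%:C * u.
  have tu j : (j <= N)%N -> cabs ((t j)%:C * u) <= q.
    move=> jN; rewrite cabsM cabs_real ger0_norm//.
    by apply: le_trans uq; rewrite ler_piMl ?cabs_ge0 ?t1.
  have dK j : (j <= N)%N -> cabs (d j)^-1 <= K.
    move=> jN; have : 1 - q <= cabs (d j).
      have := cabs_distD (d j) 1 0; rewrite !subr0 cabs1.
      have -> : 1 - d j = - ((t j)%:C * u) by rewrite /d opprD addrA subrr add0r.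
      by rewrite cabsN; have := tu _ jN; lra.
    by move=> dq; rewrite cabsV lef_pV2 ?posrE// (lt_le_trans p0).
  have dn0 j : (j <= N)%N -> d j != 0.
    move=> jN; apply/eqP => d0; have := tu _ jN.
    have -> : (t j)%:C * u = -1.
      by apply/eqP; rewrite -addr_eq0 addrC -/(d j) d0.
    by rewrite cabsN cabs1; lra.
  pose x (j : nat) := (u / N%:R) * (d j)^-1.
  have x1 j : (j < N)%N -> 1 + x j = d j.+1 / d j.
    move=> jN; apply: (mulIf (dn0 _ (ltnW jN))).
    rewrite divfK ?dn0 ?(ltnW jN)// mulrDl mul1r /x divfK ?dn0 ?(ltnW jN)//.
    rewrite /d /t -natr1 mulrDl rmorphD/= mul1r fmorphV rmorph_nat mulrDl.
    by rewrite addrA (mulrC u).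
  have d0 : d 0%N = 1 by rewrite /d /t mul0r mul0r addr0.
  have dN : d N = 1 + u by rewrite /d /t divff ?gt_eqF// mul1r.
  have tel : \prod_(j < N) (1 + x j) = 1 + u.
    rewrite -dN (eq_bigr (fun j : 'I_N => d j.+1 / d j)); last by move=> j _; exact: x1.
    have : forall n, (n <= N)%N -> \prod_(j < n) (d j.+1 / d j) = d n.
      elim=> [|n IH] nN; first by rewrite big_ord0 d0.
      by rewrite big_ord_recr/= IH 1?ltnW// mulrCA divff ?mulr1// dn0// ltnW.
    exact.
  have NC : cabs (N%:R : R[i])^-1 = N%:R^-1 :> R.
    by rewrite cabsV -(rmorph_nat (real_complex R)) cabs_real normr_nat.
  have xK j : (j < N)%N -> cabs (x j) <= K / N%:R.
    move=> jN; rewrite /x !cabsM NC mulrAC ler_wpM2r ?invr_ge0//.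
    rewrite -[leRHS]mul1r; apply: ler_pM; rewrite ?cabs_ge0//.
      exact: le_trans (ltW q1).
    by apply: dK; exact: ltnW.
  have KN0 : 0 <= K / N%:R by rewrite divr_ge0// (le_trans _ K1).
  (* the product of the exponentials is close to the telescoping product *)
  have prodE : cabs (cexp (\sum_(j < N) x j) - (1 + u)) <= expR K * (8 * K ^+ 2 / N%:R).
    rewrite -tel cexp_sum.
    have := @cabs_prodB N (fun j => cexp (x j)) (fun j => 1 + x j)
      (expR (K / N%:R)) (8 * (K / N%:R) ^+ 2).
    have -> : expR (K / N%:R) ^+ N = expR K.
      by rewrite -expRM_natl mulrC divfK ?gt_eqF.
    have -> : N%:R * (8 * (K / N%:R) ^+ 2) * expR K = expR K * (8 * K ^+ 2 / N%:R).
      by field; rewrite gt_eqF.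
    apply.
    - by rewrite mulr_ge0// sqr_ge0.
    - exact: expR_ge0.
    - move=> j jN; rewrite cabs_cexp ler_expR.
      by apply: (le_trans (ler_norm _)); apply: (le_trans (cabs_Re _)); exact: xK.
    - move=> j jN; apply: (le_trans (cabsD _ _)); rewrite cabs1.
      by apply: le_trans (expR_ge1Dx _); rewrite lerD2l xK.
    - move=> j jN; rewrite opprD addrA.
      apply: (le_trans (cabs_cexpB1D _)); first exact: le_trans (xK _ jN) KN.
      by rewrite ler_wpM2l// ler_sqr ?nnegrE ?cabs_ge0// xK.
    - by apply: le_trans (expR_ge1Dx _); rewrite lerDl.
  (* the sum of the increments is close to the truncated series *)
  have sumE : cabs (logser N u - \sum_(j < N) x j) <= (q ^+ N + N%:R^-1) * K.
    have xe j : (j < N)%N -> x j =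
        \sum_(k < N) (-1) ^+ k * u ^+ k.+1 * (N%:R^-1 * (t j) ^+ k)%:C
        + (u / N%:R) * ((- ((t j)%:C * u)) ^+ N / d j).
      move=> jN; have dj := dn0 _ (ltnW jN).
      have -> : \sum_(k < N) (-1) ^+ k * u ^+ k.+1 * (N%:R^-1 * (t j) ^+ k)%:C =
          (u / N%:R) * \sum_(k < N) (- ((t j)%:C * u)) ^+ k.
        rewrite mulr_sumr; apply: eq_bigr => k _.
        rewrite rmorphM/= fmorphV rmorph_nat rmorphXn/= (exprNn (_ * u)) exprMn exprS.
        by ring.
      rewrite -mulrDr /x; congr (_ * _).
      apply: (mulIf dj); rewrite mulVf// mulrDl divfK//.
      have := subrX1 (- ((t j)%:C * u)) N.
      rewrite /d; set y := (t j)%:C * u => h.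
      have -> : 1 + y = - (- y - 1) by rewrite opprB opprK.
      by rewrite mulrN mulrC -h opprB subrK.
    rewrite (eq_bigr _ (fun j _ => xe _ (ltn_ord j))) big_split/= exchange_big/=.
    rewrite opprD addrA.
    apply: (le_trans (cabsB _ _)).
    rewrite mulrDl [leRHS]addrC; apply: lerD; last first.
      apply: (le_trans (cabs_sum _ _ _)).
      apply: (@le_trans _ _ (\sum_(j < N) (q ^+ N * K * N%:R^-1))).
        apply: ler_sum => j _; rewrite !cabsM NC mulrAC ler_wpM2r ?invr_ge0//.
        rewrite -[leRHS]mul1r; apply: ler_pM; rewrite ?cabs_ge0//.
        - by rewrite -cabsM cabs_ge0.
        - exact: le_trans (ltW q1).
        - apply: ler_pM; rewrite ?cabs_ge0//; last by apply: dK; exact: ltnW.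
          by rewrite cabsX lerXn2r ?nnegrE ?cabs_ge0// cabsN tu// ltnW.
      by rewrite sumr_const card_ord -[_ *+ N]mulr_natr divfK ?gt_eqF.
    rewrite /logser -sumrB.
    apply: (le_trans (cabs_sum _ _ _)).
    apply: (@le_trans _ _ (\sum_(k < N) q ^+ k * N%:R^-1)).
      apply: ler_sum => k _.
      rewrite -mulr_sumr -rmorph_sum/= -mulr_sumr.
      set A := _ * \sum_(i < N) _.
      have -> : (-1) ^+ k * (k.+1%:R^-1)%:C * u ^+ k.+1 - (-1) ^+ k * u ^+ k.+1 * A%:C =
                ((-1) ^+ k * u ^+ k.+1) * (k.+1%:R^-1 - A)%:C.
        by rewrite rmorphB/=; ring.
      rewrite !cabsM cabsX cabsN cabs1 expr1n mul1r cabs_real distrC.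
      apply: ler_pM; rewrite ?cabs_ge0//; last exact: riemann_sum_pow.
      rewrite cabsX exprS -[leRHS]mul1r; apply: ler_pM; rewrite ?exprn_ge0 ?cabs_ge0//.
        exact: le_trans (ltW q1).
      by rewrite lerXn2r ?nnegrE ?cabs_ge0.
    rewrite -mulr_suml mulrC ler_wpM2l ?invr_ge0//.
    have := subrX1 q N => h.
    rewrite -[leRHS]mul1r ler_pdivlMr// mulrC -opprB mulNr -h opprB lerBlDr lerDl.
    exact: exprn_ge0.
  (* transfer through the exponential *)
  set S := \sum_(j < N) x j in prodE sumE *.
  set D := (q ^+ N + N%:R^-1) * K in small sumE *.
  have SK : cabs (cexp S) <= expR K * (8 * K ^+ 2 / N%:R) + 2.
    have := cabsD (cexp S - (1 + u)) (1 + u); rewrite subrK.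
    have := cabsD 1 u; rewrite cabs1; lra.
  have -> : cexp (logser N u) - (1 + u) =
     cexp S * (cexp (logser N u - S) - 1) + (cexp S - (1 + u)).
    by rewrite mulrBr -cexpD mulr1 [S + _]addrC subrK; ring.
  have cu : cabs (cexp (logser N u - S) - 1) <= 5 * D.
    apply: (le_trans (cabs_cexpB1 _)); first exact: le_trans sumE small.
    by rewrite ler_wpM2l.
  apply: (le_trans (cabsD _ _)); rewrite cabsM lerD//.
  by apply: ler_pM; rewrite ?cabs_ge0.
move=> e e0; set C := expR K * (8 * K ^+ 2).
have C0 : 0 <= C by rewrite mulr_ge0 ?expR_ge0// mulr_ge0// sqr_ge0.
pose m := Num.min 1 e.
have m0 : 0 < m by rewrite lt_min ltr01.
have m1 : m <= 1 by rewrite ge_min lexx.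
have me : m <= e by rewrite ge_min lexx orbT.
pose c := m / (60 * (C + K)).
have CK0 : 0 < C + K by rewrite ltr_wpDl// (lt_le_trans _ K1).
have c0 : 0 < c by rewrite divr_gt0// mulr_gt0.
have cCK : c * (C + K) = m / 60 by rewrite /c; field; rewrite gt_eqF.
have cC : c * C <= m / 60 by rewrite -cCK ler_wpM2l ?(ltW c0)// lerDl (le_trans _ K1).
have cK : c * K <= m / 60 by rewrite -cCK ler_wpM2l ?(ltW c0)// lerDr.
have [N1 qN] : exists N1, forall N, (N1 <= N)%N -> q ^+ N <= c.
  have q1' : `|q| < 1 by rewrite ger0_norm.
  have /cvgrPdist_le/(_ _ c0) [N1 _ h] := cvg_expr q1'.
  exists N1 => N N1N; have := h _ N1N.
  by rewrite /= sub0r normrN ger0_norm// exprn_ge0.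
have [N2 _ nN] := near_infty_natSinv_lt (PosNum c0).
exists (maxn N1 N2).+1 => -[//|N]; rewrite ltnS geq_max => /andP[N1N N2N] u uq.
have h1 := qN _ (leqW N1N).
have h2 := ltW (nN _ N2N); rewrite /= in h2.
set i := N.+1%:R^-1 in h2 *.
have i0 : 0 <= i by rewrite invr_ge0.
have iK : K * i <= m / 60.
  by apply: le_trans cK; rewrite mulrC ler_wpM2r// (le_trans _ K1).
have D0 : (q ^+ N.+1 + i) * K <= m / 30.
  apply: (@le_trans _ _ ((c + c) * K)); last by lra.
  by rewrite ler_wpM2r ?lerD// (le_trans _ K1).
have E0 : expR K * (8 * K ^+ 2 * i) <= m / 60.
  by rewrite mulrA; apply: le_trans cC; rewrite mulrC ler_wpM2r.
have h3 : K / N.+1%:R <= 2^-1 by rewrite -/i; lra.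
have h4 : (q ^+ N.+1 + N.+1%:R^-1) * K <= 2^-1 by rewrite -/i; lra.
apply: (le_trans (key _ _ (ltn0Sn N) uq h3 h4)); rewrite -/i.
have D1 : 0 <= (q ^+ N.+1 + i) * K.
  by rewrite mulr_ge0 ?addr_ge0 ?exprn_ge0// (le_trans _ K1).
have : (expR K * (8 * K ^+ 2 * i) + 2) * (5 * ((q ^+ N.+1 + i) * K)) <= 3 * (5 * (m / 30)).
  apply: ler_pM; try lra.
  by rewrite addr_ge0// mulr_ge0 ?expR_ge0// mulr_ge0// mulr_ge0// sqr_ge0.
lra.
Qed.

End complex_exponential.

(** * Laurent polynomials on the unit circle *)

Section laurent.
Context {R : realType}.
Implicit Types (w u : R[i]) (x z M : R) (F G : R -> R[i]).

Local Notation cabs := (ComplexField.Normc.normc).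

Definition cis z : R[i] := cexp ('i%C * z%:C).

Lemma cabs_cis z : cabs (cis z) = 1. Proof. exact: cabs_cexp_i. Qed.

Lemma cis_neq0 z : cis z != 0. Proof. exact: cexp_neq0. Qed.

Lemma cisXz z (n : int) : cis z ^ n = cexp ('i%C * (n%:~R * z)%:C).
Proof.
rewrite /cis cexpXz -mulrzr rmorphM/= rmorph_int; congr cexp; ring.
Qed.

Lemma cabsXz w (n : int) : cabs (w ^ n) = cabs w ^ n.
Proof. by case: n => n; rewrite ?NegzE -?exprnN -?exprnP ?cabsV cabsX. Qed.

Lemma cabs_cisXz z (n : int) : cabs (cis z ^ n) = 1.
Proof. by rewrite cabsXz cabs_cis exp1rz. Qed.

(** A Laurent polynomial is a list of coefficients and exponents; repeated
    exponents are allowed, which makes sums and products concatenations. *)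
Definition laurent := seq (R[i] * int).

Definition leval (s : laurent) w : R[i] := \sum_(t <- s) t.1 * w ^ t.2.

Definition lnorm (s : laurent) : R := \sum_(t <- s) cabs t.1.

Definition lmul (s t : laurent) : laurent :=
  [seq (a.1 * b.1, a.2 + b.2) | a <- s, b <- t].

Lemma leval_cat s t w : leval (s ++ t) w = leval s w + leval t w.
Proof. exact: big_cat. Qed.

Lemma leval_nil w : leval [::] w = 0. Proof. exact: big_nil. Qed.

Lemma leval_cons a s w : leval (a :: s) w = a.1 * w ^ a.2 + leval s w.
Proof. exact: big_cons. Qed.

Lemma leval_seq1 a w : leval [:: a] w = a.1 * w ^ a.2.
Proof. exact: big_seq1. Qed.

Lemma leval_mul s t w : w != 0 -> leval (lmul s t) w = leval s w * leval t w.
Proof.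
move=> w0; rewrite /leval /lmul big_allpairs_dep mulr_suml; apply: eq_bigr => x _.
rewrite mulr_sumr; apply: eq_bigr => y _.
by rewrite /= expfzDr//; ring.
Qed.

Lemma lnorm_ge0 s : 0 <= lnorm s.
Proof. by apply: sumr_ge0 => t _; exact: cabs_ge0. Qed.

Lemma lnorm_cat s t : lnorm (s ++ t) = lnorm s + lnorm t.
Proof. exact: big_cat. Qed.

Lemma lnorm_mul s t : lnorm (lmul s t) = lnorm s * lnorm t.
Proof.
rewrite /lnorm /lmul big_allpairs_dep mulr_suml; apply: eq_bigr => x _.
by rewrite mulr_sumr; apply: eq_bigr => y _; rewrite /= cabsM.
Qed.

Lemma cabs_leval s z : cabs (leval s (cis z)) <= lnorm s.
Proof.
apply: (le_trans (cabs_sum _ _ _)); apply: ler_sum => t _.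
by rewrite cabsM cabs_cisXz mulr1.
Qed.

(** * The Wiener algebra *)

(** [wiener M F] plays the role of a bound [M] on the sum of the moduli of the
    Fourier coefficients of [F].  Phrased through uniform approximation by
    trigonometric polynomials of norm at most [M], the bound is visibly
    submultiplicative and stable under uniform limits, and no infinite
    convolution is ever formed. *)
Definition wiener M F := forall e, 0 < e -> exists s : laurent,
  lnorm s <= M /\ forall z, cabs (F z - leval s (cis z)) <= e.

Lemma wiener_ge0 M F : wiener M F -> 0 <= M.
Proof. by move=> /(_ 1 ltr01)[s [sM _]]; exact: le_trans (lnorm_ge0 s) sM. Qed.

Lemma wiener_le M M' F : M <= M' -> wiener M F -> wiener M' F.
Proof.
by move=> MM' W e e0; have [s [sM h]] := W e e0; exists s; split=> //; apply: le_trans MM'.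
Qed.

Lemma wiener_bounded M F : wiener M F -> forall z, cabs (F z) <= M.
Proof.
move=> W z; apply/ler_addgt0Pr => e e0; have [s [sM h]] := W e e0.
rewrite -[F z](subrK (leval s (cis z))); apply: (le_trans (cabsD _ _)).
rewrite addrC lerD//; exact: le_trans (cabs_leval _ _) sM.
Qed.

Lemma wiener_leval s : wiener (lnorm s) (fun z => leval s (cis z)).
Proof. by move=> e e0; exists s; split=> // z; rewrite subrr cabs0 ltW. Qed.

Lemma wiener_mono a (n : int) : wiener (cabs a) (fun z => a * cis z ^ n).
Proof.
have := wiener_leval [:: (a, n)]; rewrite /lnorm big_seq1/=.
by under eq_fun do rewrite leval_seq1.
Qed.

Lemma wiener_cst a : wiener (cabs a) (fun=> a).
Proof.
have := wiener_mono a 0.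
by under eq_fun do rewrite expr0z mulr1.
Qed.

Lemma wienerD M M' F G : wiener M F -> wiener M' G ->
  wiener (M + M') (fun z => F z + G z).
Proof.
move=> WF WG e e0; have e20 : 0 < e / 2 by rewrite divr_gt0.
have [s [sM hs]] := WF _ e20; have [t [tM ht]] := WG _ e20.
exists (s ++ t); split; first by rewrite lnorm_cat lerD.
move=> z; rewrite leval_cat.
have -> : F z + G z - (leval s (cis z) + leval t (cis z)) =
  (F z - leval s (cis z)) + (G z - leval t (cis z)) by ring.
by apply: (le_trans (cabsD _ _)); rewrite (splitr e) lerD.
Qed.

Lemma wienerM M M' F G : wiener M F -> wiener M' G ->
  wiener (M * M') (fun z => F z * G z).
Proof.
move=> WF WG e e0.
have M0 := wiener_ge0 WF; have M'0 := wiener_ge0 WG.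
have MM : 0 < M + M' + 1 by rewrite ltr_wpDl ?addr_ge0.
pose e' := e / (M + M' + 1).
have e'0 : 0 < e' by rewrite divr_gt0.
have [s [sM hs]] := WF _ e'0; have [t [tM ht]] := WG _ e'0.
exists (lmul s t); split; first by rewrite lnorm_mul ler_pM ?lnorm_ge0.
move=> z; rewrite leval_mul ?cis_neq0//.
set S := leval s _; set T := leval t _.
have -> : F z * G z - S * T = F z * (G z - T) + (F z - S) * T by ring.
apply: (le_trans (cabsD _ _)); rewrite !cabsM.
have h1 : cabs (F z) * cabs (G z - T) <= M * e'.
  by apply: ler_pM; rewrite ?cabs_ge0 ?(wiener_bounded WF)// ht.
have h2 : cabs (F z - S) * cabs T <= e' * M'.
  apply: ler_pM; rewrite ?cabs_ge0 ?hs//.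
  exact: le_trans (cabs_leval _ _) tM.
apply: (le_trans (lerD h1 h2)).
have -> : M * e' + e' * M' = (M + M') * e' by ring.
rewrite /e' mulrCA ger_pMr// ler_pdivrMr// mul1r; lra.
Qed.

Lemma wienerZ a M F : wiener M F -> wiener (cabs a * M) (fun z => a * F z).
Proof. exact: wienerM (wiener_cst a). Qed.

Lemma wienerX M F n : wiener M F -> wiener (M ^+ n) (fun z => F z ^+ n).
Proof.
move=> W; elim: n => [|n IH].
  by rewrite expr0 -cabs1; under eq_fun do rewrite expr0; exact: wiener_cst.
by rewrite exprS; under eq_fun do rewrite exprS; exact: wienerM.
Qed.

Lemma wiener_sum (n : nat) (M : nat -> R) (F : nat -> R -> R[i]) :
  (forall k, wiener (M k) (F k)) ->
  wiener (\sum_(k < n) M k) (fun z => \sum_(k < n) F k z).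
Proof.
move=> W; elim: n => [|n IH].
  by rewrite big_ord0 -cabs0; under eq_fun do rewrite big_ord0; exact: wiener_cst.
rewrite big_ord_recr/=.
have -> : (fun z => \sum_(k < n.+1) F k z) = (fun z => \sum_(k < n) F k z + F n z).
  by apply/funext => z; rewrite big_ord_recr.
exact: wienerD.
Qed.

Lemma wiener_lim M F : (forall e, 0 < e -> exists G, wiener M G /\
  forall z, cabs (F z - G z) <= e) -> wiener M F.
Proof.
move=> H e e0; have e20 : 0 < e / 2 by rewrite divr_gt0.
have [G [WG FG]] := H _ e20; have [s [sM hs]] := WG _ e20.
exists s; split=> // z; apply: (le_trans (cabs_distD (G z) _ _)).
by rewrite (splitr e) lerD.
Qed.

End laurent.

(** * Laurent approximation on an annulus *)

Section annulus.
Context {R : realType}.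
Implicit Types (w u : R[i]) (r e q : R) (F G : R[i] -> R[i]).

Local Notation cabs := (ComplexField.Normc.normc).

Definition annulus r w := r^-1 <= cabs w <= r.

(** Uniform limits of Laurent polynomials on an annulus stand for the functions
    analytic on it; closure properties replace contour integrals. *)
Definition annulus_approx r (G : R[i] -> R[i]) := forall e, 0 < e ->
  exists s : laurent, forall w, annulus r w -> cabs (G w - leval s w) <= e.

Lemma annulus_neq0 r w : 0 < r -> annulus r w -> w != 0.
Proof. by move=> r0 /andP[rw _]; rewrite -cabs_gt0 (lt_le_trans _ rw) ?invr_gt0. Qed.

Lemma leval_annulus_bounded r s : 1 < r -> exists2 B, 0 <= B &
  forall w, annulus r w -> cabs (leval s w) <= B.
Proof.
move=> r1; have r0 : 0 < r := lt_trans ltr01 r1.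
exists (\sum_(t <- s) cabs t.1 * r ^+ `|t.2|%N).
  by apply: sumr_ge0 => t _; rewrite mulr_ge0 ?cabs_ge0 ?exprn_ge0 ?ltW.
move=> w aw; have w0 := annulus_neq0 r0 aw; have /andP[rw wr] := aw.
apply: (le_trans (cabs_sum _ _ _)); apply: ler_sum => t _.
rewrite cabsM ler_wpM2l ?cabs_ge0// cabsXz.
have cw0 : 0 < cabs w by rewrite cabs_gt0.
case: (t.2) => n; rewrite ?NegzE -?exprnN -?exprnP ?abszN ?absz_nat.
  by rewrite lerXn2r ?nnegrE ?cabs_ge0 ?(ltW r0).
by rewrite -exprVn lerXn2r ?nnegrE ?invr_ge0 ?cabs_ge0 ?(ltW r0)// -[leRHS]invrK lef_pV2 ?posrE ?invr_gt0.
Qed.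

Lemma annulus_approx_leval r s : annulus_approx r (leval s).
Proof. by move=> e e0; exists s => w _; rewrite subrr cabs0 ltW. Qed.

Lemma annulus_approx_eq r F G : (forall w, annulus r w -> F w = G w) ->
  annulus_approx r F -> annulus_approx r G.
Proof. by move=> FG UF e e0; have [s hs] := UF e e0; exists s => w aw; rewrite -FG// hs. Qed.

Lemma annulus_approxM r F G : 1 < r -> annulus_approx r F -> annulus_approx r G ->
  annulus_approx r (fun w => F w * G w).
Proof.
move=> r1 UF UG e e0; have r0 : 0 < r := lt_trans ltr01 r1.
have [s1 hs1] := UF _ ltr01.
have [B1 B10 hB1] := leval_annulus_bounded s1 r1.
have FB w : annulus r w -> cabs (F w) <= B1 + 1.
  move=> aw; rewrite -[F w](subrK (leval s1 w)) addrC.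
  by apply: (le_trans (cabsD _ _)); rewrite lerD ?hB1 ?hs1.
have p1 : 0 < B1 + 1 by lra.
have e10 : 0 < e / 2 / (B1 + 1) by rewrite !divr_gt0.
have [t ht] := UG _ e10.
have [B2 B20 hB2] := leval_annulus_bounded t r1.
have p2 : 0 < B2 + 1 by lra.
have e20 : 0 < e / 2 / (B2 + 1) by rewrite !divr_gt0.
have [s hs] := UF _ e20.
exists (lmul s t) => w aw; rewrite leval_mul ?(annulus_neq0 r0 aw)//.
set S := leval s w; set T := leval t w.
have -> : F w * G w - S * T = F w * (G w - T) + (F w - S) * T by ring.
apply: (le_trans (cabsD _ _)); rewrite !cabsM (splitr e); apply: lerD.
  rewrite -[leRHS](divfK (lt0r_neq0 p1)) mulrC.
  by apply: ler_pM; rewrite ?cabs_ge0 ?FB ?ht.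
rewrite -[leRHS](divfK (lt0r_neq0 p2)).
apply: ler_pM; rewrite ?cabs_ge0 ?hs//.
by apply: (le_trans (hB2 _ aw)); lra.
Qed.

Lemma annulus_approxX r F n : 1 < r -> annulus_approx r F ->
  annulus_approx r (fun w => F w ^+ n).
Proof.
move=> r1 UF; elim: n => [|n IH].
  apply: (@annulus_approx_eq _ (leval [:: (1, 0)])); last exact: annulus_approx_leval.
  by move=> w _; rewrite leval_seq1 expr0 mul1r expr0z.
by under eq_fun do rewrite exprS; exact: annulus_approxM.
Qed.

(** The partial sums of the geometric series are Laurent polynomials, and the
    bound [q < 1] makes their convergence uniform. *)
Lemma annulus_approx_geometric r b (n : int) q : 1 < r -> 0 <= q -> q < 1 ->
  (forall w, annulus r w -> cabs (b * w ^ n) <= q) ->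
  annulus_approx r (fun w => (1 - b * w ^ n)^-1).
Proof.
move=> r1 q0 q1 hq e e0; have r0 : 0 < r := lt_trans ltr01 r1.
have p0 : 0 < 1 - q by lra.
have q1' : `|q| < 1 by rewrite ger0_norm.
have c0 : 0 < e * (1 - q) by rewrite mulr_gt0.
have /cvgrPdist_le/(_ _ c0) [N _ h] := cvg_expr q1'.
have {h} qN : q ^+ N <= e * (1 - q).
  by have := h N (leqnn N); rewrite /= sub0r normrN ger0_norm// exprn_ge0.
exists [seq (b ^+ k, n * k%:Z) | k <- iota 0 N] => w aw.
have w0 := annulus_neq0 r0 aw; set u := b * w ^ n.
have -> : leval [seq (b ^+ k, n * k%:Z) | k <- iota 0 N] w = \sum_(k < N) u ^+ k.
  rewrite /leval big_map -(big_mkord xpredT (fun k => u ^+ k)) /index_iota subn0.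
  by apply: eq_bigr => k _ /=; rewrite exprMn -exprz_exp exprnP.
have uq : cabs u <= q by exact: hq.
have du : 1 - q <= cabs (1 - u).
  by have := cabsD (1 - u) u; rewrite subrK cabs1; lra.
have u1 : 1 - u != 0 by rewrite -cabs_gt0; lra.
have -> : (1 - u)^-1 - \sum_(k < N) u ^+ k = u ^+ N / (1 - u).
  apply: (mulIf u1); rewrite divfK// mulrBl mulVf//.
  have := subrX1 u N; set S := \sum_(i < N) _ => h.
  have -> : S * (1 - u) = - ((u - 1) * S) by ring.
  by rewrite -h; ring.
rewrite cabsM cabsV cabsX ler_pdivrMr; last by lra.
apply: (@le_trans _ _ (q ^+ N)); first by rewrite lerXn2r ?nnegrE ?cabs_ge0.
by apply: (le_trans qN); rewrite ler_pM2l.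
Qed.

(** A pole on either side of the annulus leaves a geometric series, in [w / a] or
    in [a / w]. *)
Lemma annulus_approx_root r a : 1 < r -> ~ annulus r a ->
  annulus_approx r (fun w => (w - a)^-1).
Proof.
move=> r1 na; have r0 : 0 < r := lt_trans ltr01 r1.
have [ar|ar] := ltP r (cabs a).
- have ca0 : 0 < cabs a := lt_trans r0 ar.
  have a0 : a != 0 by rewrite -cabs_gt0.
  apply: (@annulus_approx_eq _ (fun w => leval [:: (- a^-1, 0)] w * (1 - a^-1 * w ^ (1 : int))^-1)).
    move=> w aw; rewrite leval_seq1 expr0z mulr1 expr1z/=.
    have wa : w - a != 0.
      apply/eqP => /subr0_eq e; move: aw; rewrite e => /andP[_].
      by rewrite leNgt ar.
    by field; rewrite a0 wa/= ; rewrite -opprB oppr_eq0.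
  apply: annulus_approxM => //; first exact: annulus_approx_leval.
  apply: (@annulus_approx_geometric _ _ _ (r / cabs a)) => //.
  + by rewrite divr_ge0 ?ltW.
  + by rewrite ltr_pdivrMr// mul1r.
  + move=> w /andP[_ wr]; rewrite expr1z cabsM cabsV mulrC.
    by rewrite ler_wpM2r ?invr_ge0 ?cabs_ge0.
- have {}ar : cabs a < r^-1.
    by rewrite ltNge; apply/negP => h; apply: na; rewrite /annulus h ar.
  apply: (@annulus_approx_eq _ (fun w => leval [:: (1, -1)] w * (1 - a * w ^ (-1 : int))^-1)).
    move=> w aw; have w0 := annulus_neq0 r0 aw.
    rewrite leval_seq1 mul1r/= -invr_expz expr1z.
    have wa : w - a != 0.
      apply/eqP => /subr0_eq e; move: aw; rewrite e => /andP[].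
      by rewrite leNgt ar.
    by field; rewrite w0 wa.
  apply: annulus_approxM => //; first exact: annulus_approx_leval.
  apply: (@annulus_approx_geometric _ _ _ (cabs a * r)) => //.
  + by rewrite mulr_ge0 ?cabs_ge0 ?ltW.
  + by rewrite -ltr_pdivlMr// mul1r.
  + move=> w aw; have w0 := annulus_neq0 r0 aw; have /andP[rw _] := aw.
    rewrite -invr_expz expr1z cabsM cabsV ler_wpM2l ?cabs_ge0//.
    by rewrite -[leRHS]invrK lef_pV2 ?posrE ?invr_gt0// cabs_gt0.
Qed.

End annulus.

(** * Integrals of complex functions *)

Section complex_integral.
Context {R : realType}.
Implicit Types (m : {measure set (borelR R) -> \bar R}) (D : set (borelR R)).
Implicit Types (F G : R -> R[i]).

Local Notation cabs := (ComplexField.Normc.normc).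

Definition cintegrable m D F :=
  m.-integrable D (EFin \o (fun x => complex.Re (F x))) /\
  m.-integrable D (EFin \o (fun x => complex.Im (F x))).

(** Boundedness makes these functions integrable against all finite measures, and
    they form an algebra. *)
Definition bmeas F := [/\ measurable_fun setT ((fun x => complex.Re (F x)) : borelR R -> R),
  measurable_fun setT ((fun x => complex.Im (F x)) : borelR R -> R) &
  exists M : R, forall x, cabs (F x) <= M].

Lemma bounded_integrable m D (f : R -> R) : measurable D -> (m D < +oo)%E ->
  measurable_fun setT (f : borelR R -> R) -> (exists M, forall x, `|f x| <= M) ->
  m.-integrable D (EFin \o f).
Proof.
move=> mD mDoo mf [M fM]; apply: measurable_bounded_integrable => //.
  exact: measurable_funTS.
exists M; split; first exact: num_real.
by move=> N MN x _; apply: le_trans (fM x) (ltW MN).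
Qed.

Lemma bmeas_cintegrable m D F : measurable D -> (m D < +oo)%E -> bmeas F ->
  cintegrable m D F.
Proof.
move=> mD mDoo [m1 m2 [M FM]]; split; apply: bounded_integrable => //; exists M => x.
  exact: le_trans (cabs_Re _) (FM x).
exact: le_trans (cabs_Im _) (FM x).
Qed.

Lemma bmeasD F G : bmeas F -> bmeas G -> bmeas (fun x => F x + G x).
Proof.
move=> [f1 f2 [M FM]] [g1 g2 [N GN]]; split.
- by under eq_fun do rewrite cReD; exact: measurable_funD.
- by under eq_fun do rewrite cImD; exact: measurable_funD.
- by exists (M + N) => x; apply: (le_trans (cabsD _ _)); rewrite lerD.
Qed.

Lemma bmeasM F G : bmeas F -> bmeas G -> bmeas (fun x => F x * G x).
Proof.
move=> [f1 f2 [M FM]] [g1 g2 [N GN]]; split.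
- by under eq_fun do rewrite cReM; apply: measurable_funB; exact: measurable_funM.
- by under eq_fun do rewrite cImM; apply: measurable_funD; exact: measurable_funM.
- by exists (M * N) => x; rewrite cabsM ler_pM ?cabs_ge0.
Qed.

Lemma bmeas_cst a : bmeas (fun=> a).
Proof. by split; [exact: measurable_cst|exact: measurable_cst|exists (cabs a)]. Qed.

Lemma bmeasN F : bmeas F -> bmeas (fun x => - F x).
Proof.
by move=> bF; under eq_fun do rewrite -mulN1r; apply: bmeasM => //; exact: bmeas_cst.
Qed.

Lemma bmeasB F G : bmeas F -> bmeas G -> bmeas (fun x => F x - G x).
Proof. by move=> bF bG; apply: bmeasD => //; exact: bmeasN. Qed.

Lemma bmeas_sum (I : Type) (s : seq I) (H : I -> R -> R[i]) :
  (forall i, bmeas (H i)) -> bmeas (fun x => \sum_(i <- s) H i x).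
Proof.
move=> bH; elim: s => [|i s IH].
  by under eq_fun do rewrite big_nil; exact: bmeas_cst.
by under eq_fun do rewrite big_cons; exact: bmeasD.
Qed.

Lemma cabs_conj (w : R[i]) : cabs (conjc w) = cabs w.
Proof. by rewrite !cabsE; case: w => a b /=; rewrite sqrrN. Qed.

Lemma bmeas_conj F : bmeas F -> bmeas (fun x => conjc (F x)).
Proof.
move=> [f1 f2 [M FM]]; split.
- by rewrite (_ : (fun x => _) = (fun x => complex.Re (F x)))//; apply/funext => x; case: (F x).
- rewrite (_ : (fun x => _) = (fun x => - complex.Im (F x))); last first.
    by apply/funext => x; case: (F x).
  exact: measurableT_comp.
- by exists M => x; rewrite cabs_conj.
Qed.

Lemma continuous_bmeas F (M : R) : continuous (fun x => complex.Re (F x)) ->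
  continuous (fun x => complex.Im (F x)) -> (forall x, cabs (F x) <= M) -> bmeas F.
Proof.
move=> c1 c2 FM; split; [exact: continuous_measurable_fun|exact: continuous_measurable_fun|].
by exists M.
Qed.

Lemma continuous_addf (f g : R -> R) : continuous f -> continuous g ->
  continuous (fun x => f x + g x).
Proof. by move=> cf cg x; apply: cvgD; [exact: cf|exact: cg]. Qed.

Lemma continuous_mulf (f g : R -> R) : continuous f -> continuous g ->
  continuous (fun x => f x * g x).
Proof. by move=> cf cg x; apply: cvgM; [exact: cf|exact: cg]. Qed.

Lemma continuous_oppf (f : R -> R) : continuous f -> continuous (fun x => - f x).
Proof. by move=> cf x; apply: cvgN; exact: cf. Qed.

Lemma continuous_lin (a : R) : continuous (fun x : R => a * x).
Proof. by move=> x; exact: mulrl_continuous. Qed.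

Lemma continuous_cos_lin (a : R) : continuous (fun x : R => cos (a * x)).
Proof.
move=> x; apply: (@continuous_comp _ _ _ (fun x : R => a * x) cos).
  exact: continuous_lin.
exact: continuous_cos.
Qed.

Lemma continuous_sin_lin (a : R) : continuous (fun x : R => sin (a * x)).
Proof.
move=> x; apply: (@continuous_comp _ _ _ (fun x : R => a * x) sin).
  exact: continuous_lin.
exact: continuous_sin.
Qed.

Lemma continuous_cexp_iRe (z : R) : continuous (fun x : R => complex.Re (cexp ('i%C * (z * x)%:C))).
Proof.
under eq_fun do rewrite cexp_i/=.
exact: continuous_cos_lin.
Qed.

Lemma continuous_cexp_iIm (z : R) : continuous (fun x : R => complex.Im (cexp ('i%C * (z * x)%:C))).
Proof.
under eq_fun do rewrite cexp_i/=.
exact: continuous_sin_lin.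
Qed.

Lemma bmeas_cexp_i (z : R) : bmeas (fun x => cexp ('i%C * (z * x)%:C)).
Proof.
apply: (@continuous_bmeas _ 1); [exact: continuous_cexp_iRe|exact: continuous_cexp_iIm|].
by move=> x; rewrite cabs_cexp_i.
Qed.

Lemma eq_cintegral m D F G : (forall x, D x -> F x = G x) ->
  cintegral m D F = cintegral m D G.
Proof.
move=> FG; rewrite /cintegral; congr (_ +i* _); apply: eq_Rintegral => x.
  by rewrite inE => /FG ->.
by rewrite inE => /FG ->.
Qed.

Lemma cintegralD m D F G : measurable D -> cintegrable m D F -> cintegrable m D G ->
  cintegral m D (fun x => F x + G x) = cintegral m D F + cintegral m D G.
Proof.
move=> mD [f1 f2] [g1 g2]; apply: complex_eqP; rewrite ?cReD ?cImD /=.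
  by under eq_Rintegral do rewrite cReD; rewrite RintegralD.
by under eq_Rintegral do rewrite cImD; rewrite RintegralD.
Qed.

Lemma cintegralZ m D F a : measurable D -> cintegrable m D F ->
  cintegral m D (fun x => a * F x) = a * cintegral m D F.
Proof.
move=> mD [f1 f2].
have Zi (b : R) (f : R -> R) : m.-integrable D (EFin \o f) ->
    m.-integrable D (EFin \o (fun x => b * f x)).
  by move=> fi; have := integrableZl mD b fi; apply: eq_integrable.
apply: complex_eqP; rewrite ?cReM ?cImM /=.
  under eq_Rintegral do rewrite cReM.
  by rewrite RintegralB// ?Zi// !RintegralZl.
under eq_Rintegral do rewrite cImM.
by rewrite RintegralD// ?Zi// !RintegralZl.
Qed.

Lemma cintegrableD m D F G : measurable D -> cintegrable m D F -> cintegrable m D G ->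
  cintegrable m D (fun x => F x + G x).
Proof.
move=> mD [f1 f2] [g1 g2]; split.
  by have := integrableD mD f1 g1; apply: eq_integrable => // x _; rewrite /= cReD.
by have := integrableD mD f2 g2; apply: eq_integrable => // x _; rewrite /= cImD.
Qed.

Lemma cintegrableZ m D F a : measurable D -> cintegrable m D F ->
  cintegrable m D (fun x => a * F x).
Proof.
move=> mD [f1 f2]; split.
  have := integrableB mD (integrableZl mD (complex.Re a) f1) (integrableZl mD (complex.Im a) f2).
  by apply: eq_integrable => // x _; rewrite /= cReM.
have := integrableD mD (integrableZl mD (complex.Re a) f2) (integrableZl mD (complex.Im a) f1).
by apply: eq_integrable => // x _; rewrite /= cImM.
Qed.

Lemma cintegralN m D F : measurable D -> cintegrable m D F ->
  cintegral m D (fun x => - F x) = - cintegral m D F.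
Proof.
by move=> mD iF; under eq_fun do rewrite -mulN1r; rewrite cintegralZ// mulN1r.
Qed.

Lemma cintegralB m D F G : measurable D -> cintegrable m D F -> cintegrable m D G ->
  cintegral m D (fun x => F x - G x) = cintegral m D F - cintegral m D G.
Proof.
move=> mD iF iG; rewrite cintegralD// ?cintegralN//.
by under eq_fun do rewrite -mulN1r; exact: cintegrableZ.
Qed.

Lemma cintegral_sum m D (I : Type) (s : seq I) (H : I -> R -> R[i]) :
  measurable D -> (m D < +oo)%E -> (forall i, bmeas (H i)) ->
  cintegral m D (fun x => \sum_(i <- s) H i x) = \sum_(i <- s) cintegral m D (H i).
Proof.
move=> mD mDoo bH; elim: s => [|i s IH].
  rewrite big_nil; under eq_fun do rewrite big_nil.
  by apply: complex_eqP; rewrite /= Rintegral_cst// mul0r.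
rewrite big_cons; under eq_fun do rewrite big_cons.
by rewrite cintegralD ?IH//; apply: bmeas_cintegrable => //; exact: bmeas_sum.
Qed.

Lemma cintegral_cst m D a : measurable D ->
  cintegral m D (fun=> a) = a * (fine (m D))%:C.
Proof.
move=> mD; apply: complex_eqP; rewrite ?cReM ?cImM/= !Rintegral_cst//.
  by rewrite mulr0 subr0.
by rewrite mulr0 add0r.
Qed.

(** The factor 2 comes from estimating real and imaginary parts separately. *)
Lemma cabs_cintegral_le m D F (M : R) : measurable D -> (m D < +oo)%E ->
  cintegrable m D F -> (forall x, D x -> cabs (F x) <= M) ->
  cabs (cintegral m D F) <= 2 * M * fine (m D).
Proof.
move=> mD mDoo [f1 f2] FM.
have bd (f : R -> R) : m.-integrable D (EFin \o f) -> (forall x, D x -> `|f x| <= M) ->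
    `|\int[m]_(x in D) f x| <= M * fine (m D).
  move=> fi fM; apply: (le_trans (le_normr_Rintegral mD fi)).
  rewrite -Rintegral_cst//; apply: le_Rintegral => //.
    exact: (integrable_norm fi).
  by apply: bounded_integrable => //; exists `|M| => _; exact: lexx.
apply: (le_trans (cabs_leD _)); rewrite -mulrA mulr_natl mulr2n lerD//= bd// => x Dx.
  exact: le_trans (cabs_Re _) (FM _ Dx).
exact: le_trans (cabs_Im _) (FM _ Dx).
Qed.

End complex_integral.

(** * Fourier coefficients *)

Section fourier.
Context {R : realType}.
Implicit Types (F G : R -> R[i]) (n m : int).

Local Notation cabs := (ComplexField.Normc.normc).
Local Notation leb := (@lebesgue_measure R).
Local Notation I02pi := (`[(0 : R), 2 * pi]%classic).

Let twopi_gt0 : 0 < 2 * pi :> R.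
Proof. by rewrite mulr_gt0 ?pi_gt0. Qed.

Lemma I02pi_fin : (leb I02pi < +oo)%E.
Proof. by rewrite lebesgue_measure_itv/= lte_fin twopi_gt0 ltry. Qed.

Lemma fine_I02pi : fine (leb I02pi) = 2 * pi.
Proof. by rewrite lebesgue_measure_itv/= lte_fin twopi_gt0/= subr0. Qed.

Let mI : measurable (I02pi : set (borelR R)).
Proof. exact: measurable_itv. Qed.

#[local] Hint Resolve mI I02pi_fin : core.

Lemma fourier_kernelE n (z : R) : cexp (- ('i%C * (n%:~R * z)%:C)) = cis z ^ (- n) :> R[i].
Proof. by rewrite cisXz rmorphN/= mulNr rmorphN/= mulrN. Qed.

Lemma bmeas_cisXz n : bmeas (fun z : R => cis z ^ n).
Proof. by under eq_fun do rewrite cisXz; exact: bmeas_cexp_i. Qed.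

Lemma fourier_coefE F n : fourier_coef F n =
  ((2 * pi)^-1)%:C * cintegral leb I02pi (fun z => cis z ^ (- n) * F z).
Proof.
by rewrite /fourier_coef; congr (_ * _); apply: eq_cintegral => z _; rewrite fourier_kernelE.
Qed.

Lemma fourier_coefD F G n : bmeas F -> bmeas G ->
  fourier_coef (fun z => F z + G z) n = fourier_coef F n + fourier_coef G n.
Proof.
move=> bF bG; rewrite !fourier_coefE -mulrDr -cintegralD//.
- by congr (_ * _); apply: eq_cintegral => z _; rewrite mulrDr.
- by apply: bmeas_cintegrable => //; apply: bmeasM => //; exact: bmeas_cisXz.
- by apply: bmeas_cintegrable => //; apply: bmeasM => //; exact: bmeas_cisXz.
Qed.

Lemma fourier_coefZ a F n : bmeas F ->
  fourier_coef (fun z => a * F z) n = a * fourier_coef F n.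
Proof.
move=> bF; rewrite !fourier_coefE mulrCA; congr (_ * _); rewrite -cintegralZ//.
  by apply: eq_cintegral => z _; rewrite mulrCA.
by apply: bmeas_cintegrable => //; apply: bmeasM => //; exact: bmeas_cisXz.
Qed.

Lemma fourier_coefB F G n : bmeas F -> bmeas G ->
  fourier_coef (fun z => F z - G z) n = fourier_coef F n - fourier_coef G n.
Proof.
move=> bF bG.
have -> : (fun z => F z - G z) = (fun z => F z + (-1) * G z).
  by apply/funext => z; rewrite mulN1r.
rewrite fourier_coefD// ?fourier_coefZ// ?mulN1r//.
by apply: bmeasM => //; exact: bmeas_cst.
Qed.

Lemma fourier_coef_sum (I : Type) (s : seq I) (H : I -> R -> R[i]) n :
  (forall i, bmeas (H i)) ->
  fourier_coef (fun z => \sum_(i <- s) H i z) n = \sum_(i <- s) fourier_coef (H i) n.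
Proof.
move=> bH; rewrite fourier_coefE; under eq_cintegral => z _ do rewrite mulr_sumr.
rewrite cintegral_sum//; last by move=> i; apply: bmeasM => //; exact: bmeas_cisXz.
by rewrite mulr_sumr; apply: eq_bigr => i _; rewrite fourier_coefE.
Qed.

Lemma fourier_coef_le F n (M : R) : bmeas F -> (forall z, cabs (F z) <= M) ->
  cabs (fourier_coef F n) <= 2 * M.
Proof.
move=> bF FM; rewrite fourier_coefE cabsM cabs_real ger0_norm ?invr_ge0 ?(ltW twopi_gt0)//.
rewrite mulrC ler_pdivrMr// -{2}fine_I02pi; apply: cabs_cintegral_le => //.
  by apply: bmeas_cintegrable => //; apply: bmeasM => //; exact: bmeas_cisXz.
by move=> x _; rewrite cabsM cabs_cisXz mul1r.
Qed.

Lemma Rintegral_derivative (f g : R -> R) : (forall x : R, is_derive x (1 : R) g (f x)) ->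
  continuous f -> \int[leb]_(x in I02pi) f x = g (2 * pi) - g 0.
Proof.
move=> gf cf; rewrite /Rintegral.
have cg : continuous g.
  by move=> x; apply: differentiable_continuous; apply/derivable1_diffP; exact: ex_derive.
rewrite (@continuous_FTC2 R f g)//.
- exact: continuous_subspaceT.
- split.
  + by move=> x _; exact: ex_derive.
  + exact/cvg_at_right_filter/cg.
  + exact/cvg_at_left_filter/cg.
- by move=> x _; rewrite derive1E; exact: derive_val.
Qed.

Lemma cos2piMn (k : nat) : cos (k%:R * (2 * pi)) = 1 :> R.
Proof.
have -> : k%:R * (2 * pi) = 0 + pi *+ 2 *+ k :> R by rewrite !mulr_natl add0r.
by rewrite (periodicn (@cosD2pi R)) cos0.
Qed.

Lemma sin2piMn (k : nat) : sin (k%:R * (2 * pi)) = 0 :> R.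
Proof.
have -> : k%:R * (2 * pi) = 0 + pi *+ 2 *+ k :> R by rewrite !mulr_natl add0r.
by rewrite (periodicn (@sinD2pi R)) sin0.
Qed.

Lemma cos2piM (n : int) : cos (n%:~R * (2 * pi)) = 1 :> R.
Proof.
case: n => k; first exact: cos2piMn.
by rewrite NegzE mulrNz mulNr cosN; exact: cos2piMn.
Qed.

Lemma sin2piM (n : int) : sin (n%:~R * (2 * pi)) = 0 :> R.
Proof.
case: n => k; first exact: sin2piMn.
by rewrite NegzE mulrNz mulNr sinN -[RHS]oppr0; congr (- _); exact: sin2piMn.
Qed.

Lemma cis2piXz n : cis (2 * pi : R) ^ n = 1.
Proof. by rewrite cisXz cexp_i cos2piM sin2piM. Qed.

Lemma cisDXz (x y : R) n : cis (x + y) ^ n = cis x ^ n * cis y ^ n.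
Proof. by rewrite !cisXz -cexpD mulrDr rmorphD mulrDr. Qed.

Lemma is_derive_sin_lin (a x : R) : is_derive x 1 (fun x => sin (a * x)) (a * cos (a * x)).
Proof.
have h : is_derive x 1 (fun x : R => a * x) a.
  by have := is_deriveZ a (is_derive_id x (1 : R)); rewrite /GRing.scale/= mulr1.
have := is_derive1_comp (is_derive_sin (a * x)) h.
by rewrite mulrC.
Qed.

Lemma is_derive_cos_lin (a x : R) : is_derive x 1 (fun x => cos (a * x)) (- a * sin (a * x)).
Proof.
have h : is_derive x 1 (fun x : R => a * x) a.
  by have := is_deriveZ a (is_derive_id x (1 : R)); rewrite /GRing.scale/= mulr1.
have := is_derive1_comp (is_derive_cos (a * x)) h.
by rewrite mulNr mulrC mulNr.
Qed.

Lemma cintegral_cisXz n : n != 0 -> cintegral leb I02pi (fun z => cis z ^ n) = 0.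
Proof.
move=> n0; have n0' : n%:~R != 0 :> R by rewrite intr_eq0.
under eq_cintegral => z _ do rewrite cisXz cexp_i.
have cc : continuous (fun x : R => cos (n%:~R * x)).
  exact: continuous_cos_lin.
have cs : continuous (fun x : R => sin (n%:~R * x)).
  exact: continuous_sin_lin.
apply: complex_eqP => /=.
  have h x : is_derive (x : R) (1 : R) (fun z : R => n%:~R^-1 * sin (n%:~R * z))
      (cos (n%:~R * x)).
    have := is_deriveZ n%:~R^-1 (is_derive_sin_lin n%:~R x).
    by rewrite /GRing.scale/= mulrA mulVf// mul1r.
  by rewrite (Rintegral_derivative h cc) sin2piM !mulr0 sin0 !mulr0 subrr.
have h x : is_derive (x : R) (1 : R) (fun z : R => - n%:~R^-1 * cos (n%:~R * z))
    (sin (n%:~R * x)).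
  have := is_deriveZ (- n%:~R^-1) (is_derive_cos_lin n%:~R x).
  by rewrite /GRing.scale/= mulrA mulrNN mulVf// mul1r.
by rewrite (Rintegral_derivative h cs) cos2piM !mulr0 cos0 subrr.
Qed.

Lemma fourier_coef_mono a m n :
  fourier_coef (fun z : R => a * cis z ^ m) n = if m == n then a else 0.
Proof.
rewrite fourier_coefZ ?fourier_coefE; last exact: bmeas_cisXz.
under eq_cintegral => z _ do rewrite -expfzDr ?cis_neq0//.
case: eqP => [->|mn].
  under eq_cintegral => z _ do rewrite addNr expr0z.
  rewrite cintegral_cst// fine_I02pi mul1r -rmorphM/= mulVf ?gt_eqF//.
  by rewrite mulr1.
rewrite cintegral_cisXz ?mulr0//.
by rewrite addrC subr_eq0; apply/eqP.
Qed.

Lemma bmeas_leval (s : laurent) : bmeas (fun z : R => leval s (cis z)).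
Proof.
apply: bmeas_sum => t; apply: bmeasM; [exact: bmeas_cst|exact: bmeas_cisXz].
Qed.

Lemma fourier_coef_leval (s : laurent) n :
  fourier_coef (fun z : R => leval s (cis z)) n = \sum_(t <- s | t.2 == n) t.1.
Proof.
rewrite fourier_coef_sum; last first.
  by move=> t; apply: bmeasM; [exact: bmeas_cst|exact: bmeas_cisXz].
by rewrite [RHS]big_mkcond; apply: eq_bigr => t _; rewrite fourier_coef_mono.
Qed.

(** This moment is the correction that the winding number contributes to the
    Fourier coefficients of a logarithm. *)
Lemma cintegral_idM_cisXz n : n != 0 ->
  cintegral leb I02pi (fun z => cis z ^ (- n) * z%:C) = 'i%C * (2 * pi / n%:~R)%:C.
Proof.
move=> n0; have n0' : n%:~R != 0 :> R by rewrite intr_eq0.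
have cc : continuous (fun x : R => x * cos (n%:~R * x)).
  move=> x; apply: continuousM; first exact: cvg_id.
  exact: continuous_cos_lin.
have cs : continuous (fun x : R => - (x * sin (n%:~R * x))).
  under eq_fun do rewrite -mulN1r mulrA.
  move=> x; apply: continuousM; first exact: continuous_lin.
  exact: continuous_sin_lin.
have -> : cintegral leb I02pi (fun z => cis z ^ (- n) * z%:C) =
    cintegral leb I02pi (fun z => (z * cos (n%:~R * z)) +i* (- (z * sin (n%:~R * z)))).
  apply: eq_cintegral => z _; rewrite cisXz cexp_i mulrNz mulNr cosN sinN.
  by apply: complex_eqP; rewrite ?cReM ?cImM/=; ring.
apply: complex_eqP; rewrite ?cReM ?cImM/=.
  have h x : is_derive (x : R) (1 : R) (fun z : R => z * (n%:~R^-1 * sin (n%:~R * z)) +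
     n%:~R^-1 * (n%:~R^-1 * cos (n%:~R * z))) (x * cos (n%:~R * x)).
    have h1 := is_deriveZ n%:~R^-1 (is_derive_sin_lin n%:~R x).
    have h2 := is_deriveZ n%:~R^-1 (is_deriveZ n%:~R^-1 (is_derive_cos_lin n%:~R x)).
    have h3 := is_deriveD (is_deriveM (is_derive_id x (1 : R)) h1) h2.
    apply: is_derive_eq h3 _.
    by rewrite /GRing.scale/= /GRing.scale/=; field.
  rewrite (Rintegral_derivative h cc) sin2piM cos2piM !mulr0 cos0 sin0.
  by rewrite !(mulr0, mul0r, mulr1, add0r, subr0) subrr.
have h x : is_derive (x : R) (1 : R) (fun z : R => z * (n%:~R^-1 * cos (n%:~R * z)) +
     - n%:~R^-1 * (n%:~R^-1 * sin (n%:~R * z))) (- (x * sin (n%:~R * x))).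
  have h1 := is_deriveZ n%:~R^-1 (is_derive_cos_lin n%:~R x).
  have h2 := is_deriveZ (- n%:~R^-1) (is_deriveZ n%:~R^-1 (is_derive_sin_lin n%:~R x)).
  have h3 := is_deriveD (is_deriveM (is_derive_id x (1 : R)) h1) h2.
  apply: is_derive_eq h3 _.
  by rewrite /GRing.scale/= /GRing.scale/=; field.
rewrite (Rintegral_derivative h cs) sin2piM cos2piM !mulr0 cos0 sin0.
by rewrite !(mulr0, mul0r, mulr1, add0r, mul1r, addr0, subr0).
Qed.

End fourier.

(** * Sums over the integers *)

Section integer_sums.
Context {R : realType}.
Implicit Types (F : int -> R).

(** The split by sign reduces geometric sums over the integers to sums over [nat]. *)
Definition zrange (B : nat) : seq int := map Posz (iota 0 B) ++ map Negz (iota 0 B).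

Lemma mem_zrangeE B n : n \in zrange B = match n with Posz k => (k < B)%N | Negz k => (k < B)%N end.
Proof.
have iP : injective Posz by move=> ? ? [].
have iN : injective Negz by move=> ? ? [].
rewrite mem_cat; case: n => k.
  rewrite mem_map// mem_iota/=; case: mapP => [[]//|_]; exact: orbF.
by rewrite [X in _ || X]mem_map// mem_iota/=; case: mapP => [[]//|_].
Qed.

Lemma zrange_uniq B : uniq (zrange B).
Proof.
rewrite cat_uniq !map_inj_uniq ?iota_uniq//=; try by move=> ? ? [].
by rewrite andbT; apply/hasPn => n /mapP[k _ ->]; apply/negP => /mapP[].
Qed.

Lemma sub_zrange (s : seq int) : exists B, {subset s <= zrange B}.
Proof.
elim: s => [|n s [B sB]]; first by exists 0%N.
exists (maxn B `|n|.+1) => x; rewrite inE => /orP[/eqP ->|/sB].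
  by rewrite mem_zrangeE; case: n => k; rewrite ?NegzE ?abszN ?absz_nat leq_max ?leqnn ?orbT// ltnS leqnSn orbT.
by rewrite !mem_zrangeE; case: x => k kB; rewrite (leq_trans kB) ?leq_maxl.
Qed.

Lemma zrange_subset A B : (A <= B)%N -> {subset zrange A <= zrange B}.
Proof. by move=> AB x; rewrite !mem_zrangeE; case: x => k kA; exact: leq_trans kA AB. Qed.

Lemma ler_sum_subset F (s t : seq int) : (forall n, 0 <= F n) -> uniq s -> uniq t ->
  {subset s <= t} -> \sum_(n <- s) F n <= \sum_(n <- t) F n.
Proof.
move=> F0 us ut st.
have p : perm_eq s [seq n <- t | n \in s].
  apply: uniq_perm => //; first exact: filter_uniq.
  by move=> n; rewrite mem_filter; case: (boolP (n \in s)) => // /st ->.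
rewrite (perm_big _ p) big_filter big_mkcond/=; apply: ler_sum => n _.
by case: ifP.
Qed.

Lemma sum_geometric_le (q : R) (s : seq int) : 0 <= q -> q < 1 -> uniq s ->
  \sum_(n <- s) q ^+ `|n|%N <= 2 / (1 - q).
Proof.
move=> q0 q1 us; have p0 : 0 < 1 - q by lra.
have [B sB] := sub_zrange s.
apply: (@le_trans _ _ (\sum_(n <- zrange B) q ^+ `|n|%N)).
  by apply: ler_sum_subset => //; [move=> n; exact: exprn_ge0|exact: zrange_uniq].
have g : \sum_(k <- iota 0 B) q ^+ k <= (1 - q)^-1.
  have -> : iota 0 B = index_iota 0 B by rewrite /index_iota subn0.
  rewrite big_mkord.
  have := subrX1 q B => h.
  rewrite -[leRHS]mul1r ler_pdivlMr// mulrC -opprB mulNr -h opprB lerBlDr lerDl.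
  exact: exprn_ge0.
rewrite big_cat !big_map/= mulr_natl mulr2n lerD//.
apply: le_trans g; apply: ler_sum => k _.
by rewrite exprS ler_piMl ?exprn_ge0// ltW.
Qed.

End integer_sums.

(** * Coefficient bounds from an annulus *)

Section wiener_annulus.
Context {R : realType}.
Implicit Types (w : R[i]) (r S e : R) (G : R[i] -> R[i]) (s t : @laurent R).

Local Notation cabs := (ComplexField.Normc.normc).

Definition lcoef s (n : int) : R[i] := \sum_(t <- s | t.2 == n) t.1.

(** Without equal exponents the norm is the sum of the moduli of the Fourier
    coefficients, which sup norms control. *)
Definition lcanon s : laurent := [seq (lcoef s n, n) | n <- undup (map snd s)].

Lemma leval_lcanon s w : leval (lcanon s) w = leval s w.
Proof.
rewrite /leval /lcanon big_map /=.
under eq_bigr => n _ do rewrite /lcoef mulr_suml big_mkcond.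
rewrite exchange_big/= [LHS]big_seq [RHS]big_seq; apply: eq_bigr => t ts.
rewrite -big_mkcond/= (big_rem t.2)/=; last by rewrite mem_undup map_f.
rewrite eqxx big1_seq ?addr0// => n /andP[/eqP <-].
by rewrite mem_rem_uniqF ?undup_uniq.
Qed.

(** Cauchy's estimate: [lcoef s n * r ^ n] is the Fourier coefficient of index [n]
    of the restriction of [s] to the circle of radius [r]. *)
Lemma lcoef_le s S r n : 0 < r ->
  (forall w, cabs w = r -> cabs (leval s w) <= S) ->
  cabs (lcoef s n) * r ^ n <= 2 * S.
Proof.
move=> r0 sS; have rC : r%:C != 0 :> R[i] by rewrite -cabs_gt0 cabs_real gtr0_norm.
pose sr : @laurent R := [seq (x.1 * r%:C ^ x.2, x.2) | x <- s].
have srE z : leval sr (cis z) = leval s (r%:C * cis z).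
  by rewrite /leval /sr big_map; apply: eq_bigr => t _; rewrite /= (expfzMl r%:C (cis z)) mulrA.
have := @fourier_coef_le R (fun z => leval sr (cis z)) n S (bmeas_leval sr).
rewrite fourier_coef_leval => h.
have -> : cabs (lcoef s n) * r ^ n = cabs (lcoef s n * r%:C ^ n).
  by rewrite cabsM cabsXz cabs_real gtr0_norm.
have -> : lcoef s n * r%:C ^ n = \sum_(t <- sr | t.2 == n) t.1.
  by rewrite /lcoef mulr_suml big_map/=; apply: eq_bigr => t /eqP ->.
apply: h => z; rewrite srE; apply: sS.
by rewrite cabsM cabs_cis mulr1 cabs_real gtr0_norm.
Qed.

(** Cauchy's estimates on the two boundary circles make the coefficients decay
    geometrically, so a uniform bound on an annulus controls the norm. *)
Lemma lnorm_lcanon s S r : 1 < r ->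
  (forall w, annulus r w -> cabs (leval s w) <= S) ->
  lnorm (lcanon s) <= 4 * S / (1 - r^-1).
Proof.
move=> r1 sS; have r0 : 0 < r := lt_trans ltr01 r1.
have rV1 : r^-1 < 1 by rewrite invf_lt1.
have rr : r^-1 <= r by rewrite (le_trans (ltW rV1))// ltW.
have c n : cabs (lcoef s n) <= 2 * S * r^-1 ^+ `|n|%N.
  have h1 : cabs (lcoef s n) * r ^ n <= 2 * S.
    by apply: lcoef_le => // w wr; apply: sS; rewrite /annulus wr lexx rr.
  have h2 : cabs (lcoef s n) * r^-1 ^ n <= 2 * S.
    apply: lcoef_le; rewrite ?invr_gt0// => w wr.
    by apply: sS; rewrite /annulus wr lexx rr.
  case: n h1 h2 => k h1 h2.
    by rewrite absz_nat exprVn -ler_pdivrMr ?invr_gt0 ?exprn_gt0// invrK.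
  rewrite NegzE abszN absz_nat -exprnN exprVn invrK in h2 *.
  by rewrite ler_pdivlMr ?exprn_gt0.
rewrite /lnorm /lcanon big_map/=.
apply: (@le_trans _ _ (\sum_(n <- undup (map snd s)) 2 * S * r^-1 ^+ `|n|%N)).
  by apply: ler_sum => n _; exact: c.
have S0 : 0 <= S.
  apply: le_trans (sS 1 _); first exact: cabs_ge0.
  by rewrite /annulus cabs1 !ltW.
have r0' : 0 <= r^-1 by rewrite invr_ge0 ltW.
rewrite -mulr_sumr; apply: (@le_trans _ _ (2 * S * (2 / (1 - r^-1)))).
  by rewrite ler_wpM2l ?mulr_ge0// sum_geometric_le ?undup_uniq.
by rewrite le_eqVlt; apply/orP; left; apply/eqP; rewrite mulrA; congr (_ / _); ring.
Qed.

(** Close approximations are bounded by [2 * S] on the annulus, so that their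
    norms are bounded independently of the precision. *)
Lemma wiener_annulus r S G : 1 < r -> 0 < S -> annulus_approx r G ->
  (forall w, annulus r w -> cabs (G w) <= S) ->
  wiener (8 * S / (1 - r^-1)) (fun z => G (cis z)).
Proof.
move=> r1 S0 UG GS e e0.
have m0 : 0 < Num.min e S by rewrite lt_min e0.
have [s hs] := UG _ m0.
exists (lcanon s); split.
  have -> : 8 * S = 4 * (S + S) by ring.
  apply: lnorm_lcanon => // w aw.
  rewrite -[leval s w](subrK (G w)); apply: (le_trans (cabsD _ _)).
  rewrite cabs_distC lerD ?GS//; apply: (le_trans (hs _ aw)).
  by rewrite ge_min lexx orbT.
move=> z; rewrite leval_lcanon; apply: (le_trans (hs _ _)).
  by rewrite /annulus cabs_cis ltW ?invf_lt1 ?(lt_trans ltr01)//= ltW.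
by rewrite ge_min lexx.
Qed.

Lemma cis_surj (v : R[i]) : cabs v = 1 -> exists z : R, v = cis z.
Proof.
move=> v1; have := cabs_sqr v; rewrite v1 expr1n.
set a := complex.Re v; set b := complex.Im v => ab.
have a1 : -1 <= a <= 1.
  have : a ^+ 2 <= 1 by rewrite ab lerDl sqr_ge0.
  by rewrite -ler_norml -(real_normK (num_real a)) expr_le1.
have sb : sin (acos a) = `|b|.
  have e : 1 - a ^+ 2 = b ^+ 2 by lra.
  by rewrite sin_acos// e sqrtr_sqr.
have [b0|b0] := leP 0 b.
  exists (acos a); rewrite /cis cexp_i; apply: complex_eqP => /=.
    by rewrite acosK.
  by rewrite sb ger0_norm.
exists (- acos a); rewrite /cis cexp_i; apply: complex_eqP => /=.
  by rewrite cosN acosK.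
by rewrite sinN sb ltr0_norm// opprK.
Qed.

Lemma exprn_near1 (N : nat) e : 0 < e -> exists2 r, 1 < r &
  forall x, r^-1 <= x <= r -> `|x ^+ N - 1| <= e.
Proof.
move=> e0; have e1 : 1 < 1 + e by rewrite ltrDl.
pose r := expR (ln (1 + e) / N.+1%:R).
have r1 : 1 < r by rewrite expR_gt1 divr_gt0 ?ln_gt0.
have r0 : 0 < r := lt_trans ltr01 r1.
have rN : r ^+ N <= 1 + e.
  apply: (@le_trans _ _ (r ^+ N.+1)); first by rewrite exprS ler_peMl ?exprn_ge0 ?ltW.
  by rewrite -expRM_natl mulrC divfK ?gt_eqF// lnK// posrE (lt_trans ltr01).
exists r => // x /andP[rx xr]; have x0 : 0 < x by apply: lt_le_trans rx; rewrite invr_gt0.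
have h1 : x ^+ N <= 1 + e.
  by apply: le_trans rN; rewrite lerXn2r ?nnegrE ?(ltW x0) ?(ltW r0).
have h2 : (1 + e)^-1 <= x ^+ N.
  apply: (@le_trans _ _ (r^-1 ^+ N)).
    by rewrite exprVn lef_pV2 ?posrE ?exprn_gt0//; lra.
  by rewrite lerXn2r ?nnegrE ?invr_ge0 ?(ltW x0) ?(ltW r0).
have h3 : 1 - e <= (1 + e)^-1.
  by rewrite -[leRHS]mul1r ler_pdivlMr; [nra|lra].
by rewrite ler_norml; lra.
Qed.

Lemma exprz_near1 (n : int) e : 0 < e -> exists2 r, 1 < r &
  forall x, r^-1 <= x <= r -> `|x ^ n - 1| <= e.
Proof.
move=> e0; case: n => k.
  by have [r r1 h] := exprn_near1 k e0; exists r.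
have [r r1 h] := exprn_near1 k.+1 e0; exists r => // x /andP[rx xr].
rewrite NegzE -exprnN -exprVn; apply: h.
have r0 : 0 < r := lt_trans ltr01 r1.
have x0 : 0 < x by apply: lt_le_trans rx; rewrite invr_gt0.
rewrite lef_pV2 ?posrE// xr /=.
by rewrite -[leRHS]invrK lef_pV2 ?posrE ?invr_gt0.
Qed.

Lemma annulus_perturb s e : 0 < e -> exists2 r, 1 < r & forall x z : R,
  r^-1 <= x <= r -> cabs (leval s (x%:C * cis z) - leval s (cis z)) <= e.
Proof.
elim: s e => [|t s IH] e e0.
  by exists 2 => [|x z _]; [lra|rewrite !leval_nil subrr cabs0 ltW].
have e20 : 0 < e / 2 by rewrite divr_gt0.
have [r1 r11 h1] := IH _ e20.
have c0 : 0 < cabs t.1 + 1 by rewrite ltr_wpDl ?cabs_ge0.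
have [|r2 r21 h2] := @exprz_near1 t.2 (e / 2 / (cabs t.1 + 1)); first by rewrite divr_gt0.
exists (Num.min r1 r2) => [|x z xr]; first by rewrite lt_min r11.
have m0 : 0 < Num.min r1 r2 by rewrite lt_min !(lt_trans ltr01).
have sub r : 0 < r -> Num.min r1 r2 <= r -> r^-1 <= x <= r.
  move=> r0 mr; move: xr => /andP[xl xh].
  by rewrite (le_trans xh)// (le_trans _ xl)// lef_pV2.
rewrite !leval_cons.
have -> : t.1 * (x%:C * cis z) ^ t.2 + leval s (x%:C * cis z) -
    (t.1 * cis z ^ t.2 + leval s (cis z)) =
    t.1 * cis z ^ t.2 * (x%:C ^ t.2 - 1) + (leval s (x%:C * cis z) - leval s (cis z)).
  have -> : (x%:C * cis z) ^ t.2 = x%:C ^ t.2 * cis z ^ t.2 := expfzMl _ _ _.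
  move: (x%:C ^ t.2) (cis z ^ t.2) (leval s _) (leval s _) => p1 p2 p3 p4.
  by ring.
apply: (le_trans (cabsD _ _)); rewrite (splitr e); apply: lerD; last first.
  by apply: h1; apply: sub; [exact: lt_trans r11|rewrite ge_min lexx].
have -> : x%:C ^ t.2 - 1 = (x ^ t.2 - 1)%:C by rewrite rmorphB/= fmorphXz.
rewrite !cabsM cabs_cisXz mulr1 cabs_real.
have h : `|x ^ t.2 - 1| <= e / 2 / (cabs t.1 + 1).
  by apply: h2; apply: sub; [exact: lt_trans r21|rewrite ge_min lexx orbT].
apply: (@le_trans _ _ ((cabs t.1 + 1) * (e / 2 / (cabs t.1 + 1)))).
  by apply: ler_pM; rewrite ?cabs_ge0// lerDl.
by rewrite mulrC divfK ?gt_eqF.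
Qed.

(** A point [w] of a thin annulus is close to its radial projection on the circle,
    where the lower bound is given. *)
Lemma annulus_lower_bound s d d' : d' < d ->
  (forall z, d <= cabs (leval s (cis z))) ->
  exists2 r, 1 < r & forall w, annulus r w -> d' <= cabs (leval s w).
Proof.
move=> dd sd; have e0 : 0 < d - d' by lra.
have [r r1 hr] := annulus_perturb s e0; exists r => // w aw.
have w0 : w != 0 by apply: annulus_neq0 aw; exact: lt_trans r1.
have cw0 : cabs w != 0 by rewrite cabs_eq0.
have [|z zE] := @cis_surj (w / (cabs w)%:C).
  by rewrite cabsM cabsV cabs_real ger0_norm ?cabs_ge0// divff.
have wE : w = (cabs w)%:C * cis z.
  by rewrite -zE mulrC divfK// -cabs_eq0 cabs_real normr_eq0.
have := hr (cabs w) z aw; rewrite -wE => h.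
have := sd z; rewrite -[leval s (cis z)](subrK (leval s w)).
have := cabsD (leval s (cis z) - leval s w) (leval s w).
by rewrite cabs_distC in h; lra.
Qed.

Lemma leval_poly s : exists (N : nat) (Q : {poly R[i]}),
  forall w, w != 0 -> leval s w = w ^- N * Q.[w].
Proof.
elim: s => [|t s [N [Q hQ]]].
  by exists 0%N, 0 => w _; rewrite leval_nil horner0 mulr0.
case: t => a [] k.
  exists N, (Q + a *: 'X^(N + k)) => w w0; rewrite leval_cons hQ//=.
  rewrite hornerD hornerZ hornerXn exprD mulrDr addrC -exprnP; congr (_ + _).
  by rewrite mulrCA mulKf// expf_neq0.
exists (N + k.+1)%N, ('X^(k.+1) * Q + a *: 'X^N) => w w0; rewrite leval_cons hQ//=.
rewrite hornerD hornerZ hornerM !hornerXn exprD NegzE -exprnN.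
have := expf_neq0 N w0; have := expf_neq0 k.+1 w0 => h1 h2.
by move: (w ^+ N) (w ^+ k.+1) Q.[w] h1 h2 (leval s w) => p1 p2 p3 h1 h2 p4; field; rewrite h1 h2.
Qed.

(** All roots of a Laurent polynomial without zeros in an annulus lie outside
    of it, and there each factor of its inverse is a geometric series. *)
Lemma annulus_approx_inv s r : 1 < r ->
  (forall w, annulus r w -> leval s w != 0) ->
  annulus_approx r (fun w => (leval s w)^-1).
Proof.
move=> r1 s0; have r0 : 0 < r := lt_trans ltr01 r1.
have [N [Q hQ]] := leval_poly s.
have [rs Qrs] := closed_field_poly_normal Q.
have Qn0 w : annulus r w -> Q.[w] != 0.
  move=> aw; apply: contra (s0 _ aw) => /eqP Q0.
  by rewrite hQ ?Q0 ?mulr0// (annulus_neq0 r0 aw).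
have na a : a \in rs -> ~ annulus r a.
  move=> ars aa; have := Qn0 _ aa; rewrite Qrs hornerZ horner_prod.
  by rewrite (big_rem a)//= hornerXsubC subrr mul0r mulr0 eqxx.
have P : annulus_approx r (fun w => \prod_(a <- rs) (w - a)^-1).
  elim: rs na {Qrs} => [|a rs IH] na.
    apply: (@annulus_approx_eq _ _ (leval [:: (1, 0)])); last exact: annulus_approx_leval.
    by move=> w _; rewrite leval_seq1 big_nil mul1r expr0z.
  under eq_fun do rewrite big_cons.
  apply: annulus_approxM => //; last by apply: IH => b brs; apply: na; rewrite inE brs orbT.
  by apply: annulus_approx_root => //; apply: na; rewrite inE eqxx.
have L := annulus_approx_leval r [:: ((lead_coef Q)^-1, (N : int))].
apply: annulus_approx_eq (annulus_approxM r1 L P) => w aw.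
rewrite leval_seq1 hQ ?(annulus_neq0 r0 aw)//= {2}Qrs hornerZ horner_prod.
rewrite !invfM invrK -exprnP -mulrA mulrCA; congr (_ * (_ * _)).
by rewrite prodfV; congr (_^-1); apply: eq_bigr => a _; rewrite hornerXsubC.
Qed.

(** The norms of the powers of [1 / P] grow at most like the powers of
    [1 / d] for every [d] below the minimum of [|P|]: this replaces the spectral
    radius formula. *)
Lemma wiener_inv_exp s d d' : 0 < d' -> d' < d ->
  (forall z, d <= cabs (leval s (cis z))) ->
  exists K, forall n, wiener (K * d'^-1 ^+ n) (fun z => (leval s (cis z))^-1 ^+ n).
Proof.
move=> d0 dd sd; have [r r1 hr] := annulus_lower_bound dd sd.
have s0 w : annulus r w -> leval s w != 0.
  by move=> aw; rewrite -cabs_gt0 (lt_le_trans d0)// hr.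
have U := annulus_approx_inv r1 s0.
exists (8 / (1 - r^-1)) => n.
have := @wiener_annulus r (d'^-1 ^+ n) (fun w => (leval s w)^-1 ^+ n) r1 _ (annulus_approxX n r1 U).
rewrite mulrAC; apply; first by rewrite exprn_gt0 ?invr_gt0.
move=> w aw; rewrite cabsX cabsV lerXn2r ?nnegrE ?invr_ge0 ?cabs_ge0 ?(ltW d0)//.
by rewrite lef_pV2 ?posrE ?hr// (lt_le_trans d0)// hr.
Qed.

End wiener_annulus.

(** * Logarithms in the Wiener algebra *)

Section wiener_levy.
Context {R : realType}.
Implicit Types (w u v : R[i]) (q C e M : R) (F G : R -> R[i]) (s t : @laurent R).

Local Notation cabs := (ComplexField.Normc.normc).

Lemma logser_tail (N N' : nat) q u : 0 <= q -> q < 1 -> cabs u <= q ->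
  (N <= N')%N -> cabs (logser N' u - logser N u) <= q ^+ N / (1 - q).
Proof.
move=> q0 q1 uq NN; have p0 : 0 < 1 - q by lra.
pose f k : R[i] := (-1) ^+ k * (k.+1%:R^-1)%:C * u ^+ k.+1.
have fE n : logser n u = \sum_(0 <= k < n) f k by rewrite big_mkord.
have fq k : cabs (f k) <= q ^+ k.
  rewrite !cabsM !cabsX cabsN cabs1 expr1n mul1r cabs_real.
  rewrite -[leRHS]mul1r; apply: ler_pM; rewrite ?exprn_ge0 ?cabs_ge0//.
    by rewrite ger0_norm ?invr_ge0// invf_le1// ler1n.
  rewrite exprS -[leRHS]mul1r; apply: ler_pM; rewrite ?exprn_ge0 ?cabs_ge0//.
    exact: le_trans (ltW q1).
  by rewrite lerXn2r ?nnegrE ?cabs_ge0.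
rewrite !fE (big_cat_nat (leq0n N) NN)/= addrAC subrr add0r.
apply: (le_trans (cabs_sum _ _ _)).
apply: (@le_trans _ _ (\sum_(N <= k < N') q ^+ k)).
  by apply: ler_sum => k _; exact: fq.
rewrite -{1}[N]add0n big_addn.
under eq_bigr do rewrite exprD.
rewrite -mulr_suml big_mkord mulrC ler_wpM2l ?exprn_ge0//.
have := subrX1 q (N' - N) => h.
rewrite -[leRHS]mul1r ler_pdivlMr// mulrC -opprB mulNr -h opprB lerBlDr lerDl.
exact: exprn_ge0.
Qed.

(** The principal logarithm of [1 + u], for [u] in the unit disc. *)
Definition clog u : R[i] :=
  limn (fun N => complex.Re (logser N u)) +i* limn (fun N => complex.Im (logser N u)).

Lemma geometric_small q e : 0 <= q -> q < 1 -> 0 < e ->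
  exists N0, forall N, (N0 <= N)%N -> q ^+ N / (1 - q) <= e.
Proof.
move=> q0 q1 e0; have p0 : 0 < 1 - q by lra.
have q1' : `|q| < 1 by rewrite ger0_norm.
have c0 : 0 < e * (1 - q) by rewrite mulr_gt0.
have /cvgrPdist_le/(_ _ c0) [N _ h] := cvg_expr q1'.
exists N => n Nn; rewrite ler_pdivrMr//; have := h n Nn.
by rewrite /= sub0r normrN ger0_norm// exprn_ge0.
Qed.

Lemma clog_approx q : 0 <= q -> q < 1 -> forall N u, cabs u <= q ->
  cabs (clog u - logser N u) <= 2 * (q ^+ N / (1 - q)).
Proof.
move=> q0 q1.
have tail (f : R[i] -> R) : (forall w, `|f w| <= cabs w) ->
    (forall w v, f (w - v) = f w - f v) -> forall N u, cabs u <= q ->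
    `|limn (fun N => f (logser N u)) - f (logser N u)| <= q ^+ N / (1 - q).
  move=> fc fB N u uq; set g := fun N => f (logser N u).
  have gt n n' : (n <= n')%N -> `|g n' - g n| <= q ^+ n / (1 - q).
    by move=> nn; rewrite /g -fB; apply: (le_trans (fc _)); exact: logser_tail.
  have cg : cvgn g.
    apply/cauchy_cvgP/cauchy_exP => e e0; have e20 : 0 < e / 2 by rewrite divr_gt0.
    have [N0 h] := geometric_small q0 q1 e20.
    exists (g N0), N0 => // n /= N0n; rewrite /ball/= distrC.
    apply: le_lt_trans (gt _ _ N0n) _; apply: le_lt_trans (h _ (leqnn _)) _.
    by rewrite ltr_pdivrMr// ltr_pMr// ltr1n.
  apply/ler_addgt0Pr => e e0.
  have /cvgrPdist_le/(_ _ e0)[N1 _ h] := cg.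
  have h1 := h (maxn N N1) (leq_maxr _ _); rewrite /= in h1.
  have h2 := gt _ _ (leq_maxl N N1).
  rewrite -[_ - g N](subrKA (g (maxn N N1))).
  by apply: (le_trans (ler_normD _ _)); rewrite addrC lerD.
move=> N u uq; apply: (le_trans (cabs_leD _)).
rewrite cReD cImD cReN cImN mulr_natl mulr2n; apply: lerD.
  by apply: (tail (@complex.Re R)) => //; [exact: cabs_Re|move=> w v; rewrite cReD cReN].
by apply: (tail (@complex.Im R)) => //; [exact: cabs_Im|move=> w v; rewrite cImD cImN].
Qed.

Lemma cexp_clog u : cabs u < 1 -> cexp (clog u) = 1 + u.
Proof.
move=> u1; have q0 := cabs_ge0 u.
apply/eqP; rewrite -subr_eq0 -cabs_eq0 eq_le cabs_ge0 andbT.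
apply/ler_addgt0Pr => e e0; rewrite add0r.
pose e' := Num.min 2^-1 (e / 32).
have e'0 : 0 < e' by rewrite lt_min invr_gt0 ltr0n divr_gt0.
have e'h : e' <= 2^-1 by rewrite ge_min lexx.
have e'e : e' <= e / 32 by rewrite ge_min lexx orbT.
have e'20 : 0 < e' / 2 by rewrite divr_gt0.
have [N1 h1] := cexp_logser_cvg q0 u1 e'0.
have [N2 h2] := geometric_small q0 u1 e'20.
pose N := maxn N1 N2; set S := logser N u.
have g1 : cabs (cexp S - (1 + u)) <= e' by apply: h1 => //; exact: leq_maxl.
have g2 : cabs (clog u - S) <= e'.
  apply: (le_trans (clog_approx q0 u1 N (lexx _))).
  by have := h2 N (leq_maxr _ _); lra.
have cS : cabs (cexp S) <= 3.
  have := cabsD (cexp S - (1 + u)) (1 + u); rewrite subrK.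
  have := cabsD 1 u; rewrite cabs1; lra.
have -> : cexp (clog u) - (1 + u) = cexp S * (cexp (clog u - S) - 1) + (cexp S - (1 + u)).
  by rewrite mulrBr -cexpD mulr1 [S + _]addrC subrK; ring.
apply: (le_trans (cabsD _ _)); rewrite cabsM.
have g3 : cabs (cexp (clog u - S) - 1) <= 5 * e'.
  apply: (le_trans (cabs_cexpB1 _)); first exact: le_trans g2 e'h.
  by rewrite ler_wpM2l.
have : cabs (cexp S) * cabs (cexp (clog u - S) - 1) <= 3 * (5 * e').
  by apply: ler_pM; rewrite ?cabs_ge0.
lra.
Qed.

(** The norms of the powers of [G] decrease geometrically, so the logarithmic series
    converges in the algebra; the pointwise bound [p] identifies its sum. *)
Lemma wiener_clog G C q p : 0 <= C -> 0 <= q -> q < 1 -> 0 <= p -> p < 1 ->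
  (forall n, wiener (C * q ^+ n) (fun z => G z ^+ n)) -> (forall z, cabs (G z) <= p) ->
  wiener (C / (1 - q)) (fun z => clog (G z)).
Proof.
move=> C0 q0 q1 p0 p1 WG Gp; have d0 : 0 < 1 - q by lra.
apply: wiener_lim => e e0; have e20 : 0 < e / 2 by rewrite divr_gt0.
have [N h] := geometric_small p0 p1 e20.
exists (fun z => logser N (G z)); split; last first.
  move=> z; apply: (le_trans (clog_approx p0 p1 N (Gp z))).
  by have := h N (leqnn N); lra.
have W := wiener_sum N (fun k => wienerZ ((-1) ^+ k * (k.+1%:R^-1)%:C) (WG k.+1)).
apply: wiener_le W.
apply: (@le_trans _ _ (\sum_(k < N) C * q ^+ k)).
  apply: ler_sum => k _; rewrite cabsM cabsX cabsN cabs1 expr1n mul1r cabs_real.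
  rewrite -[leRHS]mul1r; apply: ler_pM; rewrite ?mulr_ge0 ?exprn_ge0//.
    by rewrite ger0_norm ?invr_ge0// invf_le1// ler1n.
  by rewrite ler_wpM2l// exprS ler_piMl ?exprn_ge0// ltW.
rewrite -mulr_sumr ler_wpM2l//.
have hh := subrX1 q N.
rewrite -[leRHS]mul1r ler_pdivlMr// mulrC -opprB mulNr -hh opprB lerBlDr lerDl.
exact: exprn_ge0.
Qed.

(** The factor [C * cis z ^ k] carries the winding number [k], which a periodic
    function [G] cannot produce. *)
Definition wiener_log F := exists (C : R[i]) (k : int) M G, wiener M G /\
  forall z, F z = C * cis z ^ k * cexp (G z).

Lemma wiener_logM F G : wiener_log F -> wiener_log G ->
  wiener_log (fun z => F z * G z).
Proof.
move=> [C [k [M [A [WA FA]]]]] [D [l [N [B [WB GB]]]]].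
exists (C * D), (k + l), (M + N), (fun z => A z + B z); split; first exact: wienerD.
by move=> z; rewrite FA GB cexpD expfzDr ?cis_neq0//; ring.
Qed.

Lemma wiener_log_mono (C : R[i]) (k : int) : wiener_log (fun z => C * cis z ^ k).
Proof.
exists C, k, (cabs (0 : R[i])), (fun=> 0); split; first exact: wiener_cst.
by move=> z; rewrite cexp0 mulr1.
Qed.

Lemma wiener_log_geometric (b : R[i]) (k : int) : cabs b < 1 ->
  wiener_log (fun z => 1 - b * cis z ^ k).
Proof.
move=> b1; have uE z : cabs (- b * cis z ^ k) = cabs b.
  by rewrite cabsM cabs_cisXz mulr1 cabsN.
exists 1, 0, (1 / (1 - cabs b)), (fun z => clog (- b * cis z ^ k)); split; last first.
  by move=> z; rewrite expr0z !mul1r cexp_clog ?uE// mulNr.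
have h z : cabs (- b * cis z ^ k) <= cabs b by rewrite uE.
apply: (@wiener_clog _ 1 (cabs b) (cabs b)) => //; try exact: cabs_ge0.
move=> n; have := wienerX n (wiener_mono (- b) k); by rewrite cabsN mul1r.
Qed.

(** The root [a] contributes 1 to the winding number when it lies inside of the
    circle, from [cis z * (1 - a / cis z)], and nothing when it lies outside, from
    [- a * (1 - cis z / a)]. *)
Lemma wiener_log_root (a : R[i]) : cabs a != 1 -> wiener_log (fun z => cis z - a).
Proof.
move=> a1; have [al|ag] := ltP (cabs a) 1.
  have := wiener_logM (wiener_log_mono 1 1) (wiener_log_geometric (-1) al).
  rewrite (_ : (fun z => _) = (fun z => cis z - a))//; apply/funext => z.
  have c0 := cis_neq0 z.
  by rewrite mul1r -invr_expz expr1z mulrBr mulr1 mulrCA divff// mulr1.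
have {a1}ag : 1 < cabs a by rewrite lt_neqAle eq_sym a1.
have a0 : a != 0 by rewrite -cabs_gt0 (lt_trans ltr01).
have aV : cabs a^-1 < 1 by rewrite cabsV invf_lt1// (lt_trans ltr01).
have := wiener_logM (wiener_log_mono (- a) 0) (wiener_log_geometric 1 aV).
rewrite (_ : (fun z => _) = (fun z => cis z - a))//; apply/funext => z.
by rewrite expr0z mulr1 expr1z; field.
Qed.

Lemma wiener_log_leval s : (forall z, leval s (cis z) != 0) ->
  wiener_log (fun z => leval s (cis z)).
Proof.
move=> s0; have [N [Q hQ]] := leval_poly s.
have [rs Qrs] := closed_field_poly_normal Q.
have Qn0 z : Q.[cis z] != 0.
  by apply: contra (s0 z) => /eqP Q0; rewrite hQ ?cis_neq0// Q0 mulr0.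
have na a : a \in rs -> cabs a != 1.
  move=> ars; apply/eqP => /cis_surj[z az]; have := Qn0 z; rewrite Qrs hornerZ horner_prod.
  by rewrite (big_rem a)//= hornerXsubC az subrr mul0r mulr0 eqxx.
have P : wiener_log (fun z => \prod_(a <- rs) (cis z - a)).
  elim: rs na {Qrs} => [|a rs IH] na.
    by under eq_fun do rewrite big_nil; have := wiener_log_mono 1 0;
      under eq_fun do rewrite mul1r expr0z.
  under eq_fun do rewrite big_cons.
  apply: wiener_logM; last by apply: IH => b brs; apply: na; rewrite inE brs orbT.
  by apply: wiener_log_root; apply: na; rewrite inE eqxx.
have := wiener_logM (wiener_log_mono (lead_coef Q) (- N%:Z)) P.
rewrite (_ : (fun z => _) = (fun z => leval s (cis z)))//; apply/funext => z.
rewrite hQ ?cis_neq0// {2}Qrs hornerZ horner_prod -exprnN [lead_coef Q * _]mulrC -mulrA.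
congr (_ * (_ * _)).
by apply: eq_bigr => a _; rewrite hornerXsubC.
Qed.

(** The theorem of Wiener and Levy, for the logarithm.  Write [F = P (1 + u)]
    with [P] a Laurent polynomial and [u = (F - P) / P].  The norm of [u ^ n] is
    at most a constant times [2 ^ - n], because that of [F - P] is small compared
    with the minimum of [|P|], and so the logarithmic series converges in the
    algebra; [P] itself is a product of factors [1 - b w] or [1 - b / w] with
    [|b| < 1]. *)
Theorem wiener_levy_log F d : 0 < d -> (forall z, d <= cabs (F z)) ->
  (forall e, 0 < e -> exists s, wiener e (fun z => F z - leval s (cis z))) ->
  wiener_log F.
Proof.
move=> d0 Fd FA.
(* [|F - P| <= e] leaves [|P| >= 3 e], and [2 e] is a bound below this minimum
   for which the norms of the powers of [u] decrease like [(e / (2 e)) ^ n]. *)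
pose e := d / 4.
have e0 : 0 < e by rewrite divr_gt0.
have [s Ws] := FA _ e0.
have sd z : 3 * e <= cabs (leval s (cis z)).
  have := wiener_bounded Ws z; have := Fd z.
  have := cabsD (F z - leval s (cis z)) (leval s (cis z)); rewrite subrK.
  by rewrite /e; lra.
have s0 z : leval s (cis z) != 0.
  by rewrite -cabs_gt0 (lt_le_trans _ (sd z))// mulr_gt0.
have e20 : 0 < 2 * e by rewrite mulr_gt0.
have e23 : 2 * e < 3 * e by rewrite ltr_pM2r// ltr_nat.
have [K hK] := wiener_inv_exp e20 e23 sd.
have K0 : 0 <= K by have := wiener_ge0 (hK 0%N); rewrite expr0 mulr1.
pose u z := (F z - leval s (cis z)) / leval s (cis z).
have up z : cabs (u z) <= 3^-1.
  have p0 : 0 < cabs (leval s (cis z)) by rewrite cabs_gt0.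
  rewrite /u cabsM cabsV ler_pdivrMr//.
  by apply: (le_trans (wiener_bounded Ws z)); have := sd z; lra.
have Wu n : wiener (K * 2^-1 ^+ n) (fun z => u z ^+ n).
  have := wienerM (wienerX n Ws) (hK n).
  have -> : e ^+ n * (K * (2 * e)^-1 ^+ n) = K * 2^-1 ^+ n.
    rewrite mulrCA -exprMn; congr (_ * _ ^+ _).
    by field; rewrite gt_eqF.
  by rewrite (_ : (fun z => _) = (fun z => u z ^+ n))//; apply/funext => z; rewrite -exprMn.
have W1 : wiener_log (fun z => 1 + u z).
  exists 1, 0, (K / (1 - 2^-1)), (fun z => clog (u z)); split.
    apply: (@wiener_clog _ _ _ 3^-1) => //; by [rewrite invf_lt1// ltr1n|rewrite invr_ge0].
  move=> z; rewrite expr0z !mul1r cexp_clog//.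
  by apply: le_lt_trans (up z) _; rewrite invf_lt1// ltr1n.
have := wiener_logM (wiener_log_leval s0) W1.
rewrite (_ : (fun z => _) = F)//; apply/funext => z.
by rewrite mulrDr mulr1 /u mulrC divfK// addrC subrK.
Qed.

End wiener_levy.

(** * Measures on the integers *)

Section lattice_measures.
Context {R : realType}.
Implicit Types (m : {measure set (borelR R) -> \bar R}) (F : R -> R[i]).

Local Notation cabs := (ComplexField.Normc.normc).

Definition lpoints (s : seq int) : set (borelR R) := [set x | exists2 n, n \in s & x = n%:~R].

Definition mass m (n : int) : R := fine (m [set n%:~R]).

Lemma lpoints_nil : lpoints [::] = set0.
Proof. by apply/seteqP; split => x // -[]. Qed.

Lemma lpoints_cons n s : lpoints (n :: s) = [set n%:~R] `|` lpoints s.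
Proof.
apply/seteqP; split => x.
  move=> [k]; rewrite inE => /orP[/eqP ->|ks] ->; first by left.
  by right; exists k.
by move=> [->|[k ks ->]]; [exists n|exists k]; rewrite ?inE ?eqxx ?ks ?orbT.
Qed.

Lemma measurable_lpoints s : measurable (lpoints s).
Proof.
elim: s => [|n s IH]; first by rewrite lpoints_nil; exact: measurable0.
by rewrite lpoints_cons; apply: measurableU => //; exact: measurable_set1.
Qed.

#[local] Hint Resolve measurable_lpoints : core.

Lemma measurable_integers : measurable (range (fun n : int => n%:~R : R) : set (borelR R)).
Proof.
by apply: countable_measurable; [move=> t; exact: measurable_set1|exact: (card_le_trans (card_image_le _ _) (countableP _))].
Qed.

Lemma finite_measureS m A : measurable A -> (m setT < +oo)%E -> (m A < +oo)%E.
Proof. by move=> mA; apply: le_lt_trans; apply: le_measure; rewrite ?inE. Qed.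

Lemma finite_measure_fin_num m A : measurable A -> (m setT < +oo)%E -> m A \is a fin_num.
Proof. by move=> mA mfin; rewrite ge0_fin_numE// finite_measureS. Qed.

Lemma cintegral_setU m (A B : set (borelR R)) F : measurable A -> measurable B ->
  (m setT < +oo)%E -> bmeas F -> [disjoint A & B] ->
  cintegral m (A `|` B) F = cintegral m A F + cintegral m B F.
Proof.
move=> mA mB mfin bF AB; have mAB : measurable (A `|` B) by exact: measurableU.
have [i1 i2] := bmeas_cintegrable mAB (finite_measureS mAB mfin) bF.
by apply: complex_eqP; rewrite ?cReD ?cImD /= Rintegral_setU.
Qed.

Lemma cintegral_set1 m (x : R) F :
  cintegral m [set x] F = F x * (fine (m [set x]))%:C.
Proof.
by rewrite -cintegral_cst; [apply: eq_cintegral => y ->|exact: measurable_set1].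
Qed.

Lemma intr_disjoint n s : n \notin s -> [disjoint [set (n%:~R : R)] & lpoints s].
Proof.
move=> ns; apply/disj_setPS => x [-> [k ks /intr_inj nk]].
by rewrite nk ks in ns.
Qed.

Lemma cintegral_lpoints m s F : (m setT < +oo)%E -> bmeas F -> uniq s ->
  cintegral m (lpoints s) F = \sum_(n <- s) F n%:~R * (mass m n)%:C.
Proof.
move=> mfin bF; elim: s => [|n s IH] /=.
  by rewrite lpoints_nil big_nil; move=> _; apply: complex_eqP; rewrite /= Rintegral_set0.
move=> /andP[ns us]; rewrite big_cons lpoints_cons cintegral_setU//; last exact: intr_disjoint.
by rewrite IH// cintegral_set1.
Qed.

Lemma measure_lpoints m s : (m setT < +oo)%E -> uniq s ->
  fine (m (lpoints s)) = \sum_(n <- s) mass m n.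
Proof.
move=> mfin; elim: s => [|n s IH] /=; first by rewrite lpoints_nil measure0 big_nil.
move=> /andP[ns us]; rewrite big_cons lpoints_cons measureU//; last first.
  by apply/eqP; exact: intr_disjoint.
rewrite fineD ?IH//; apply: finite_measure_fin_num => //; exact: measurable_set1.
Qed.

Definition integer_valued m := m (~` range (fun n : int => n%:~R : R)) = 0%E.

Definition tail m N : R := fine (m (~` lpoints (zrange N))).

Lemma tail_ge0 m N : 0 <= tail m N.
Proof. exact: fine_ge0. Qed.

(** The complements of the finite sets of integers [-N, N[ decrease to a null set. *)
Lemma tail_cvg m e : (m setT < +oo)%E -> integer_valued m -> 0 < e ->
  exists N0, forall N, (N0 <= N)%N -> tail m N <= e.
Proof.
move=> mfin mZ e0.
have UZ : \bigcup_N lpoints (zrange N) = range (fun n : int => n%:~R : R).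
  apply/seteqP; split => [x [N _ [n _ ->]]|x [n _ <-]]; first by exists n.
  have [B sB] := sub_zrange [:: n]; exists B => //; exists n => //.
  by apply: sB; rewrite inE.
have mZ1 := measurable_integers.
have mR : m (range (fun n : int => n%:~R : R)) = m setT.
  rewrite -(setvU (range (fun n : int => n%:~R : R))) measureU ?setICl//; last exact: measurableC.
  by rewrite [X in (X + _)%E](_ : _ = 0%E) ?add0e.
have cv : (m \o (fun N => lpoints (zrange N))) n @[n --> \oo] --> m setT.
  rewrite -mR -UZ; apply: nondecreasing_cvg_mu => //; first by rewrite UZ.
  move=> i j ij; apply/subsetPset => x [n ni ->]; exists n => //.
  exact: zrange_subset ni.
have tE N : tail m N = fine (m setT) - fine (m (lpoints (zrange N))).
  have f1 : m (lpoints (zrange N)) \is a fin_num by exact: finite_measure_fin_num.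
  have f2 : m (~` lpoints (zrange N)) \is a fin_num.
    by apply: finite_measure_fin_num => //; exact: measurableC.
  rewrite -(setvU (lpoints (zrange N))) measureU ?setICl//; last exact: measurableC.
  by rewrite fineD// addrK.
have fT : m setT \is a fin_num by rewrite ge0_fin_numE.
rewrite -(fineK fT) in cv; move/fine_cvgP: cv => [_] /cvgrPdist_le/(_ _ e0)[N0 _ h].
exists N0 => N N0N; have := h N N0N; rewrite /= -tE ger0_norm//.
exact: tail_ge0.
Qed.

Lemma cintegral_zrange m F N (M : R) : (m setT < +oo)%E -> bmeas F ->
  (forall x, cabs (F x) <= M) ->
  cabs (cintegral m setT F - \sum_(n <- zrange N) F n%:~R * (mass m n)%:C) <= 2 * M * tail m N.
Proof.
move=> mfin bF FM; rewrite -cintegral_lpoints ?zrange_uniq//.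
have mC : measurable (~` lpoints (zrange N)) by exact: measurableC.
have -> : setT = lpoints (zrange N) `|` ~` lpoints (zrange N) by rewrite setUv.
rewrite cintegral_setU//; last by apply/disj_setPS; rewrite setICr.
rewrite addrAC subrr add0r; apply: cabs_cintegral_le => //.
  exact: finite_measureS.
by apply: bmeas_cintegrable => //; exact: finite_measureS.
Qed.

Lemma charfun_zrange m N z : (m setT < +oo)%E ->
  cabs (charfun m z - leval [seq ((mass m n)%:C, n) | n <- zrange N] (cis z)) <= 2 * tail m N.
Proof.
move=> mfin; have := @cintegral_zrange m (fun x => cexp ('i%C * (z * x)%:C)) N 1 mfin (bmeas_cexp_i z).
rewrite mulr1 /leval big_map => h.
under eq_bigr => n _ do rewrite /= cisXz mulrC (mulrC n%:~R).
by apply: h => x; rewrite cabs_cexp_i.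
Qed.

Lemma mass_ge0 m n : 0 <= mass m n. Proof. exact: fine_ge0. Qed.

(** The mass that a truncation leaves out bounds the error in the norm of the
    algebra, and not only in the sup norm: this is the hypothesis of the theorem
    of Wiener and Levy. *)
Lemma wiener_charfun_tail m N : (m setT < +oo)%E -> integer_valued m ->
  wiener (tail m N) (fun z => charfun m z - leval [seq ((mass m n)%:C, n) | n <- zrange N] (cis z)).
Proof.
move=> mfin mZ e e0; have e20 : 0 < e / 2 by rewrite divr_gt0.
have [N1 h] := tail_cvg mfin mZ e20.
pose N' := maxn N N1.
have NN' : (N <= N')%N by exact: leq_maxl.
have p : perm_eq (zrange N') (zrange N ++ [seq n <- zrange N' | n \notin zrange N]).
  apply: uniq_perm; first exact: zrange_uniq.
    rewrite cat_uniq zrange_uniq filter_uniq ?zrange_uniq// andbT/=.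
    by apply/hasPn => n; rewrite mem_filter => /andP[].
  move=> n; rewrite [RHS]mem_cat mem_filter.
  by case: (boolP (n \in zrange N)) => //= /(zrange_subset NN') ->.
set s := [seq n <- zrange N' | n \notin zrange N] in p.
exists [seq ((mass m n)%:C, n) | n <- s]; split.
  rewrite /lnorm big_map.
  under eq_bigr => n _ do rewrite cabs_real ger0_norm ?mass_ge0//.
  have us : uniq s by rewrite filter_uniq// zrange_uniq.
  rewrite -measure_lpoints// fine_le//.
  - exact: finite_measure_fin_num.
  - by apply: finite_measure_fin_num => //; exact: measurableC.
  - apply: le_measure; rewrite ?inE//; first exact: measurableC.
    move=> x [n ns ->] [k kN /intr_inj nk]; move: ns; rewrite mem_filter nk.
    by rewrite kN.
move=> z.
have E : leval [seq ((mass m n)%:C, n) | n <- zrange N'] (cis z) =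
    leval [seq ((mass m n)%:C, n) | n <- zrange N] (cis z) +
    leval [seq ((mass m n)%:C, n) | n <- s] (cis z).
  rewrite -leval_cat -map_cat /leval; apply: perm_big; exact: perm_map.
rewrite -addrA -opprD -E.
apply: (le_trans (charfun_zrange _ _ mfin)).
have := h N' (leq_maxr _ _); lra.
Qed.

Lemma wiener_charfun m : (m setT < +oo)%E -> integer_valued m ->
  exists M, wiener M (charfun m).
Proof.
move=> mfin mZ; have W := wiener_charfun_tail 0 mfin mZ.
exists (tail m 0); move: W; under eq_fun do rewrite /zrange/= leval_nil subr0.
by [].
Qed.

Lemma charfun_laurent_approx m e : (m setT < +oo)%E -> integer_valued m -> 0 < e ->
  exists s, wiener e (fun z => charfun m z - leval s (cis z)).
Proof.
move=> mfin mZ e0; have [N h] := tail_cvg mfin mZ e0.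
exists [seq ((mass m n)%:C, n) | n <- zrange N].
exact: wiener_le (h N (leqnn N)) (wiener_charfun_tail N mfin mZ).
Qed.

(** Unordered sums of nonnegative weights are sigma-additive in the index set. *)
Lemma lattice_measure_exists (p : int -> R) (M : R) : (forall n, 0 <= p n) ->
  (forall s, uniq s -> \sum_(n <- s) p n <= M) ->
  exists m : {measure set (borelR R) -> \bar R},
    [/\ forall B, m B = (\esum_(n in [set n : int | B (n%:~R : R)]) (p n)%:E)%E,
        (m setT < +oo)%E, integer_valued m & forall n, mass m n = p n].
Proof.
move=> p0 pM.
pose f (B : set (borelR R)) := (\esum_(n in [set n : int | B (n%:~R : R)]) (p n)%:E)%E.
have pe0 n : (0 <= (p n)%:E)%E by rewrite lee_fin.
have f0 : f set0 = 0%E by rewrite /f (_ : [set n | _] = set0) ?esum_set0.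
have f_ge0 B : (0 <= f B)%E by apply: esum_ge0.
have fS : semi_sigma_additive f.
  move=> F mF tF mUF.
  have -> : f (\bigcup_n F n) = (\sum_(0 <= i <oo) f (F i))%E.
    have tF' : trivIset setT (fun i => [set n : int | F i (n%:~R : R)]).
      by move=> i j _ _ [n [/= Fi Fj]]; apply: tF => //; exists (n%:~R : R).
    by rewrite -(nneseries_sum_bigcup tF' pe0); congr (esum _ _);
      apply/seteqP; split => n [k _ Fk]; exists k.
  by apply: is_cvg_ereal_nneg_natsum.
pose m' := isMeasure.Build _ _ _ f f0 f_ge0 fS.
pose m : {measure set (borelR R) -> \bar R} := HB.pack_for {measure set (borelR R) -> \bar R} f m'.
exists m; split => //.
- apply: (@le_lt_trans _ _ M%:E); last exact: ltry.
  rewrite /m/= /f; apply: ge_ereal_sup => _ [X [finX _] <-].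
  rewrite fsbig_finite//= sumEFin lee_fin; apply: pM.
  exact: finmap.fset_uniq.
- rewrite /integer_valued /m/= /f esum1// => n /= nn; exfalso; apply: nn.
  by exists n.
- move=> n; rewrite /mass /m/= /f.
  have -> : [set n0 : int | n0%:~R = n%:~R :> R] = [set n].
    by apply/seteqP; split => k /=; [move/intr_inj|move->].
  by rewrite esum_set1.
Qed.

End lattice_measures.

(** * Fourier series of Hermitian functions *)

Section wiener_fourier.
Context {R : realType}.
Implicit Types (m : {measure set (borelR R) -> \bar R}) (F G H : R -> R[i]) (M e : R).

Local Notation cabs := (ComplexField.Normc.normc).
Local Notation leb := (@lebesgue_measure R).
Local Notation I02pi := (`[(0 : R), 2 * pi]%classic).

Lemma continuous_ReIm_leval (s : laurent) :
  continuous (fun z : R => complex.Re (leval s (cis z))) /\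
  continuous (fun z : R => complex.Im (leval s (cis z))).
Proof.
elim: s => [|t s [IH1 IH2]].
  by split; under eq_fun do rewrite leval_nil/=; exact: cst_continuous.
have cR : continuous (fun z : R => complex.Re (cis z ^ t.2)).
  by under eq_fun do rewrite cisXz; exact: continuous_cexp_iRe.
have cI : continuous (fun z : R => complex.Im (cis z ^ t.2)).
  by under eq_fun do rewrite cisXz; exact: continuous_cexp_iIm.
split; under eq_fun do rewrite leval_cons ?cReD ?cImD ?cReM ?cImM.
  apply: continuous_addf => //; apply: continuous_addf; last apply: continuous_oppf;
    by apply: continuous_mulf => //; exact: cst_continuous.
apply: continuous_addf => //; apply: continuous_addf;
  by apply: continuous_mulf => //; exact: cst_continuous.
Qed.

Lemma maxr0B (x : R) : Num.max x 0 - Num.max (- x) 0 = x.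
Proof.
have [x0|x0] := leP 0 x.
  by rewrite max_r ?oppr_le0// subr0.
by rewrite max_l ?oppr_ge0 ?(ltW x0)// sub0r opprK.
Qed.

Lemma uniform_approx_continuous (f : R -> R) : (forall e, 0 < e ->
    exists2 g : R -> R, continuous g & forall z, `|f z - g z| <= e) -> continuous f.
Proof.
move=> H z; apply/cvgrPdist_le => e e0.
have e30 : 0 < e / 3 by rewrite divr_gt0.
have [g cg fg] := H _ e30.
have /cvgrPdist_le/(_ _ e30) := cg z; apply: filterS => y gy.
have -> : f z - f y = (f z - g z) + (g z - g y) + (g y - f y) by ring.
apply: (le_trans (ler_normD _ _)); have := ler_normD (f z - g z) (g z - g y).
have h1 := fg z; have h2 := fg y; rewrite distrC in h2; lra.
Qed.

Lemma wiener_continuous M F : wiener M F ->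
  continuous (fun z => complex.Re (F z)) /\ continuous (fun z => complex.Im (F z)).
Proof.
move=> W; split; apply: uniform_approx_continuous => e e0; have [s [_ h]] := W e e0;
  have [c1 c2] := continuous_ReIm_leval s.
  exists (fun z => complex.Re (leval s (cis z))) => // z.
  by rewrite -cReN -cReD; exact: le_trans (cabs_Re _) (h z).
exists (fun z => complex.Im (leval s (cis z))) => // z.
by rewrite -cImN -cImD; exact: le_trans (cabs_Im _) (h z).
Qed.

Lemma wiener_bmeas M F : wiener M F -> bmeas F.
Proof.
move=> W; have [c1 c2] := wiener_continuous W.
exact: continuous_bmeas c1 c2 (wiener_bounded W).
Qed.

Lemma wiener_periodic M F : wiener M F -> forall z (n : int), F (z + n%:~R * (2 * pi)) = F z.
Proof.
move=> W z n; apply/eqP; rewrite -subr_eq0 -cabs_eq0 eq_le cabs_ge0 andbT.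
apply/ler_addgt0Pr => e e0; rewrite add0r; have e20 : 0 < e / 2 by rewrite divr_gt0.
have [s [_ h]] := W _ e20.
have E : leval s (cis (z + n%:~R * (2 * pi))) = leval s (cis z).
  have c1 : cis (n%:~R * (2 * pi)) = 1 :> R[i].
    have := @cis2piXz R n; rewrite cisXz -/(cis _) => <-; congr cis.
  have := cisDXz z (n%:~R * (2 * pi)) 1; rewrite !expr1z c1 mulr1 => ->.
  by [].
rewrite (splitr e); apply: le_trans (cabs_distD (leval s (cis z)) _ _) _.
by apply: lerD; [rewrite -E; exact: h|rewrite cabs_distC; exact: h].
Qed.

(** Orthogonality of the characters reads the coefficients of trigonometric
    approximations, up to the precision of the approximation. *)
Lemma fourier_coef_approx F n e (s : laurent) : bmeas F ->
  (forall z, cabs (F z - leval s (cis z)) <= e) ->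
  cabs (fourier_coef F n - lcoef s n) <= 2 * e.
Proof.
move=> bF h; rewrite /lcoef -fourier_coef_leval -fourier_coefB//; last exact: bmeas_leval.
by apply: fourier_coef_le => //; apply: bmeasB => //; exact: bmeas_leval.
Qed.

Lemma wiener_fourier_summable M F (ns : seq int) : wiener M F -> uniq ns ->
  \sum_(n <- ns) cabs (fourier_coef F n) <= M.
Proof.
move=> W uns; have bF := wiener_bmeas W.
apply/ler_addgt0Pr => e e0.
pose L : R := (size ns)%:R.
have L0 : 0 < 2 * L + 1 by rewrite ltr_wpDl// mulr_ge0.
have e'0 : 0 < e / (2 * L + 1) by rewrite divr_gt0.
have [s [sM h]] := W _ e'0.
apply: (@le_trans _ _ (\sum_(n <- ns) (cabs (lcoef s n) + 2 * (e / (2 * L + 1))))).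
  apply: ler_sum => n _; have h2 := fourier_coef_approx n bF h.
  by have := cabsD (fourier_coef F n - lcoef s n) (lcoef s n); rewrite subrK; lra.
rewrite big_split/= big_const_seq count_predT iter_addr_0; apply: lerD.
  apply: le_trans sM; apply: (@le_trans _ _ (\sum_(n <- ns) \sum_(t <- s | t.2 == n) cabs t.1)).
    by apply: ler_sum => n _; exact: cabs_sum.
  under eq_bigr do rewrite big_mkcond.
  rewrite exchange_big/=; apply: ler_sum => t _.
  rewrite -big_mkcond/=.
  have [tn|tn] := boolP (t.2 \in ns).
    rewrite (eq_bigl (pred1 t.2)); last by move=> i; exact: eq_sym.
    by rewrite -big_filter filter_pred1_uniq// big_seq1.
  rewrite big1_seq ?cabs_ge0// => n /andP[/eqP <-].
  by rewrite (negPf tn).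
rewrite -[X in X <= _]mulr_natr -/L; have := divfK (lt0r_neq0 L0) e.
by move: e'0; set e' := e / _ => e'0; lra.
Qed.

(** Hermitian symmetry allows an approximation of [F] to be replaced with its real
    part in the sense of coefficients. *)
Lemma hermitian_fourier_real M F n : wiener M F -> (forall z, F (- z) = conjc (F z)) ->
  complex.Im (fourier_coef F n) = 0.
Proof.
move=> W FN; have bF := wiener_bmeas W.
apply/eqP; rewrite -normr_eq0 eq_le normr_ge0 andbT.
apply/ler_addgt0Pr => e e0; rewrite add0r; have e20 : 0 < e / 2 by rewrite divr_gt0.
have [s [sM h]] := W _ e20.
(* the average of [s] and of its Hermitian conjugate has real coefficients *)
pose t : laurent := [seq ((complex.Re x.1)%:C, x.2) | x <- s].
have conjE z : leval t (cis z) = 2^-1%:C * (leval s (cis z) + conjc (leval s (cis (- z)))).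
  rewrite /leval big_map rmorph_sum/= -big_split/= mulr_sumr; apply: eq_bigr => x _.
  rewrite rmorphM/= !cisXz mulrN [(- _)%:C]rmorphN mulrN cexpN.
  have -> : (cexp ('i%C * (x.2%:~R * z)%:C))^-1^* = cexp ('i%C * (x.2%:~R * z)%:C).
    rewrite -cexpN -mulrN -rmorphN !cexp_i cosN sinN.
    by apply: complex_eqP => //=; rewrite opprK.
  rewrite -mulrDl mulrA; congr (_ * _).
  by case: x.1 => a b; apply: complex_eqP; rewrite ?cReM ?cImM ?cReD ?cImD/=; lra.
have h' z : cabs (F z - leval t (cis z)) <= e / 2.
  rewrite conjE.
  have -> : F z - 2^-1%:C * (leval s (cis z) + conjc (leval s (cis (- z)))) =
      2^-1%:C * ((F z - leval s (cis z)) + conjc (F (- z) - leval s (cis (- z)))).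
    rewrite rmorphB/= FN conjcK.
    have -> : 2^-1%:C = 2^-1 :> R[i] by rewrite fmorphV rmorph_nat.
    by field.
  rewrite cabsM cabs_real ger0_norm ?invr_ge0//.
  rewrite [leRHS]mulrC ler_wpM2l ?invr_ge0// (splitr e).
  by apply: le_trans (cabsD _ _) _; apply: lerD; [exact: h|rewrite cabs_conj; exact: h].
have := fourier_coef_approx n bF h'.
have -> : lcoef t n = (\sum_(x <- s | x.2 == n) complex.Re x.1)%:C.
  by rewrite /lcoef big_map rmorph_sum.
set X := \sum_(x <- s | x.2 == n) complex.Re x.1 => h2.
have := cabs_Im (fourier_coef F n - X%:C).
rewrite cImD cImN (_ : complex.Im X%:C = 0)// oppr0 addr0 => h3.
by apply: le_trans h3 (le_trans h2 _); rewrite mulrC divfK.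
Qed.

Lemma continuous_Rintegral_eq0 (h : R -> R) (z : R) : continuous h -> (forall y, 0 <= h y) ->
  \int[leb]_(y in I02pi) h y = 0 -> 0 <= z < 2 * pi -> h z = 0.
Proof.
move=> ch h0 Ih.
have mI : measurable (I02pi : set (borelR R)) by exact: measurable_itv.
move=> /andP[z0 z2]; apply/eqP/negPn/negP => hz.
have hz0 : 0 < h z by rewrite lt_neqAle eq_sym hz h0.
have hz2 : 0 < h z / 2 by rewrite divr_gt0.
have /cvgrPdist_lt/(_ _ hz2) /nbhs_ballP[d /= d0 hd] := ch z.
pose d' := Num.min (d / 2) (2 * pi - z).
have d'0 : 0 < d' by rewrite lt_min divr_gt0//= subr_gt0.
have d'd : d' < d by rewrite gt_min ltr_pdivrMr// ltr_pMr// ltr1n.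
have d'2 : d' <= 2 * pi - z by rewrite ge_min lexx orbT.
have sub : `[z, z + d']%classic `<=` I02pi.
  move=> y /=; rewrite !in_itv/= => /andP[zy yd].
  by rewrite (le_trans z0 zy)/= (le_trans yd)//; lra.
have lower : (\int[leb]_(y in `[z, (z + d')%R]) (h z / 2)%:E <=
    \int[leb]_(y in I02pi) (h y)%:E)%E.
  apply: (@le_trans _ _ (\int[leb]_(y in `[z, (z + d')%R]) (h y)%:E)%E).
    apply: ge0_le_integral => //; try by move=> *; rewrite lee_fin ?h0 ?ltW.
    - by apply/measurable_EFinP; apply: measurable_funTS; exact: continuous_measurable_fun.
    - move=> y /=; rewrite in_itv/= => /andP[zy yd]; rewrite lee_fin.
      have : `|h z - h y| < h z / 2.
        by apply: hd; rewrite /ball/= distrC ger0_norm; lra.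
      by rewrite ltr_norml; lra.
  apply: ge0_subset_integral => //.
    by apply/measurable_EFinP; apply: measurable_funTS; exact: continuous_measurable_fun.
  by move=> y _; rewrite lee_fin h0.
rewrite integral_cst// [X in (_ * X <= _)%E](_ : _ = d'%:E) in lower; last first.
  have := @lebesgue_measure_itv R `[z, z + d']%R.
  by rewrite /= lte_fin ltrDl d'0 -EFinB addrAC subrr add0r.
have fin : (\int[leb]_(y in I02pi) (h y)%:E)%E = 0%E.
  rewrite -[LHS]fineK; first by congr EFin; exact: Ih.
  apply: integrable_fin_num => //.
  by apply: continuous_compact_integrable; [exact: segment_compact|exact: continuous_subspaceT].
rewrite fin -EFinM lee_fin in lower.
have : 0 < h z / 2 * d' by rewrite mulr_gt0.
by rewrite ltNge lower.
Qed.

Lemma period_shift (z : R) : exists n : int, 0 <= z + n%:~R * (2 * pi) < 2 * pi.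
Proof.
have tp0 : 0 < 2 * pi :> R by rewrite mulr_gt0 ?pi_gt0.
pose n := Num.floor (z / (2 * pi)); exists (- n).
have /andP[n1 n2] := floor_itv (z / (2 * pi)); rewrite -/n intrD/= in n1 n2.
rewrite ler_pdivlMr// in n1; rewrite ltr_pdivrMr// in n2.
by rewrite mulrNz mulNr subr_ge0 n1/= ltrBlDl; lra.
Qed.

(** If all Fourier coefficients of [H] vanish, then [H] is orthogonal to the
    trigonometric polynomials that approximate it, hence to itself. *)
Lemma wiener_fourier_inj M H : wiener M H -> (forall n, fourier_coef H n = 0) ->
  forall z, H z = 0.
Proof.
move=> W H0; have bH := wiener_bmeas W.
have mI : measurable (I02pi : set (borelR R)) by exact: measurable_itv.
have fI : (leb I02pi < +oo)%E by exact: I02pi_fin.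
have tp0 : 0 < 2 * pi :> R by rewrite mulr_gt0 ?pi_gt0.
have M0 := wiener_ge0 W.
have orth (s : laurent) : cintegral leb I02pi (fun z => H z * conjc (leval s (cis z))) = 0.
  have E z : H z * conjc (leval s (cis z)) = \sum_(t <- s) conjc t.1 * (cis z ^ (- t.2) * H z).
    rewrite /leval rmorph_sum/= mulr_sumr; apply: eq_bigr => t _.
    rewrite rmorphM/= mulrCA [H z * _]mulrC; congr (_ * (_ * _)).
    by rewrite !cisXz mulrNz mulNr !cexp_i cosN sinN.
  under eq_cintegral => z _ do rewrite E.
  rewrite cintegral_sum//; last first.
    move=> t; apply: bmeasM; first exact: bmeas_cst.
    by apply: bmeasM => //; exact: bmeas_cisXz.
  rewrite big1_seq// => t _; rewrite cintegralZ//; last first.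
    by apply: bmeas_cintegrable => //; apply: bmeasM => //; exact: bmeas_cisXz.
  have := H0 t.2; rewrite fourier_coefE => /eqP; rewrite mulf_eq0 => /orP[|/eqP ->]; last first.
    by rewrite mulr0.
  by rewrite -cabs_eq0 cabs_real normr_eq0 invr_eq0 gt_eqF.
have I0 : cintegral leb I02pi (fun z => H z * conjc (H z)) = 0.
  apply/eqP; rewrite -cabs_eq0 eq_le cabs_ge0 andbT.
  apply/ler_addgt0Pr => e e0; rewrite add0r.
  have M1 : 0 < M + 1 by rewrite ltr_wpDl.
  have K0 : 0 < 2 * (M + 1) * (2 * pi) by apply: mulr_gt0 => //; exact: mulr_gt0.
  have e'0 : 0 < e / (2 * (M + 1) * (2 * pi)) by rewrite divr_gt0.
  have [s [_ h]] := W _ e'0.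
  have b1 : bmeas (fun z => H z * conjc (leval s (cis z))).
    by apply: bmeasM => //; apply: bmeas_conj; exact: bmeas_leval.
  have b2 : bmeas (fun z => H z * conjc (H z)) by apply: bmeasM => //; exact: bmeas_conj.
  rewrite -[cintegral _ _ _]subr0 -(orth s) -cintegralB//; try exact: bmeas_cintegrable.
  apply: (@le_trans _ _ (2 * (M * (e / (2 * (M + 1) * (2 * pi)))) * fine (leb I02pi))).
    apply: cabs_cintegral_le => //; first by apply: bmeas_cintegrable => //; exact: bmeasB.
    move=> z _; rewrite -mulrBr -rmorphB/= cabsM; apply: ler_pM; rewrite ?cabs_ge0//.
      exact: wiener_bounded W z.
    by rewrite cabs_conj.
  rewrite fine_I02pi -[leRHS](divfK (lt0r_neq0 K0)).
  move: e'0; set e' := e / _ => e'0.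
  have : 0 < e' * (2 * (2 * pi)) by apply: mulr_gt0 => //; exact: mulr_gt0.
  lra.
have [cR cI] := wiener_continuous W.
pose h (z : R) := complex.Re (H z) ^+ 2 + complex.Im (H z) ^+ 2.
have ch : continuous h.
  by apply: continuous_addf; under eq_fun do rewrite expr2; exact: continuous_mulf.
have h0 z : 0 <= h z by rewrite addr_ge0 ?sqr_ge0.
have Ih : \int[leb]_(z in I02pi) h z = 0.
  transitivity (complex.Re (cintegral leb I02pi (fun z => H z * conjc (H z)))); last by rewrite I0.
  by apply: eq_Rintegral => z _; rewrite cReM /h; case: (H z) => a b /=; ring.
have key z := continuous_Rintegral_eq0 (z := z) ch h0 Ih.
move=> z; have [n zn] := period_shift z.
have := key _ zn.
rewrite /h (wiener_periodic W) -cabs_sqr => /eqP; rewrite sqrf_eq0 cabs_eq0 => /eqP.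
by [].
Qed.

Lemma fourier_charfun m n : (m setT < +oo)%E -> integer_valued m ->
  fourier_coef (charfun m) n = (mass m n)%:C.
Proof.
move=> mfin mZ; have [M W] := wiener_charfun mfin mZ.
have bF := wiener_bmeas W.
apply/eqP; rewrite -subr_eq0 -cabs_eq0 eq_le cabs_ge0 andbT.
apply/ler_addgt0Pr => e e0; rewrite add0r; have e40 : 0 < e / 4 by rewrite divr_gt0.
have [N0 h] := tail_cvg mfin mZ e40.
have [B sB] := sub_zrange [:: n].
pose N := maxn N0 B.
have nN : n \in zrange N.
  by apply: zrange_subset (leq_maxr N0 B) _ _; apply: sB; rewrite inE.
have := @fourier_coef_approx (charfun m) n (2 * (e / 4))
  [seq ((mass m k)%:C, k) | k <- zrange N] bF.
rewrite {1}/lcoef big_map/= -big_filter filter_pred1_uniq ?zrange_uniq// big_seq1.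
have -> : 2 * (2 * (e / 4)) = e by field.
apply => z; apply: (le_trans (charfun_zrange _ _ mfin)).
by rewrite ler_wpM2l// h// leq_maxl.
Qed.

(** The Fourier coefficients of [F] are real and summable; their positive and
    negative parts are the point masses of two finite measures, and the difference
    of the characteristic functions has the same coefficients as [F], except at 0.
    The mass at 0 is left out because it cancels in [F z - F 0]. *)
Lemma wiener_hermitian_measures M F : wiener M F -> (forall z, F (- z) = conjc (F z)) ->
  exists (b : int -> R) (mp mn : {measure set (borelR R) -> \bar R}),
  [/\ forall n, (b n)%:C = fourier_coef F n,
      forall s, uniq s -> \sum_(n <- s) `|b n| <= M,
      [/\ forall B, mp B = (\esum_(n in [set n : int | B (n%:~R : R)])
              (if n == 0 then 0 else Num.max (b n) 0)%:E)%E,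
        (mp setT < +oo)%E & integer_valued mp],
      [/\ forall B, mn B = (\esum_(n in [set n : int | B (n%:~R : R)])
              (if n == 0 then 0 else Num.max (- b n) 0)%:E)%E,
        (mn setT < +oo)%E & integer_valued mn] &
      forall z, F z = (b 0)%:C + (charfun mp z - charfun mn z)].
Proof.
move=> W FN; pose b n := complex.Re (fourier_coef F n).
have bE n : (b n)%:C = fourier_coef F n.
  by apply: complex_eqP; [by []|rewrite (hermitian_fourier_real n W FN)].
have bM s : uniq s -> \sum_(n <- s) `|b n| <= M.
  move=> us; apply: le_trans (wiener_fourier_summable W us).
  by apply: ler_sum => n _; exact: cabs_Re.
pose p (c : int -> R) n := if n == 0 then 0 else Num.max (c n) 0.
have p0 c n : 0 <= p c n by rewrite /p; case: ifP => // _; rewrite le_max lexx orbT.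
have pM c s : (forall n, `|c n| = `|b n|) -> uniq s -> \sum_(n <- s) p c n <= M.
  move=> cb us; apply: le_trans (bM s us); apply: ler_sum => n _; rewrite -cb /p.
  by case: ifP => // _; rewrite ge_max ler_norm normr_ge0.
have [mp [mpE mpfin mpZ mpm]] := lattice_measure_exists (p0 b) (fun s => pM b s (fun=> erefl)).
have [mn [mnE mnfin mnZ mnm]] := lattice_measure_exists (p0 (fun n => - b n))
  (fun s => pM (fun n => - b n) s (fun n => normrN (b n))).
exists b, mp, mn; split => // z.
have [Mp Wp] := wiener_charfun mpfin mpZ; have [Mn Wn] := wiener_charfun mnfin mnZ.
have Wc := wiener_cst (b 0)%:C.
have WG := wienerD Wc (wienerD Wp (wienerZ (-1) Wn)).
have WH := wienerD W (wienerZ (-1) WG).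
have GE : (fun z => (b 0)%:C + (charfun mp z + (-1) * charfun mn z)) =
  (fun z => (b 0)%:C + (charfun mp z - charfun mn z)).
  by apply/funext => y; rewrite mulN1r.
apply/eqP; rewrite -subr_eq0 -mulN1r -[charfun mp z - _]/(charfun mp z + - charfun mn z) -[- charfun mn z]mulN1r; apply/eqP.
apply: (wiener_fourier_inj WH) => n.
have bF := wiener_bmeas W; have bG := wiener_bmeas WG.
have b1 := wiener_bmeas Wp; have b2 := wiener_bmeas Wn.
rewrite fourier_coefD//; last by apply: bmeasM => //; exact: bmeas_cst.
rewrite fourier_coefZ// fourier_coefD//; last 2 first.
- exact: bmeas_cst.
- by apply: bmeasD => //; apply: bmeasM => //; exact: bmeas_cst.
rewrite fourier_coefD//; last by apply: bmeasM => //; exact: bmeas_cst.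
rewrite fourier_coefZ// !fourier_charfun// mpm mnm.
have -> : fourier_coef (fun=> (b 0)%:C) n = if (0 : int) == n then (b 0)%:C else 0.
  rewrite (_ : (fun=> (b 0)%:C) = (fun y => (b 0)%:C * cis y ^ (0 : int))).
    exact: fourier_coef_mono.
  by apply/funext => y; rewrite expr0z mulr1.
rewrite -bE /p eq_sym; case: eqP => [->|_].
  by rewrite mulr0 !addr0 mulN1r subrr.
rewrite add0r !mulN1r -rmorphB/= -rmorphN -rmorphD/= -[RHS]/(0%:C); congr (_%:C).
by rewrite maxr0B subrr.
Qed.

End wiener_fourier.

(** * Weighted measures with equal trigonometric moments *)

Section fourier_injectivity.
Context {R : realType}.
Implicit Types (m : {measure set (borelR R) -> \bar R}) (f g w : R -> R) (p : {poly R}).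

Definition rbmeas f := measurable_fun setT (f : borelR R -> R) /\ exists M, forall x, `|f x| <= M.

Lemma rbmeasD f g : rbmeas f -> rbmeas g -> rbmeas (fun x => f x + g x).
Proof.
move=> [mf [M fM]] [mg [N gN]]; split; first exact: measurable_funD.
by exists (M + N) => x; apply: (le_trans (ler_normD _ _)); rewrite lerD.
Qed.

Lemma rbmeasM f g : rbmeas f -> rbmeas g -> rbmeas (fun x => f x * g x).
Proof.
move=> [mf [M fM]] [mg [N gN]]; split; first exact: measurable_funM.
by exists (M * N) => x; rewrite normrM ler_pM.
Qed.

Lemma rbmeas_cst (a : R) : rbmeas (fun=> a).
Proof. by split; [exact: measurable_cst|exists `|a|]. Qed.

Lemma rbmeas_cos (a : R) : rbmeas (fun x => cos (a * x)).
Proof.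
split; first by apply: continuous_measurable_fun; exact: continuous_cos_lin.
by exists 1 => x; exact: cos_max.
Qed.

Lemma rbmeas_sin (a : R) : rbmeas (fun x => sin (a * x)).
Proof.
split; first by apply: continuous_measurable_fun; exact: continuous_sin_lin.
by exists 1 => x; exact: sin_max.
Qed.

Lemma rbmeas_integrable m (D : set (borelR R)) f : measurable D -> (m setT < +oo)%E ->
  rbmeas f -> m.-integrable D (EFin \o f).
Proof.
move=> mD mfin [mf bf]; apply: bounded_integrable => //.
exact: finite_measureS.
Qed.

Lemma bounded_cvg_Rintegral m (f_ : nat -> R -> R) f (M : R) : (m setT < +oo)%E ->
  (forall n, measurable_fun setT (f_ n : borelR R -> R)) ->
  measurable_fun setT (f : borelR R -> R) -> (forall n x, `|f_ n x| <= M) ->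
  (forall x, f_ n x @[n --> \oo] --> f x) ->
  \int[m]_(x in setT) f_ n x @[n --> \oo] --> \int[m]_(x in setT) f x.
Proof.
move=> mfin mf_ mf bf cf.
have fM x : `|f x| <= M.
  have /cvgrPdist_le cfx := cf x.
  apply/ler_addgt0Pr => e e0; have [N _ h] := cfx e e0.
  have := h N (leqnn N) => /= h1.
  have h2 := bf N x; have h3 := ler_normD (f x - f_ N x) (f_ N x).
  rewrite subrK in h3; lra.
have mE n : measurable_fun setT (EFin \o (f_ n : borelR R -> R)) by apply/measurable_EFinP.
have mE' : measurable_fun setT (EFin \o (f : borelR R -> R)) by apply/measurable_EFinP.
have cE : {ae m, forall x, setT x -> (EFin \o f_ n) x @[n --> \oo] --> (EFin \o f) x}.
  by apply: aeW => x _; apply: cvg_EFin; [exact: nearW|exact: cf].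
have bE : {ae m, forall x n, setT x -> (`|(EFin \o f_ n) x| <= (EFin \o (fun=> M)) x)%E}.
  by apply: aeW => x n _; rewrite lee_fin; exact: bf.
have iM := rbmeas_integrable measurableT mfin (rbmeas_cst M).
have [if_ _ cI] := dominated_convergence (@measurableT _ (borelR R)) mE mE' cE iM bE.
rewrite /Rintegral; apply: fine_cvg; rewrite fineK//; exact: integrable_fin_num.
Qed.

Lemma sgr_poly_step (y s : R) : 0 < s -> s <= y -> y <= 1 ->
  let y' := (3 * y - y ^+ 3) / 2 in [/\ y <= y', y' <= 1 & 1 - y' <= (1 - s / 2) * (1 - y)].
Proof.
move=> s0 sy y1 /=; split.
- have h : 0 <= y * (1 - y) * (1 + y) by rewrite !mulr_ge0//; lra.
  suff : 0 <= (3 * y - y ^+ 3) / 2 - y by rewrite subr_ge0.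
  have -> : (3 * y - y ^+ 3) / 2 - y = y * (1 - y) * (1 + y) / 2 by field.
  lra.
- have h : 0 <= (1 - y) ^+ 2 * (2 + y) by rewrite mulr_ge0 ?sqr_ge0//; lra.
  suff : 0 <= 1 - (3 * y - y ^+ 3) / 2 by rewrite subr_ge0.
  have -> : 1 - (3 * y - y ^+ 3) / 2 = (1 - y) ^+ 2 * (2 + y) / 2 by field.
  lra.
- have h : 0 <= (1 - y) * (y - s) + (1 - y) * y ^+ 2.
    by rewrite addr_ge0// mulr_ge0 ?sqr_ge0//; lra.
  suff : 0 <= (1 - s / 2) * (1 - y) - (1 - (3 * y - y ^+ 3) / 2) by rewrite subr_ge0.
  have -> : (1 - s / 2) * (1 - y) - (1 - (3 * y - y ^+ 3) / 2) =
    ((1 - y) * (y - s) + (1 - y) * y ^+ 2) / 2 by field.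
  lra.
Qed.

(** Iterates of the odd polynomial (3 y - y^3) / 2, whose attracting fixed
    points are -1 and 1: they approximate the sign on [-1, 1]. *)
Fixpoint sgr_poly (N : nat) : {poly R} :=
  if N is N'.+1 then (3 / 2) *: sgr_poly N' - (2^-1) *: sgr_poly N' ^+ 3 else 'X.

Lemma sgr_polyS N (s : R) :
  (sgr_poly N.+1).[s] = (3 * (sgr_poly N).[s] - (sgr_poly N).[s] ^+ 3) / 2.
Proof. by rewrite /= hornerD hornerN !hornerZ horner_exp; lra. Qed.

Lemma sgr_polyN N (s : R) : (sgr_poly N).[- s] = - (sgr_poly N).[s].
Proof. by elim: N => [|N IH]; rewrite ?hornerX// !sgr_polyS IH; ring. Qed.

Lemma sgr_poly_pos N (s : R) : 0 < s -> s <= 1 ->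
  [/\ s <= (sgr_poly N).[s], (sgr_poly N).[s] <= 1 & 1 - (sgr_poly N).[s] <= (1 - s / 2) ^+ N].
Proof.
move=> s0 s1; elim: N => [|N [IH1 IH2 IH3]].
  by rewrite /= hornerX expr0; split => //; lra.
have [h1 h2 h3] := sgr_poly_step s0 IH1 IH2.
rewrite sgr_polyS; split => //; first exact: le_trans h1.
by apply: (le_trans h3); rewrite exprS; apply: ler_wpM2l => //; lra.
Qed.

Lemma sgr_poly_bounded N (s : R) : `|s| <= 1 -> `|(sgr_poly N).[s]| <= 1.
Proof.
move=> s1; wlog s0 : s s1 / 0 <= s.
  move=> H; have [/H->//|s0] := leP 0 s.
  have := H (- s); rewrite sgr_polyN !normrN oppr_ge0; apply => //; exact: ltW.
have [->|sn0] := eqVneq s 0.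
  by elim: N => [|N IH]; rewrite ?hornerX ?normr0// sgr_polyS;
    have -> : (sgr_poly N).[0] = 0 :> R; rewrite ?expr0n/= ?mulr0 ?subrr ?mul0r ?normr0//;
    have := sgr_polyN N 0; rewrite oppr0; lra.
have sgt0 : 0 < s by rewrite lt_neqAle eq_sym sn0.
rewrite ger0_norm// in s1; have [h1 h2 _] := sgr_poly_pos N sgt0 s1.
by rewrite ger0_norm// (le_trans s0).
Qed.

Lemma sgr_poly_cvg (s : R) : `|s| <= 1 -> (sgr_poly N).[s] @[N --> \oo] --> Num.sg s.
Proof.
have pos (t : R) : 0 < t -> t <= 1 -> (sgr_poly N).[t] @[N --> \oo] --> (1 : R).
  move=> t0 t1; apply/cvgrPdist_le => e e0.
  have q1 : `|1 - t / 2| < 1 by rewrite ger0_norm; lra.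
  have /cvgrPdist_le/(_ _ e0)[N0 _ h] := cvg_expr q1.
  exists N0 => // N N0N; have := h N N0N; rewrite /= sub0r normrN.
  have [h1 h2 h3] := sgr_poly_pos N t0 t1.
  rewrite (ger0_norm (x := 1 - _)); last by rewrite subr_ge0.
  by apply: le_trans; apply: le_trans h3 _; exact: ler_norm.
move=> s1; have [s0|s0|->] := ltrgtP s 0.
- rewrite ltr0_sg// (_ : (fun N => _) = fun N => - (sgr_poly N).[- s]); last first.
    by apply/funext => N; rewrite sgr_polyN opprK.
  apply: cvgN; apply: pos; first by rewrite oppr_gt0.
  by rewrite -(ltr0_norm s0).
- by rewrite gtr0_sg//; apply: pos => //; rewrite -(gtr0_norm s0).
- rewrite sgr0 (_ : (fun N => _) = fun=> 0); first exact: cvg_cst.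
  by apply/funext => N; have := sgr_polyN N 0; rewrite oppr0; lra.
Qed.

Section weighted.
Variables (m1 m2 : {measure set (borelR R) -> \bar R}) (w : R -> R).
Hypotheses (m1fin : (m1 setT < +oo)%E) (m2fin : (m2 setT < +oo)%E) (rw : rbmeas w).

Definition weq f := \int[m1]_(x in setT) (f x * w x) = \int[m2]_(x in setT) (f x * w x).

Lemma weq_ext f g : f =1 g -> weq f -> weq g.
Proof. by move=> /funext ->. Qed.

Lemma weq_lin f g (a b : R) : rbmeas f -> rbmeas g -> weq f -> weq g ->
  weq (fun x => a * f x + b * g x).
Proof.
move=> rf rg; rewrite /weq => ef eg.
have key m : (m setT < +oo)%E -> \int[m]_(x in setT) ((a * f x + b * g x) * w x) =
    a * (\int[m]_(x in setT) (f x * w x)) + b * (\int[m]_(x in setT) (g x * w x)).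
  move=> mfin.
  have rI h : rbmeas h -> m.-integrable [set: borelR R] (EFin \o h).
    exact: rbmeas_integrable.
  have -> : (fun x => (a * f x + b * g x) * w x) =
      ((fun x => a * (f x * w x)) \+ (fun x => b * (g x * w x))).
    by apply/funext => x /=; ring.
  rewrite RintegralD//; last 2 first.
  - exact: rI (rbmeasM (rbmeas_cst a) (rbmeasM rf rw)).
  - exact: rI (rbmeasM (rbmeas_cst b) (rbmeasM rg rw)).
  by rewrite !RintegralZl//; exact: rI (rbmeasM _ rw).
by rewrite !key// ef eg.
Qed.

Lemma weq_cvg (f_ : nat -> R -> R) f (M : R) : (forall n, weq (f_ n)) ->
  (forall n, measurable_fun setT (f_ n : borelR R -> R)) ->
  measurable_fun setT (f : borelR R -> R) -> (forall n x, `|f_ n x| <= M) ->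
  (forall x, f_ n x @[n --> \oo] --> f x) -> weq f.
Proof.
move=> ef mf_ mf bf cf; case: rw => mw [W bw].
have key m : (m setT < +oo)%E ->
    \int[m]_(x in setT) (f_ n x * w x) @[n --> \oo] --> \int[m]_(x in setT) (f x * w x).
  move=> mfin; apply: (@bounded_cvg_Rintegral _ (fun n x => f_ n x * w x) _ (M * W)) => //.
  - by move=> n; exact: measurable_funM.
  - exact: measurable_funM.
  - by move=> n x; rewrite normrM ler_pM.
  - by move=> x; apply: cvgM; [exact: cf|exact: cvg_cst].
have c1 := key _ m1fin; have c2 := key _ m2fin.
rewrite /weq; apply: (cvg_unique _ c1); first exact: Rhausdorff.
rewrite (_ : (fun n => _) = (fun n => \int[m2]_(x in setT) (f_ n x * w x)))//.
by apply/funext => n; exact: ef.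
Qed.

(** The factors [cos (z * x)] and [sin (z * x)] make the class closed under
    multiplication by trigonometric functions, hence by polynomials in
    [sin (h * (x - a))]. *)
Definition trig_weq f := rbmeas f /\ forall z,
  weq (fun x => f x * cos (z * x)) /\ weq (fun x => f x * sin (z * x)).

Lemma trig_weq_ext f g : f =1 g -> trig_weq f -> trig_weq g.
Proof. by move=> /funext ->. Qed.

Lemma trig_weq_lin f g (a b : R) : trig_weq f -> trig_weq g ->
  trig_weq (fun x => a * f x + b * g x).
Proof.
move=> [rf ef] [rg eg]; split.
  exact: rbmeasD (rbmeasM (rbmeas_cst a) rf) (rbmeasM (rbmeas_cst b) rg).
move=> z; have [ef1 ef2] := ef z; have [eg1 eg2] := eg z.
have rc := rbmeas_cos z; have rs := rbmeas_sin z.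
split.
  apply: (@weq_ext (fun x => a * (f x * cos (z * x)) + b * (g x * cos (z * x)))).
    by move=> x /=; ring.
  by apply: weq_lin => //; exact: rbmeasM.
apply: (@weq_ext (fun x => a * (f x * sin (z * x)) + b * (g x * sin (z * x)))).
  by move=> x /=; ring.
by apply: weq_lin => //; exact: rbmeasM.
Qed.

Lemma trig_weq_cos f (a : R) : trig_weq f -> trig_weq (fun x => f x * cos (a * x)).
Proof.
move=> [rf ef]; split; first exact: rbmeasM (rbmeas_cos a).
move=> z; have [p1 p2] := ef (z + a); have [n1 n2] := ef (z - a).
have rc y := rbmeasM rf (rbmeas_cos y); have rs y := rbmeasM rf (rbmeas_sin y).
split.
  apply: weq_ext (weq_lin 2^-1 2^-1 (rc _) (rc _) p1 n1) => x /=.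
  by rewrite mulrDl mulrBl cosD cosB; field.
apply: weq_ext (weq_lin 2^-1 2^-1 (rs _) (rs _) p2 n2) => x /=.
by rewrite mulrDl mulrBl sinD sinB; field.
Qed.

Lemma trig_weq_sin f (a : R) : trig_weq f -> trig_weq (fun x => f x * sin (a * x)).
Proof.
move=> [rf ef]; split; first exact: rbmeasM (rbmeas_sin a).
move=> z; have [p1 p2] := ef (z + a); have [n1 n2] := ef (z - a).
have rc y := rbmeasM rf (rbmeas_cos y); have rs y := rbmeasM rf (rbmeas_sin y).
split.
  apply: weq_ext (weq_lin 2^-1 (- 2^-1) (rs _) (rs _) p2 n2) => x /=.
  by rewrite mulrDl mulrBl sinD sinB; field.
apply: weq_ext (weq_lin (- 2^-1) 2^-1 (rc _) (rc _) p1 n1) => x /=.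
by rewrite mulrDl mulrBl cosD cosB; field.
Qed.

Hypothesis trig1 : trig_weq (fun=> 1).

Lemma trig_weq_poly p (h a : R) : trig_weq (fun x => p.[sin (h * (x - a))]).
Proof.
elim/poly_ind: p => [|p c IH].
  by apply: trig_weq_ext (trig_weq_lin 0 0 trig1 trig1) => x; rewrite horner0; ring.
have e := trig_weq_lin (cos (h * a)) (- sin (h * a)) (trig_weq_sin h IH) (trig_weq_cos h IH).
apply: trig_weq_ext (trig_weq_lin 1 c e trig1) => x /=.
rewrite hornerD hornerMX hornerC mulrBr sinB; ring.
Qed.

Lemma weq_trig f : trig_weq f -> weq f.
Proof.
by move=> [_ /(_ 0)[+ _]]; apply: weq_ext => x; rewrite mul0r cos0 mulr1.
Qed.

Lemma measurable_sg : measurable_fun setT (Num.sg : borelR R -> R).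
Proof.
rewrite (_ : Num.sg = fun x => \1_`]0, +oo[%classic x - \1_`]-oo, 0[%classic x).
  by apply: measurable_funB; exact: measurable_indic.
apply/funext => x; rewrite !indicE.
have [x0|x0|->] := ltrgtP x 0.
- by rewrite ltr0_sg// memNset ?mem_set ?sub0r//= in_itv/= ?x0// andbT; apply/negP; rewrite -leNgt ltW.
- by rewrite gtr0_sg// mem_set ?memNset ?subr0//= in_itv/= ?x0//; apply/negP; rewrite -leNgt ltW.
- by rewrite sgr0 !memNset ?subr0//= in_itv/= ltxx.
Qed.

Lemma abs_sg_le1 (x : R) : `|Num.sg x| <= 1.
Proof. by rewrite normr_sg; case: (x == 0). Qed.

Lemma measurable_sg_sin (h a : R) :
  measurable_fun setT ((fun x => Num.sg (sin (h * (x - a)))) : borelR R -> R).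
Proof.
apply: (measurableT_comp measurable_sg).
have [[+ _] _] := trig_weq_poly 'X h a.
by congr measurable_fun; apply/funext => x; rewrite hornerX.
Qed.

Lemma weq_sg_sin (h a : R) : weq (fun x => Num.sg (sin (h * (x - a)))).
Proof.
apply: (@weq_cvg (fun N x => (sgr_poly N).[sin (h * (x - a))]) _ 1).
- by move=> N; apply: weq_trig; exact: trig_weq_poly.
- by move=> N; have [[]] := trig_weq_poly (sgr_poly N) h a.
- exact: measurable_sg_sin.
- by move=> N x; apply: sgr_poly_bounded; exact: sin_max.
- by move=> x; apply: sgr_poly_cvg; exact: sin_max.
Qed.

Lemma sg_sin (u : R) : `|u| < pi -> Num.sg (sin u) = Num.sg u.
Proof.
have pos (t : R) : 0 < t -> `|t| < pi -> Num.sg (sin t) = Num.sg t.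
  move=> t0; rewrite gtr0_norm// => tpi.
  by rewrite !gtr0_sg// sin_gt0_pi// t0.
move=> upi; have [u0|u0|->] := ltrgtP u 0.
- by apply: oppr_inj; rewrite -!sgrN -sinN pos ?oppr_gt0 ?normrN.
- exact: pos.
- by rewrite sin0.
Qed.

Lemma cvg_eventually (u : nat -> R) (l : R) (e : R) : 0 < e ->
  (forall n, n.+1%:R^-1 < e -> u n = l) -> u n @[n --> \oo] --> l.
Proof.
move=> e0 ul; apply: cvg_near_cst.
have [N _ h] := near_infty_natSinv_lt (PosNum e0).
by exists N => // n Nn; rewrite /= ul//; exact: (h n Nn).
Qed.

(** As [h] tends to 0, the interval of radius [pi / h] around [a], where
    [sin (h * (x - a))] has the sign of [x - a], exhausts the line. *)
Lemma weq_sg (a : R) : weq (fun x => Num.sg (x - a)).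
Proof.
apply: (@weq_cvg (fun n x => Num.sg (sin (n.+1%:R^-1 * (x - a)))) _ 1).
- by move=> n; exact: weq_sg_sin.
- by move=> n; exact: measurable_sg_sin.
- apply: (measurableT_comp measurable_sg); apply: measurable_funB => //.
- by move=> n x; exact: abs_sg_le1.
- move=> x; have xa1 : 0 < `|x - a| + 1 by rewrite ltr_wpDl.
  have e0 : 0 < pi / (`|x - a| + 1) :> R by apply: divr_gt0 => //; exact: pi_gt0.
  apply: (cvg_eventually e0) => n; rewrite (ltr_pdivlMr _ _ xa1) => nlt.
  have n0 : 0 < n.+1%:R^-1 :> R by rewrite invr_gt0.
  rewrite sg_sin; first by rewrite sgrM (gtr0_sg n0) mul1r.
  rewrite normrM (gtr0_norm n0); apply: le_lt_trans nlt.
  by rewrite (ler_wpM2l (ltW n0))// lerDl.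
Qed.

(** The limit of [sg (x - a - 1 / n)] is [-1] at [x = a], where that of [sg (x - a)]
    is 0: this is what makes the indicator function of an open ray. *)
Lemma weq_ray (a : R) : weq \1_`]a, +oo[%classic.
Proof.
pose s (x : R) : R := if a < x then 1 else -1.
have sE x : \1_`]a, +oo[%classic x = 2^-1 * s x + 2^-1 * 1 :> R.
  rewrite indicE /s; case: ifPn => ax.
    by rewrite mem_set /= ?in_itv/= ?ax//; lra.
  rewrite memNset/=; first lra.
  by rewrite in_itv/= andbT; apply/negP.
have ms : measurable_fun setT (s : borelR R -> R).
  rewrite (_ : s = fun x => 2 * \1_`]a, +oo[%classic x - 1).
    by apply: measurable_funB => //; apply: measurable_funM => //; exact: measurable_indic.
  by apply/funext => x; rewrite sE; field.
have rs : rbmeas s.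
  by split=> //; exists 1 => x; rewrite /s; case: ifP; rewrite ?normrN normr1.
apply: (@weq_ext (fun x => 2^-1 * s x + 2^-1 * 1)); first by move=> x; rewrite sE.
apply: weq_lin => //; [exact: rbmeas_cst| |exact: weq_trig].
apply: (@weq_cvg (fun n x => Num.sg (x - (a + n.+1%:R^-1))) _ 1) => //.
- by move=> n; exact: weq_sg.
- by move=> n; apply: (measurableT_comp measurable_sg); exact: measurable_funB.
- by move=> n x; exact: abs_sg_le1.
- move=> x; rewrite /s; case: ifPn => [ax|].
    have xa : 0 < x - a by rewrite subr_gt0.
    apply: (cvg_eventually xa) => n nlt; rewrite gtr0_sg//.
    by move: nlt; move: (n.+1%:R^-1 : R) => y; lra.
  rewrite -leNgt => xa; apply: (cvg_eventually ltr01) => n _; rewrite ltr0_sg//.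
  have : 0 < n.+1%:R^-1 :> R by rewrite invr_gt0.
  by move: (n.+1%:R^-1 : R) => y; lra.
Qed.

Hypothesis w_ge0 : forall x, 0 <= w x.

Lemma integral_weighted_ray (m : {measure set (borelR R) -> \bar R}) (a : R) :
  (m setT < +oo)%E ->
  (\int[m]_(x in `]a, +oo[%classic) (w x)%:E)%E =
  (\int[m]_(x in setT) (\1_`]a, +oo[%classic x * w x))%:E.
Proof.
move=> mfin; have mi : measurable_fun setT (\1_`]a, +oo[%classic : borelR R -> R).
  exact: measurable_indic.
have r1 : rbmeas (\1_`]a, +oo[%classic : R -> R).
  split => //; exists 1 => x; rewrite indicE; case: (_ \in _); by rewrite ?normr1 ?normr0.
rewrite /Rintegral fineK; last first.
  by apply: integrable_fin_num => //; exact: (rbmeas_integrable measurableT mfin (rbmeasM r1 rw)).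
rewrite [LHS]integral_mkcond/=; apply: eq_integral => x _.
rewrite patchE indicE; case: ifP => _; by rewrite ?mul1r ?mul0r.
Qed.

(** Open rays are stable under intersection and generate the Borel sets. *)
Lemma weighted_measure_inj (B : set (borelR R)) : measurable B ->
  (\int[m1]_(x in B) (w x)%:E = \int[m2]_(x in B) (w x)%:E)%E.
Proof.
move=> mB; have mw : measurable_fun setT (EFin \o (w : borelR R -> R)).
  by apply/measurable_EFinP; case: rw.
have wm (m : {measure set (borelR R) -> \bar R}) :
    exists m' : {measure set (borelR R) -> \bar R},
      forall A, m' A = (\int[m]_(x in A) (w x)%:E)%E.
  pose f A := (\int[m]_(x in A) (w x)%:E)%E.
  have f0 : f set0 = 0%E by exact: integral_set0.
  have f_ge0 A : (0 <= f A)%E by apply: integral_ge0 => x _; rewrite lee_fin.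
  have fS : semi_sigma_additive f.
    by apply: semi_sigma_additive_nng_induced => // x; rewrite lee_fin.
  pose M := isMeasure.Build _ _ _ f f0 f_ge0 fS.
  by exists (HB.pack_for {measure set (borelR R) -> \bar R} f M).
have [n1 n1E] := wm m1; have [n2 n2E] := wm m2.
rewrite -n1E -n2E.
have ray a : n1 `]a, +oo[%classic = n2 `]a, +oo[%classic.
  by rewrite n1E n2E !integral_weighted_ray// weq_ray.
have GE : @measurable _ (borelR R) = <<s @RGenOInfty.G R >>.
  exact: RGenOInfty.measurableE.
apply: (@measure_unique _ R (borelR R) _ (fun n => `](- n%:R)%R, +oo[%classic) GE) => //.
- move=> A B' [x ->] [y ->]; exists (Num.max x y).
  by apply/seteqP; split => t /=; rewrite !in_itv/= !andbT gt_max => /andP.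
- by move=> i; exists (- i%:R).
- apply/seteqP; split => // x _; have [n _ xn] := nbhs_infty_gtr (- x).
  exists n => //=; rewrite in_itv/= andbT ltrNl; exact: (xn n (leqnn n)).
- by move=> A [x ->]; exact: ray.
- by move=> k; rewrite n1E integral_weighted_ray// ltry.
Qed.

End weighted.
End fourier_injectivity.

(** * Signed measures as differences of finite measures *)

Section charges.
Context {R : realType}.
Implicit Types (m : {measure set (borelR R) -> \bar R}) (B : set (borelR R)).
Implicit Types (zeta : {charge set (borelR R) -> \bar R}).

Lemma charge_of_measures m1 m2 : (m1 setT < +oo)%E -> (m2 setT < +oo)%E ->
  exists zeta, forall B, zeta B = (m1 B - m2 B)%E.
Proof.
move=> f1 f2; pose f B := (m1 B - m2 B)%E.
have f0 : f set0 = 0%E by rewrite /f !measure0 sube0.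
have ff B : measurable B -> f B \is a fin_num.
  by move=> mB; rewrite fin_numB !finite_measure_fin_num.
have fS : semi_sigma_additive f.
  move=> F mF tF mUF.
  rewrite (_ : (fun n => _) = (fun n =>
      \sum_(0 <= i < n) m1 (F i) - \sum_(0 <= i < n) m2 (F i))%E); last first.
    apply/funext => k; rewrite big_split/= sumeN// => i j _ _.
    by rewrite fin_num_adde_defl// finite_measure_fin_num.
  apply: cvgeB; [|exact: measure_semi_sigma_additive|exact: measure_semi_sigma_additive].
  by rewrite fin_num_adde_defl// fin_numN finite_measure_fin_num.
pose M := isCharge.Build _ _ _ f f0 ff fS.
by exists (HB.pack_for ({charge set (borelR R) -> \bar R})%type f M).
Qed.

Lemma jordan_parts zeta B : measurable B ->
  zeta B = (pos_part zeta B - neg_part zeta B)%E.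
Proof.
move=> mB; rewrite (jordan_decomp (hahnP zeta) mB).
by rewrite /cadd/= cscaleN1.
Qed.

Lemma pos_part_fin zeta B : measurable B -> pos_part zeta B \is a fin_num.
Proof. by move=> mB; apply: finite_measure_fin_num => //; case: (finite_part zeta). Qed.

Lemma neg_part_fin zeta B : measurable B -> neg_part zeta B \is a fin_num.
Proof. by move=> mB; apply: finite_measure_fin_num => //; case: (finite_part zeta). Qed.

(** Written without differences, the equality relates two measures, whose integrals
    can then be compared. *)
Lemma jordan_crossE zeta m1 m2 : (m1 setT < +oo)%E -> (m2 setT < +oo)%E ->
  (forall B, measurable B -> zeta B = m1 B - m2 B)%E ->
  forall B, measurable B -> (pos_part zeta B + m2 B = neg_part zeta B + m1 B)%E.
Proof.
move=> f1 f2 zE B mB; have := zE B mB; rewrite (jordan_parts zeta mB).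
have := pos_part_fin zeta mB; have := neg_part_fin zeta mB.
have := finite_measure_fin_num mB f1; have := finite_measure_fin_num mB f2.
move: (pos_part zeta B) (neg_part zeta B) (m1 B) (m2 B).
move=> [a| |] [b| |] [x| |] [y| |] //= _ _ _ _ [h]; congr EFin; lra.
Qed.

Lemma cintegral_measure_add m1 m2 F : (m1 setT < +oo)%E -> (m2 setT < +oo)%E ->
  bmeas F -> cintegral (measure_add m1 m2) setT F = cintegral m1 setT F + cintegral m2 setT F.
Proof.
move=> f1 f2 bF; have [i1 i2] := bmeas_cintegrable (@measurableT _ (borelR R)) f1 bF.
have [j1 j2] := bmeas_cintegrable (@measurableT _ (borelR R)) f2 bF.
have fi m (f : R -> R) : m.-integrable [set: borelR R] (EFin \o f) ->
  (\int[m]_(x in setT) (f x)%:E)%E \is a fin_num by exact: integrable_fin_num.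
rewrite /cintegral /Rintegral !integral_measure_add//.
rewrite (fineD (fi _ _ i1) (fi _ _ j1)) (fineD (fi _ _ i2) (fi _ _ j2)).
by [].
Qed.

Lemma cintegral_eq_measure m1 m2 F : (forall B, measurable B -> m1 B = m2 B) ->
  cintegral m1 setT F = cintegral m2 setT F.
Proof.
move=> mE; rewrite /cintegral /Rintegral.
by congr ((fine _) +i* (fine _)); apply: eq_measure_integral => B mB _; exact: mE.
Qed.

Lemma scintegral_measures zeta m1 m2 F : (m1 setT < +oo)%E -> (m2 setT < +oo)%E ->
  (forall B, measurable B -> zeta B = m1 B - m2 B)%E -> bmeas F ->
  scintegral zeta setT F = cintegral m1 setT F - cintegral m2 setT F.
Proof.
move=> f1 f2 zE bF; have [pf nf] := finite_part zeta.
have e : cintegral (measure_add (pos_part zeta) m2) setT F =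
    cintegral (measure_add (neg_part zeta) m1) setT F.
  apply: cintegral_eq_measure => B mB; etransitivity; first exact: measure_addE.
  etransitivity; last by symmetry; exact: measure_addE.
  exact: jordan_crossE.
move: e; rewrite !cintegral_measure_add// /scintegral => e.
apply/eqP; rewrite subr_eq addrAC -subr_eq opprK; apply/eqP.
by rewrite e addrC.
Qed.

(** The Jordan parts of [m1 - m2] have equal weighted masses on each half of a Hahn
    decomposition, where one of them vanishes.  Each density may have zeros, as
    long as no point is a zero of all of them. *)
Lemma positive_density_inj m1 m2 (w : nat -> R -> R) :
  (m1 setT < +oo)%E -> (m2 setT < +oo)%E ->
  (forall k, rbmeas (w k)) -> (forall k x, 0 <= w k x) ->
  (forall x, exists k, 0 < w k x) ->
  (forall k B, measurable B ->
    \int[m1]_(x in B) (w k x)%:E = \int[m2]_(x in B) (w k x)%:E)%E ->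
  forall B, measurable B -> m1 B = m2 B.
Proof.
move=> f1 f2 rw w0 wpos wE B mB.
have [s sE] := charge_of_measures f1 f2.
have cross A (mA : measurable A) := jordan_crossE f1 f2 (fun B _ => sE B) mA.
have [pf nf] := finite_part s.
have mw k D : measurable_fun D (EFin \o (w k : borelR R -> R)).
  by apply: measurable_funTS; apply/measurable_EFinP; case: (rw k).
have wI k A : measurable A ->
    (\int[pos_part s]_(x in A) (w k x)%:E = \int[neg_part s]_(x in A) (w k x)%:E)%E.
  move=> mA.
  have e : (\int[measure_add (pos_part s) m2]_(x in A) (w k x)%:E =
      \int[measure_add (neg_part s) m1]_(x in A) (w k x)%:E)%E.
    apply: eq_measure_integral => B' mB' _; etransitivity; first exact: measure_addE.
    etransitivity; last by symmetry; exact: measure_addE.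
    exact: cross.
  have wA x : A x -> (0 <= (w k x)%:E)%E by rewrite lee_fin.
  move: e; rewrite (ge0_integral_measure_add (pos_part s) m2 mA wA (mw k A)).
  rewrite (ge0_integral_measure_add (neg_part s) m1 mA wA (mw k A)).
  rewrite wE//.
  have : (\int[m2]_(x in A) (w k x)%:E)%E \is a fin_num.
    by apply: integrable_fin_num => //; exact: (rbmeas_integrable mA f2 (rw k)).
  move: (\int[m2]_(x in A) _)%E (\int[pos_part s]_(x in A) _)%E
    (\int[neg_part s]_(x in A) _)%E => [z| |] [x| |] [y| |] //= _ [h].
  by congr EFin; lra.
have null (q : {measure set (borelR R) -> \bar R}) A :
    measurable A -> (forall k, \int[q]_(x in A) (w k x)%:E = 0)%E -> q A = 0%E.
  move=> mA qA; pose S k := A `&` [set x | 0 < w k x].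
  have mS k : measurable (S k).
    have -> : S k = A `&` ((w k : borelR R -> R) @^-1` `]0, +oo[%classic).
      by apply/seteqP; split => x /=; rewrite /S/= in_itv/= andbT.
    apply: measurableI => //; have [mwk _] := rw k.
    by rewrite -[X in measurable X]setTI; exact: mwk.
  have nS k : q.-negligible (S k).
    have h : (\int[q]_(x in A) `|(EFin \o w k) x| = 0)%E.
      by rewrite -(qA k); apply: eq_integral => x _; rewrite /= ger0_norm.
    have /(ae_eq_integral_abs q mA (mw k A)) [N [mN N0 AN]] := h.
    exists N; split => // x [Ax wx]; apply: AN => /= /(_ Ax)[].
    by move=> w0'; move: wx; rewrite /= w0' ltxx.
  have : q.-negligible A.
    apply: negligibleS (negligible_bigcup nS) => x Ax.
    by have [k wk] := wpos x; exists k.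
  by move/negligibleP => /(_ mA).
have [[mP _] [mN _] _ _] := hahnP s.
have P0 : pos_part s (hahn s).1 = 0%E.
  apply: null => // k; rewrite wI// null_set_integral//; [exact: mw|exact: neg_part_pos].
have N0 : neg_part s (hahn s).2 = 0%E.
  apply: null => // k; rewrite -wI// null_set_integral//; [exact: mw|exact: pos_part_neg].
have part0 (q : {measure set (borelR R) -> \bar R}) A :
    measurable A -> q A = 0%E -> q B = q (B `&` A) -> q B = 0%E.
  move=> mA qA ->; apply/eqP; rewrite eq_le measure_ge0 andbT -qA.
  by apply: le_measure; rewrite ?inE//; exact: measurableI.
have pB : pos_part s B = 0%E.
  apply: part0 P0 _ => //; rewrite [LHS]pos_partE// [RHS]pos_partE//.
    by rewrite -setIA setIid.
  exact: measurableI.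
have nB : neg_part s B = 0%E.
  apply: part0 N0 _ => //; rewrite [LHS]neg_partE// [RHS]neg_partE//.
    by rewrite -setIA setIid.
  exact: measurableI.
by have := cross B mB; rewrite pB nB !add0e => ->.
Qed.

End charges.

(** * Uniqueness of the characteristic pair *)

Section exponents.
Context {R : realType}.
Variable c : R -> R.
Hypothesis rep : representation_function c.
Implicit Types (m : {measure set (borelR R) -> \bar R}).
Implicit Types (zeta : {charge set (borelR R) -> \bar R}).

Local Notation cabs := (ComplexField.Normc.normc).

Lemma levy_density0 : levy_density (0 : R) = 0.
Proof. by rewrite /levy_density expr0n/= min_r ?ler01// invr0. Qed.

Lemma levy_density_ge0 (x : R) : 0 <= levy_density x.
Proof. by rewrite -lee_fin; exact: density_ge0. Qed.

Lemma levy_density_gt0 (x : R) : x != 0 -> 0 < levy_density x.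
Proof.
by move=> x0; rewrite invr_gt0 lt_min ltr01 exprn_even_gt0//= x0.
Qed.

Lemma levy_density_far (x : R) : 1 <= `|x| -> levy_density x = 1.
Proof.
move=> x1; rewrite /levy_density min_l ?invr1//.
by rewrite -real_normK ?num_real// exprn_ege1.
Qed.

Lemma levy_density_near (x : R) : `|x| <= 1 -> levy_density x = (x ^+ 2)^-1.
Proof.
move=> x1; rewrite /levy_density min_r//.
by rewrite -real_normK ?num_real// exprn_ile1.
Qed.

Lemma levy_density_le (d x : R) : 0 < d -> d <= 1 -> d <= `|x| -> levy_density x <= (d ^+ 2)^-1.
Proof.
move=> d0 d1 dx; rewrite /levy_density lef_pV2 ?posrE ?exprn_gt0//; last first.
  by rewrite lt_min ltr01 exprn_even_gt0//= -normr_gt0 (lt_le_trans d0).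
rewrite le_min; apply/andP; split; first by rewrite exprn_ile1// ltW.
rewrite -(real_normK (num_real x)) ler_sqr// nnegrE.
exact: ltW.
Qed.

Lemma g_Re (x z : R) : complex.Re (g_ c x z) =
  (cos (z * x) - 1) * levy_density x - z ^+ 2 / 2 * (x == 0)%:R.
Proof.
rewrite /g_; case: eqP => [->|/eqP x0]; first by rewrite levy_density0 mulr0 sub0r mulr1.
rewrite mulr0 subr0 cexp_i -fmorphV cReM !cReD !cReN/= !mul0r.
by rewrite !(mulr0, mul0r, mul1r, oppr0, addr0, add0r).
Qed.

Lemma g_Im (x z : R) : complex.Im (g_ c x z) =
  (sin (z * x) - z * c x) * levy_density x.
Proof.
rewrite /g_; case: eqP => [->|/eqP x0]; first by rewrite levy_density0 mulr0.
rewrite cexp_i -fmorphV cImM !cImD !cImN/=.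
by rewrite !(mulr0, mul0r, mul1r, oppr0, addr0, add0r).
Qed.

Lemma representation_near0 : exists2 d : R, 0 < d <= 1 &
  forall x, x != 0 -> `|x| < d -> `|c x - x| <= x ^+ 2.
Proof.
have [_ _ /cvgrPdist_le/(_ _ ltr01)] := rep.
move=> [e /= e0 he]; exists (Num.min e 1); first by rewrite lt_min e0 ltr01 ge_min lexx orbT.
move=> x x0; rewrite lt_min => /andP[xe _].
have := he x; rewrite /= sub0r normrN => /(_ xe x0).
rewrite sub0r normrN normrM normfV ler_pdivrMr ?normr_gt0 ?expf_neq0//.
by rewrite mul1r (ger0_norm (sqr_ge0 x)).
Qed.

(** Near 0 the density [1 / x ^ 2] is compensated by the second order of vanishing
    of the numerator, which is what the condition on [c] at 0 provides; away from 0
    all factors are bounded. *)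
Lemma g_bounded (Z : R) : exists K, forall z, `|z| <= Z -> forall x,
  `|complex.Re (g_ c x z)| <= K /\ `|complex.Im (g_ c x z)| <= K.
Proof.
have [_ [M cM] _] := rep; have [d /andP[d0 d1] hd] := representation_near0.
have M0 : 0 <= M := le_trans (normr_ge0 _) (cM 0).
have D0 : 0 <= (d ^+ 2)^-1 by rewrite invr_ge0 sqr_ge0.
exists (2 + 2 * Z ^+ 2 + Z + (1 + Z * M) * (d ^+ 2)^-1) => z zZ x.
have Z0 : 0 <= Z := le_trans (normr_ge0 _) zZ.
have z2 : z ^+ 2 <= Z ^+ 2 by rewrite -real_normK ?num_real// ler_sqr ?nnegrE.
have Z2 : 0 <= Z ^+ 2 by exact: sqr_ge0.
have z20 : 0 <= z ^+ 2 by exact: sqr_ge0.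
have T0 : 0 <= (1 + Z * M) * (d ^+ 2)^-1 by rewrite mulr_ge0// addr_ge0// mulr_ge0.
rewrite g_Re g_Im; have [->|x0] := eqVneq x 0.
  rewrite levy_density0 !mulr0 sub0r normrN normr0 mulr1 ger0_norm; last by lra.
  by split; lra.
rewrite mulr0 subr0.
have ld0 := levy_density_ge0 x.
have x20 : 0 < x ^+ 2 by rewrite exprn_even_gt0.
split.
  rewrite normrM (ger0_norm ld0).
  have [x1|x1] := leP 1 `|x|.
    rewrite levy_density_far// mulr1.
    have := ler_normB (cos (z * x)) 1; have := cos_max (z * x); rewrite normr1; lra.
  rewrite levy_density_near ?(ltW x1)// ler_pdivrMr//.
  apply: (le_trans (abs_cos1_le _)); rewrite exprMn.
  have h1 : z ^+ 2 * x ^+ 2 <= Z ^+ 2 * x ^+ 2 by rewrite ler_wpM2r// ltW.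
  have h2 : 0 <= (2 + Z + (1 + Z * M) * (d ^+ 2)^-1) * x ^+ 2.
    by apply: mulr_ge0; [lra|exact: ltW].
  have h3 : 0 <= Z ^+ 2 * x ^+ 2 by apply: mulr_ge0 => //; exact: ltW.
  move: h1 h2 h3; move: ((1 + Z * M) * (d ^+ 2)^-1) (x ^+ 2) (Z ^+ 2) (z ^+ 2) => A B C D; nra.
rewrite normrM (ger0_norm ld0).
have [xd|xd] := leP d `|x|.
  have h1 : `|sin (z * x) - z * c x| <= 1 + Z * M.
    apply: (le_trans (ler_normB _ _)); apply: lerD; first exact: sin_max.
    by rewrite normrM ler_pM.
  have h2 := levy_density_le d0 d1 xd.
  have h3 : `|sin (z * x) - z * c x| * levy_density x <= (1 + Z * M) * (d ^+ 2)^-1.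
    by rewrite ler_pM.
  lra.
have x1 : `|x| <= 1 by rewrite (le_trans (ltW xd)).
rewrite levy_density_near// ler_pdivrMr//.
have -> : sin (z * x) - z * c x = (sin (z * x) - z * x) - z * (c x - x) by ring.
have h1 := abs_sinB_le (z * x); have h2 := hd x x0 xd.
have h3 : `|z * (c x - x)| <= Z * x ^+ 2 by rewrite normrM ler_pM.
apply: (le_trans (ler_normB _ _)).
rewrite exprMn in h1.
have h4 : z ^+ 2 * x ^+ 2 <= Z ^+ 2 * x ^+ 2 by rewrite ler_wpM2r// ltW.
have h5 : 0 <= (2 + (1 + Z * M) * (d ^+ 2)^-1) * x ^+ 2.
  by apply: mulr_ge0; [lra|exact: ltW].
move: h1 h3 h4 h5; move: `|sin (z * x) - z * x| `|z * (c x - x)|.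
move: ((1 + Z * M) * (d ^+ 2)^-1) (x ^+ 2) (Z ^+ 2) (z ^+ 2) => A B C D E F.
rewrite !mulrDl -!mulrA; move: (D * B) (C * B) (A * B) (Z * B) => a1 a2 a3 a4; lra.
Qed.

Lemma measurable_levy_density : measurable_fun setT (levy_density : borelR R -> R).
Proof. by apply/measurable_EFinP; exact: measurable_density. Qed.

Lemma measurable_at0 : measurable_fun setT ((fun x => (x == 0)%:R) : borelR R -> R).
Proof.
rewrite (_ : (fun x => _) = \1_[set 0]); last first.
  by apply/funext => x; rewrite indicE; congr (_%:R); congr nat_of_bool;
    apply/eqP/idP => [->|]; rewrite inE.
by apply: measurable_indic; exact: measurable_set1.
Qed.

Lemma measurable_cos_lin (z : R) : measurable_fun setT ((fun x => cos (z * x)) : borelR R -> R).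
Proof. by case: (rbmeas_cos z). Qed.

Lemma measurable_sin_lin (z : R) : measurable_fun setT ((fun x => sin (z * x)) : borelR R -> R).
Proof. by case: (rbmeas_sin z). Qed.

Lemma bmeas_g (z : R) : bmeas (fun x => g_ c x z).
Proof.
have [mc _ _] := rep; split.
- under eq_fun do rewrite g_Re; apply: measurable_funB.
    apply: measurable_funM; last exact: measurable_levy_density.
    by apply: measurable_funB => //; exact: measurable_cos_lin.
  by apply: measurable_funM => //; exact: measurable_at0.
- under eq_fun do rewrite g_Im; apply: measurable_funM; last exact: measurable_levy_density.
  by apply: measurable_funB; [exact: measurable_sin_lin|exact: measurable_funM].
- have [K hK] := g_bounded `|z|; exists (K + K) => x.
  by apply: (le_trans (cabs_leD _)); have [h1 h2] := hK z (lexx _) x; rewrite lerD.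
Qed.

Lemma continuous_parameter_Rintegral m (f : R -> R -> R) : (m setT < +oo)%E ->
  (forall z, measurable_fun setT (f z : borelR R -> R)) ->
  (forall x, continuous (f^~ x)) ->
  (forall Z, exists K, forall z, `|z| <= Z -> forall x, `|f z x| <= K) ->
  continuous (fun z => \int[m]_(x in setT) f z x).
Proof.
move=> mfin mf cf bf z; pose Z := `|z| + 1; have [K hK] := bf Z.
have inI y : `](- Z), Z[%classic y -> `|y| <= Z.
  by rewrite /= in_itv/= -ltr_norml => /ltW.
have := @continuity_under_integral R _ (borelR R) m f setT measurableT (- Z) Z.
apply.
- by move=> y /inI yZ; apply: bounded_integrable => //; exists K; exact: hK.
- by apply: aeW => x _ y _; exact: cf.
- exact: (rbmeas_integrable measurableT mfin (rbmeas_cst K)).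
- by move=> y /inI yZ; apply: aeW => x _; exact: hK.
- by rewrite mem_set//= in_itv/= -ltr_norml ltrDl.
Qed.

Lemma continuous_cintegral_g m : (m setT < +oo)%E ->
  continuous (fun z => complex.Im (cintegral m setT (fun x => g_ c x z))).
Proof.
move=> mfin; apply: (@continuous_parameter_Rintegral m (fun z x => complex.Im (g_ c x z))) => //.
- by move=> z; have [] := bmeas_g z.
- move=> x; under eq_fun do rewrite g_Im.
  apply: continuous_mulf; last by move=> y; exact: cvg_cst.
  apply: continuous_addf.
    by under eq_fun do rewrite mulrC; exact: continuous_sin_lin.
  apply: continuous_oppf; under eq_fun do rewrite mulrC; exact: continuous_lin.
- by move=> Z; have [K hK] := g_bounded Z; exists K => z zZ x; have [] := hK z zZ x.
Qed.

(** Up to the factor [- e ^ (i z x)], this is the second difference in [z] of [g_ c x],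
    the summand at 0 coming from the Gaussian term. *)
Definition difference_weight (h x : R) : R :=
  2 * (1 - cos (h * x)) * levy_density x + h ^+ 2 * (x == 0)%:R.

Lemma g_second_difference (h x z : R) :
  g_ c x (z + h) + g_ c x (z - h) - 2%:R%:C * g_ c x z =
  - (cexp ('i%C * (z * x)%:C) * (difference_weight h x)%:C).
Proof.
rewrite cexp_i /difference_weight.
have c1 : cos ((z + h) * x) = cos (z * x) * cos (h * x) - sin (z * x) * sin (h * x).
  by rewrite mulrDl cosD.
have c2 : cos ((z - h) * x) = cos (z * x) * cos (h * x) + sin (z * x) * sin (h * x).
  by rewrite mulrBl cosB.
have s1 : sin ((z + h) * x) = sin (z * x) * cos (h * x) + cos (z * x) * sin (h * x).
  by rewrite mulrDl sinD.
have s2 : sin ((z - h) * x) = sin (z * x) * cos (h * x) - cos (z * x) * sin (h * x).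
  by rewrite mulrBl sinB.
apply: complex_eqP.
  rewrite cReN cReM !cReD cReN cReM !g_Re g_Im/= c1 c2.
  have [->|x0] := eqVneq x 0; first by rewrite !mulr0 cos0 levy_density0; field.
  by rewrite /=; ring.
rewrite cImN cImM !cImD cImN cImM !g_Im g_Re/= s1 s2.
have [->|x0] := eqVneq x 0; first by rewrite !mulr0 sin0 levy_density0; ring.
by rewrite /=; ring.
Qed.

Lemma difference_weight_ge0 (h x : R) : 0 <= difference_weight h x.
Proof.
rewrite /difference_weight addr_ge0//; last by rewrite mulr_ge0// sqr_ge0.
by rewrite mulr_ge0 ?levy_density_ge0// mulr_ge0// subr_ge0 (le_trans (ler_norm _) (cos_max _)).
Qed.

Lemma cos_lt1 (t : R) : t != 0 -> `|t| < pi -> cos t < 1.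
Proof.
move=> t0 tpi; have -> : cos t = 1 - 2 * sin (t / 2) ^+ 2.
  by rewrite [in LHS](splitr t) cosD; have := cos2Dsin2 (t / 2); lra.
suff : 0 < sin (t / 2) ^+ 2 by lra.
rewrite exprn_even_gt0//= -sgr_eq0 sg_sin ?sgr_eq0 ?mulf_neq0//.
rewrite normrM (ger0_norm (x := 2^-1))//; have := normr_ge0 t; lra.
Qed.

(** The weight vanishes at nonzero multiples of [2 * pi / h] only, and [h] may be
    small. *)
Lemma difference_weight_gt0 (x : R) : exists k : nat, 0 < difference_weight k.+1%:R^-1 x.
Proof.
have [->|x0] := eqVneq x 0.
  by exists 0%N; rewrite /difference_weight eqxx levy_density0 mulr0 add0r mulr1 invr1 expr1n.
have x1 : 0 < `|x| by rewrite normr_gt0.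
have px : 0 < pi / `|x| :> R by apply: divr_gt0 => //; exact: pi_gt0.
have [k _ hk] := near_infty_natSinv_lt (PosNum px).
exists k; have := hk k (leqnn k); rewrite /= ltr_pdivlMr// => kx.
rewrite /difference_weight (negbTE x0) mulr0 addr0 mulr_gt0 ?levy_density_gt0//.
rewrite mulr_gt0// subr_gt0 cos_lt1 ?mulf_neq0//.
by rewrite normrM ger0_norm ?invr_ge0.
Qed.

Lemma rbmeas_difference_weight (h : R) : rbmeas (difference_weight h).
Proof.
have e x : difference_weight h x =
    complex.Re (2%:R%:C * g_ c x 0 - (g_ c x (0 + h) + g_ c x (0 - h))).
  by rewrite -opprB g_second_difference opprK cexp_i mul0r cos0 sin0 cReM/=; ring.
have b : bmeas (fun x => 2%:R%:C * g_ c x 0 - (g_ c x (0 + h) + g_ c x (0 - h))).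
  apply: bmeasB; first by apply: bmeasM; [exact: bmeas_cst|exact: bmeas_g].
  by apply: bmeasD; exact: bmeas_g.
case: b => mR _ [M hM]; split.
  have /funext <- : (fun x => complex.Re (2%:R%:C * g_ c x 0 - (g_ c x (0 + h) + g_ c x (0 - h)))) =1
      difference_weight h by move=> x; rewrite e.
  exact: mR.
by exists M => x; rewrite e; exact: le_trans (cabs_Re _) (hM x).
Qed.

Lemma cintegral_second_difference m (h z : R) : (m setT < +oo)%E ->
  let I z := cintegral m setT (fun x => g_ c x z) in
  I (z + h) + I (z - h) - 2%:R%:C * I z =
  - ((\int[m]_(x in setT) (1 * cos (z * x) * difference_weight h x)) +i*
     (\int[m]_(x in setT) (1 * sin (z * x) * difference_weight h x))).
Proof.
move=> mfin I.
have gi y : cintegrable m setT (fun x => g_ c x y).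
  by apply: bmeas_cintegrable => //; exact: bmeas_g.
have mT := @measurableT _ (borelR R).
rewrite /I -cintegralD// -cintegralZ// -cintegralB//; last 2 first.
- exact: cintegrableD.
- exact: cintegrableZ.
under eq_cintegral => x _ do rewrite g_second_difference.
rewrite cintegralN//; last first.
  apply: bmeas_cintegrable => //; apply: bmeasM; first exact: bmeas_cexp_i.
  have [mw [M hM]] := rbmeas_difference_weight h.
  by split; [exact: mw|exact: measurable_cst|exists M => x; rewrite cabs_real].
congr (- _); rewrite /cintegral.
by congr (_ +i* _); apply: eq_Rintegral => x _; rewrite cexp_i ?cReM ?cImM/=; ring.
Qed.

(** Second differences in [z] remove [gamma] and turn the exponents into the Fourier
    transforms of the measures with density [difference_weight h]. *)
Lemma exponent_inj m1 m2 (gamma : R) : (m1 setT < +oo)%E -> (m2 setT < +oo)%E ->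
  (forall z, 'i%C * (gamma * z)%:C + (cintegral m1 setT (fun x => g_ c x z) -
     cintegral m2 setT (fun x => g_ c x z)) = 0) ->
  forall B, measurable B -> m1 B = m2 B.
Proof.
move=> f1 f2 E0.
apply: (positive_density_inj f1 f2 (w := fun k => difference_weight k.+1%:R^-1)).
- by move=> k; exact: rbmeas_difference_weight.
- by move=> k x; exact: difference_weight_ge0.
- exact: difference_weight_gt0.
move=> k B mB; set h := k.+1%:R^-1.
apply: weighted_measure_inj => //; last exact: difference_weight_ge0.
  exact: rbmeas_difference_weight.
split; first exact: rbmeas_cst.
move=> z.
have h1 := cintegral_second_difference h z f1.
have h2 := cintegral_second_difference h z f2.
have e y : cintegral m1 setT (fun x => g_ c x y) =
    cintegral m2 setT (fun x => g_ c x y) - 'i%C * (gamma * y)%:C.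
  by apply/eqP; rewrite -subr_eq0 -(E0 y); apply/eqP; ring.
have : - ((\int[m1]_(x in setT) (1 * cos (z * x) * difference_weight h x)) +i*
     (\int[m1]_(x in setT) (1 * sin (z * x) * difference_weight h x))) =
  - ((\int[m2]_(x in setT) (1 * cos (z * x) * difference_weight h x)) +i*
     (\int[m2]_(x in setT) (1 * sin (z * x) * difference_weight h x))).
  rewrite -h1 -h2 /= !e.
  rewrite (_ : (gamma * (z + h))%:C = (gamma * z)%:C + (gamma * h)%:C); last first.
    by rewrite -rmorphD mulrDr.
  rewrite (_ : (gamma * (z - h))%:C = (gamma * z)%:C - (gamma * h)%:C); last first.
    by rewrite -rmorphB mulrBr.
  rewrite (_ : 2%:R%:C = 2); last by rewrite rmorph_nat.
  ring.
by move=> /oppr_inj[e1 e2].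
Qed.

(** Two exponents of the same function differ by a continuous function with values in
    [2 * i * pi * Z] that vanishes at 0.  Negative parts are moved to the other side
    in order to compare finite measures. *)
Lemma characteristic_pair_unique mu zeta1 zeta2 (gamma1 gamma2 : R) :
  characteristic_pair c mu zeta1 gamma1 -> characteristic_pair c mu zeta2 gamma2 ->
  forall B, measurable B -> zeta1 B = zeta2 B.
Proof.
move=> c1 c2.
have [p1 n1] := finite_part zeta1; have [p2 n2] := finite_part zeta2.
pose a := measure_add (pos_part zeta1) (neg_part zeta2).
pose b := measure_add (neg_part zeta1) (pos_part zeta2).
have aE B : a B = (pos_part zeta1 B + neg_part zeta2 B)%E by exact: measure_addE.
have bE B : b B = (neg_part zeta1 B + pos_part zeta2 B)%E by exact: measure_addE.
have af : (a setT < +oo)%E by rewrite aE lte_add_pinfty.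
have bf : (b setT < +oo)%E by rewrite bE lte_add_pinfty.
pose D z := 'i%C * ((gamma1 - gamma2) * z)%:C + (cintegral a setT (fun x => g_ c x z) -
     cintegral b setT (fun x => g_ c x z)).
have DE z : D z = ('i%C * (gamma1 * z)%:C + scintegral zeta1 setT (fun x => g_ c x z)) -
    ('i%C * (gamma2 * z)%:C + scintegral zeta2 setT (fun x => g_ c x z)).
  rewrite /D /scintegral !cintegral_measure_add//; try exact: bmeas_g.
  rewrite mulrBl rmorphB/=; ring.
have D1 z : cexp (D z) = 1 by rewrite DE cexpB -c1 -c2 divff// c1 cexp_neq0.
have D0 : D 0 = 0.
  have g0 x : g_ c x 0 = 0 by apply: complex_eqP; rewrite ?g_Re ?g_Im !mul0r ?cos0 ?sin0 ?expr0n/=; ring.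
  have I0 m : cintegral m setT (fun x => g_ c x 0) = 0.
    under eq_cintegral => x _ do rewrite g0.
    by rewrite /cintegral /Rintegral integral0.
  by rewrite /D !I0 mulr0 mulr0 add0r subrr.
have Dc : continuous (fun z => complex.Im (D z)).
  rewrite (_ : (fun z => _) = fun z => (gamma1 - gamma2) * z +
    (complex.Im (cintegral a setT (fun x => g_ c x z)) -
     complex.Im (cintegral b setT (fun x => g_ c x z)))).
    apply: continuous_addf; first exact: continuous_lin.
    apply: continuous_addf; last apply: continuous_oppf; exact: continuous_cintegral_g.
  by apply/funext => z; rewrite /D !cImD cImN cImM/=; ring.
have h := continuous_cexp_eq1 Dc D0 D1.
have ab := exponent_inj af bf h.
move=> B mB; have : a B = b B := ab B mB.
rewrite aE bE.
rewrite (jordan_parts zeta1 mB) (jordan_parts zeta2 mB).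
have := pos_part_fin zeta1 mB; have := neg_part_fin zeta1 mB.
have := pos_part_fin zeta2 mB; have := neg_part_fin zeta2 mB.
move: (pos_part zeta1 B) (neg_part zeta1 B) (pos_part zeta2 B) (neg_part zeta2 B).
by move=> [x| |] [y| |] [u| |] [v| |] //= _ _ _ _ [e]; congr EFin; lra.
Qed.

End exponents.

(** * The exponent of a lattice distribution *)

Section lattice_logarithm.
Context {R : realType}.
Implicit Types (mu : probability (borelR R) R) (m : {measure set (borelR R) -> \bar R}).
Local Notation cabs := (ComplexField.Normc.normc).

Lemma dirac_series_integer_valued (a : int -> R) mu :
  is_dirac_series setT a mu -> integer_valued mu.
Proof.
move=> [_ muE]; have mC := measurableC (@measurable_integers R).
rewrite /integer_valued; apply: (eq_trans (muE _ mC)).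
have w0 n : ((a n)%:E * \d_(n%:~R : R) (~` range (fun n : int => n%:~R : R)))%E = 0%E.
  by rewrite diracE memNset ?mule0// => /(_ _)[]; exists n.
rewrite !esum1 ?sube0// => n _.
  by rewrite funenegE w0 oppe0 maxxx.
by rewrite funeposE w0 maxxx.
Qed.

Lemma charfun_at0 m : charfun m 0 = (fine (m setT))%:C.
Proof.
rewrite /charfun; under eq_cintegral => x _ do rewrite mul0r mulr0 cexp0.
by rewrite cintegral_cst// mul1r.
Qed.

Lemma cexp_conj (w : R[i]) : cexp (conjc w) = conjc (cexp w).
Proof. by case: w => a b; apply: complex_eqP; rewrite !cexpE/= ?cosN ?sinN; ring. Qed.

Lemma charfun_hermitian m z : (m setT < +oo)%E -> charfun m (- z) = conjc (charfun m z).
Proof.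
move=> mfin; have [_ iI] := bmeas_cintegrable measurableT mfin (bmeas_cexp_i z).
apply: complex_eqP.
  rewrite -[LHS]/(\int[m]_(x in setT) complex.Re (cexp ('i%C * (- z * x)%:C))).
  rewrite -[RHS]/(\int[m]_(x in setT) complex.Re (cexp ('i%C * (z * x)%:C))).
  by apply: eq_Rintegral => x _; rewrite mulNr !cexp_i/= cosN.
rewrite -[LHS]/(\int[m]_(x in setT) complex.Im (cexp ('i%C * (- z * x)%:C))).
rewrite -[RHS]/(- \int[m]_(x in setT) complex.Im (cexp ('i%C * (z * x)%:C))).
rewrite -[RHS]mulN1r -RintegralZl//.
by apply: eq_Rintegral => x _; rewrite mulNr !cexp_i/= sinN mulN1r.
Qed.

(** The exponent of a compound Poisson law whose jump measure is [mp - mn]. *)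
Definition jump_exponent mp mn (z : R) : R[i] :=
  (charfun mp z - charfun mp 0) - (charfun mn z - charfun mn 0).

Lemma periodic_lower_bound M (F : R -> R[i]) : wiener M F -> (forall z, F z != 0) ->
  exists2 d : R, 0 < d & forall z, d <= cabs (F z).
Proof.
move=> W F0; have [cR cI] := wiener_continuous W.
pose h (z : R) := complex.Re (F z) ^+ 2 + complex.Im (F z) ^+ 2.
have ch : continuous h.
  by apply: continuous_addf; under eq_fun do rewrite expr2; exact: continuous_mulf.
have tp0 : 0 <= 2 * pi :> R by rewrite mulr_ge0// ltW// pi_gt0.
have [x _ hx] := EVT_min tp0 (continuous_subspaceT ch).
have hE z : cabs (F z) = Num.sqrt (h z) by rewrite cabsE.
exists (cabs (F x)); first by rewrite cabs_gt0.
move=> z; have [n /andP[n0 n1]] := period_shift z.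
rewrite -(wiener_periodic W z n) !hE ler_wsqrtr// hx//.
by rewrite in_itv/= n0 ltW.
Qed.

(** By the Wiener-Levy theorem the characteristic function equals
    C e^(ikz) e^(G z) with G in the Wiener algebra; normalizing G at 0 absorbs
    C, and Hermitian symmetry of the characteristic function passes to G. *)
Lemma lattice_charfun_exponent mu : integer_valued mu -> (forall z, charfun mu z != 0) ->
  exists (k : int) (M : R) (b : int -> R) (mp mn : {measure set (borelR R) -> \bar R}),
  [/\ wiener M (jump_exponent mp mn),
      forall n, (b n)%:C = fourier_coef (jump_exponent mp mn) n /\
        forall s, uniq s -> \sum_(n <- s) `|b n| <= M,
      [/\ forall B, mp B = (\esum_(n in [set n : int | B (n%:~R : R)])
              (if n == 0 then 0 else Num.max (b n) 0)%:E)%E,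
        (mp setT < +oo)%E & integer_valued mp],
      [/\ forall B, mn B = (\esum_(n in [set n : int | B (n%:~R : R)])
              (if n == 0 then 0 else Num.max (- b n) 0)%:E)%E,
        (mn setT < +oo)%E & integer_valued mn] &
      forall z, charfun mu z = cexp ('i%C * (k%:~R * z)%:C + jump_exponent mp mn z)].
Proof.
move=> muZ mu0; have mufin : (mu setT < +oo)%E by rewrite probability_setT ltry.
have [M0 W0] := wiener_charfun mufin muZ.
have [d d0 dmu] := periodic_lower_bound W0 mu0.
have [C [k [MG [G [WG GE]]]]] := wiener_levy_log d0 dmu
  (fun e e0 => charfun_laurent_approx mufin muZ e0).
pose F z := G z - G 0.
have [M WF] : exists M, wiener M F.
  exists (MG + cabs (- G 0)); exact: wienerD WG (wiener_cst (- G 0)).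
have C1 : C * cexp (G 0) = 1.
  have mu1 : charfun mu 0 = 1.
    by rewrite charfun_at0 -[RHS]/((fine 1%E)%:C); congr (fine _)%:C; exact: probability_setT.
  by have := GE 0; rewrite mu1 cisXz mulr0 mulr0 cexp0 mulr1 => <-.
have muE z : charfun mu z = cexp ('i%C * (k%:~R * z)%:C + F z).
  rewrite GE cexpD cexpB cisXz [RHS]mulrA [_ * cexp (G z)]mulrC.
  have -> : (cexp (G 0))^-1 = C; last by ring.
  by apply: (mulIf (cexp_neq0 (G 0))); rewrite C1 mulVf ?cexp_neq0.
have F0 : F 0 = 0 by rewrite /F subrr.
have FH z : F (- z) = conjc (F z).
  have [cR cI] := wiener_continuous WF.
  pose D z := F (- z) - conjc (F z).
  have D0 : D 0 = 0 by rewrite /D oppr0 F0 rmorph0 subrr.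
  have cD : continuous (fun z => complex.Im (D z)).
    rewrite (_ : (fun z => _) = fun z => complex.Im (F (- z)) + complex.Im (F z)).
      apply: continuous_addf => // x.
      apply: (@continuous_comp _ _ _ (fun x : R => - x) (fun z => complex.Im (F z))).
        exact: oppr_continuous.
      exact: cI.
    by apply/funext => y; rewrite /D cImD cImN; case: (F y) => u v /=; rewrite opprK.
  have D1 y : cexp (D y) = 1.
    have h := charfun_hermitian y mufin; rewrite !muE -cexp_conj in h.
    have e1 : conjc ('i%C * (k%:~R * y)%:C + F y) = - ('i%C * (k%:~R * y)%:C) + conjc (F y).
      by case: (F y) => u v; apply: complex_eqP => /=; ring.
    have -> : D y = ('i%C * (k%:~R * - y)%:C + F (- y)) - conjc ('i%C * (k%:~R * y)%:C + F y).
      by rewrite e1 /D mulrN [(- _)%:C]rmorphN/=; ring.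
    by rewrite cexpB h divff// cexp_neq0.
  by apply/eqP; rewrite -subr_eq0; apply/eqP; exact: (continuous_cexp_eq1 cD D0 D1).
have [b [mp [mn [bE bM mpE mnE FE]]]] := wiener_hermitian_measures WF FH.
have FJ : F = jump_exponent mp mn.
  apply/funext => z; have := FE 0; rewrite F0 => E0.
  rewrite FE /jump_exponent.
  have -> : (b 0)%:C = - (charfun mp 0 - charfun mn 0) by apply/eqP; rewrite -addr_eq0 -E0.
  ring.
exists k, M, b, mp, mn; rewrite -FJ; split => //.
Qed.

End lattice_logarithm.

(** * Characteristic pairs of a lattice distribution *)

Section nonzero_integers.
Context {R : realType}.
Implicit Types (m : {measure set (borelR R) -> \bar R}) (B : set (borelR R)).
Implicit Types (F G : R -> R[i]).

Definition nonzero_integers : set (borelR R) :=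
  range (fun n : int => n%:~R : R) `\` [set 0].

Lemma measurable_nonzero_integers : measurable nonzero_integers.
Proof.
by apply: measurableD; [exact: measurable_integers|exact: measurable_set1].
Qed.

#[local] Hint Resolve measurable_nonzero_integers : core.

Lemma nonzero_integers_norm (x : R) : nonzero_integers x -> 1 <= `|x|.
Proof.
move=> [[n _ <-] /= n0]; rewrite -intr_norm -[1]/(1%:~R) ler_int.
by rewrite -gtz0_ge1 normr_gt0; apply/eqP => n00; apply: n0; rewrite n00.
Qed.

Lemma measure0S m (A B : set (borelR R)) : measurable A -> measurable B ->
  A `<=` B -> m B = 0%E -> m A = 0%E.
Proof.
move=> mA mB AB mB0; apply/eqP; rewrite eq_le measure_ge0 andbT -mB0.
by apply: le_measure; rewrite ?inE.
Qed.

Lemma nonzero_integers_null m : integer_valued m -> m [set (0 : R)] = 0%E ->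
  m (~` nonzero_integers) = 0%E.
Proof.
move=> mZ m0; have mI := @measurable_integers R.
have -> : ~` nonzero_integers = (~` range (fun n : int => n%:~R : R)) `|` [set 0].
  by rewrite /nonzero_integers setDE setCI setCK.
have e : m (~` range (fun n : int => n%:~R : R) `|` [set 0]) =
    (m (~` range (fun n : int => n%:~R : R)) + m [set (0%R : R)])%E.
  apply: measureU; [exact: measurableC|exact: measurable_set1|].
  by apply/seteqP; split => // x [nx /= x0]; apply: nx; exists 0.
by rewrite e m0 adde0; exact: mZ.
Qed.

Lemma measureI_nonzero_integers m B : measurable B -> m (~` nonzero_integers) = 0%E ->
  m (B `&` nonzero_integers) = m B.
Proof.
move=> mB m0; rewrite -[in RHS](setIT B) -(setUv nonzero_integers) setIUr.
have mC : measurable (~` nonzero_integers) by exact: measurableC.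
have mBC : measurable (B `&` ~` nonzero_integers) by exact: measurableI.
have e : m (B `&` nonzero_integers `|` B `&` ~` nonzero_integers) =
    (m (B `&` nonzero_integers) + m (B `&` ~` nonzero_integers))%E.
  apply: measureU => //; first exact: measurableI.
  by rewrite setIACA setICr setI0.
by rewrite e (measure0S mBC mC _ m0) ?adde0//; exact: subIsetr.
Qed.

(** The density is 1 at the nonzero integers. *)
Lemma integral_levy_density_integers m B : measurable B -> m (~` nonzero_integers) = 0%E ->
  (\int[m]_(x in B) (levy_density x)%:E)%E = m B.
Proof.
move=> mB m0; have mC : measurable (~` nonzero_integers) by exact: measurableC.
have NC : nonzero_integers `&` ~` nonzero_integers = set0 by exact: setICr.
rewrite -(split_integral mB measurable_nonzero_integers mC (setUv _) NC m0).
have mI : measurable (B `&` nonzero_integers) by exact: measurableI.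
rewrite -(measureI_nonzero_integers mB m0) -[RHS]mul1e -integral_cst//.
by apply: eq_integral => x /set_mem[_ /nonzero_integers_norm x1]; rewrite levy_density_far.
Qed.

Lemma cintegral_integers m F G : (m setT < +oo)%E -> m (~` nonzero_integers) = 0%E ->
  bmeas F -> bmeas G -> (forall x, nonzero_integers x -> F x = G x) ->
  cintegral m setT F = cintegral m setT G.
Proof.
move=> mfin m0 bF bG FG; have mC : measurable (~` nonzero_integers) by exact: measurableC.
have d : [disjoint nonzero_integers & ~` nonzero_integers] by apply/eqP; exact: setICr.
have N0 H : bmeas H -> cintegral m (~` nonzero_integers) H = 0.
  move=> [h1 h2 _]; rewrite /cintegral /Rintegral !null_set_integral//.
    by apply: measurable_funTS; apply/measurable_EFinP.
  by apply: measurable_funTS; apply/measurable_EFinP.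
rewrite -(setUv nonzero_integers) !cintegral_setU// !N0//; congr (_ + _).
exact: eq_cintegral.
Qed.

Lemma esum_at0 (p : int -> R) :
  (\esum_(n in [set n : int | [set (0%R : R)] (n%:~R : R)]) (if n == 0 then 0 else p n)%R%:E = 0)%E.
Proof.
by apply: esum1 => n /= /eqP; rewrite intr_eq0 => ->.
Qed.

Lemma charfun0E m : (m setT < +oo)%E -> forall z : R,
  cintegral m setT (fun x => cexp ('i%C * (z * x)%:C) - 1) = charfun m z - charfun m 0.
Proof.
move=> mfin z; rewrite cintegralB//; last 2 first.
- by apply: bmeas_cintegrable => //; exact: bmeas_cexp_i.
- by apply: bmeas_cintegrable => //; exact: bmeas_cst.
by congr (_ - _); apply: eq_cintegral => x _; rewrite mul0r mulr0 cexp0.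
Qed.

Lemma cintegral_real m (f : R -> R) :
  cintegral m setT (fun x => (f x)%:C) = (\int[m]_(x in setT) f x)%:C.
Proof. by apply: complex_eqP => //=; rewrite /Rintegral integral0. Qed.

Lemma cexp_i_lin_eq1 (t : R) : (forall z, cexp ('i%C * (t * z)%:C) = 1) -> t = 0.
Proof.
move=> h; apply/eqP/negPn/negP => t0.
have := h (pi / t); have -> : t * (pi / t) = pi by field.
rewrite cexp_i cospi sinpi => -[].
by move=> e; move: (ltr01 : 0 < 1 :> R); lra.
Qed.

Lemma measurable_nonintegers : measurable (~` nonzero_integers : set (borelR R)).
Proof. by apply: measurableC; exact: measurable_nonzero_integers. Qed.

Lemma at0_nonzero_integers : [set (0 : R)] `<=` ~` nonzero_integers.
Proof. by move=> x -> [_]; apply. Qed.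

End nonzero_integers.

Section lattice_characteristic_pairs.
Context {R : realType}.
Variables (c : R -> R) (mu : probability (borelR R) R).
Variables (k : int) (M : R) (b : int -> R) (mp mn : {measure set (borelR R) -> \bar R}).
Hypothesis rep : representation_function c.
Hypothesis bM : forall s, uniq s -> \sum_(n <- s) `|b n| <= M.
Hypothesis mpE : forall B, mp B = (\esum_(n in [set n : int | B (n%:~R : R)])
  (if n == 0 then 0 else Num.max (b n) 0)%:E)%E.
Hypothesis mnE : forall B, mn B = (\esum_(n in [set n : int | B (n%:~R : R)])
  (if n == 0 then 0 else Num.max (- b n) 0)%:E)%E.
Hypotheses (mpfin : (mp setT < +oo)%E) (mnfin : (mn setT < +oo)%E).
Hypotheses (mpZ : integer_valued mp) (mnZ : integer_valued mn).
Hypothesis muE : forall z, charfun mu z =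
  cexp ('i%C * (k%:~R * z)%:C + jump_exponent mp mn z).
Implicit Types (B : set (borelR R)).

Lemma mp_null : mp (~` nonzero_integers) = 0%E.
Proof. by apply: nonzero_integers_null => //; rewrite mpE esum_at0. Qed.

Lemma mn_null : mn (~` nonzero_integers) = 0%E.
Proof. by apply: nonzero_integers_null => //; rewrite mnE esum_at0. Qed.

Lemma bmeas_c : bmeas (fun x => (c x)%:C).
Proof.
have [mc [K cK] _] := rep; split; [exact: mc|exact: measurable_cst|].
by exists K => x; rewrite cabs_real.
Qed.

Lemma cintegral_g_integers (m : {measure set (borelR R) -> \bar R}) (z : R) : (m setT < +oo)%E -> m (~` nonzero_integers) = 0%E ->
  cintegral m setT (fun x => g_ c x z) = charfun m z - charfun m 0 -
  ('i%C * z%:C) * cintegral m setT (fun x => (c x)%:C).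
Proof.
move=> mfin m0; have bc := bmeas_c.
have be := bmeasB (bmeas_cexp_i z) (bmeas_cst 1).
have bz := bmeasM (bmeas_cst ('i%C * z%:C)) bc.
transitivity (cintegral m setT (fun x => cexp ('i%C * (z * x)%:C) - 1 - 'i%C * z%:C * (c x)%:C)).
  apply: (cintegral_integers mfin m0 (bmeas_g rep z) (bmeasB be bz)) => x Zx.
  have x1 := nonzero_integers_norm Zx.
  have x0 : x != 0 by rewrite -normr_gt0 (lt_le_trans ltr01).
  rewrite /g_ (negbTE x0) min_l; last by rewrite -real_normK ?num_real// exprn_ege1.
  by rewrite [(z * c x)%:C]rmorphM/= mulrA divr1.
rewrite cintegralB//; last 2 first.
- exact: bmeas_cintegrable.
- exact: bmeas_cintegrable.
rewrite charfun0E// cintegralZ//.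
exact: bmeas_cintegrable.
Qed.

(** The compensating terms of the kernel [g_ c] are moved into the location
    parameter. *)
Lemma lattice_characteristic_pair : exists (zeta : {charge set (borelR R) -> \bar R}) gamma,
  characteristic_pair c mu zeta gamma /\ forall B, zeta B = (mp B - mn B)%E.
Proof.
have [zeta zE] := charge_of_measures mpfin mnfin.
exists zeta, (k%:~R + (\int[mp]_(x in setT) c x - \int[mn]_(x in setT) c x)).
split=> // z; rewrite muE (scintegral_measures mpfin mnfin (fun B _ => zE B) (bmeas_g rep z)).
rewrite (cintegral_g_integers z mpfin mp_null) (cintegral_g_integers z mnfin mn_null).
rewrite !cintegral_real /jump_exponent mulrDl mulrBl !rmorphD !rmorphN !rmorphM/=.
by congr cexp; ring.
Qed.

Variables (zeta : {charge set (borelR R) -> \bar R}) (gamma : R).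
Hypothesis cp : characteristic_pair c mu zeta gamma.

Lemma lattice_zetaE B : measurable B -> zeta B = (mp B - mn B)%E.
Proof.
move=> mB; have [zeta0 [gamma0 [cp0 z0E]]] := lattice_characteristic_pair.
by rewrite (characteristic_pair_unique rep cp cp0 mB).
Qed.

Lemma zeta_null B : measurable B -> B `<=` ~` nonzero_integers -> zeta B = 0%E.
Proof.
move=> mB BN; rewrite lattice_zetaE//.
have mC : measurable (~` nonzero_integers : set (borelR R)).
  by apply: measurableC; exact: measurable_nonzero_integers.
by rewrite (measure0S mB mC BN mp_null) (measure0S mB mC BN mn_null) sube0.
Qed.

Lemma pos_part_null : pos_part zeta (~` nonzero_integers) = 0%E.
Proof.
have mC := @measurable_nonintegers R; rewrite pos_partE//; apply: zeta_null; last exact: subIsetl.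
by apply: measurableI => //; exact: mP.
Qed.

Lemma neg_part_null : neg_part zeta (~` nonzero_integers) = 0%E.
Proof.
have mC := @measurable_nonintegers R; rewrite neg_partE//.
have -> : zeta (~` nonzero_integers `&` (hahn zeta).2) = 0%E; last by rewrite oppe0.
apply: zeta_null; last exact: subIsetl.
by apply: measurableI => //; exact: mN.
Qed.

Let mS0 : measurable ([set (0 : R)] : set (borelR R)) := measurable_set1 0.

(** The Jordan parts of [zeta] live on the nonzero integers, where passing from [zeta]
    to the quasi-Levy measure changes nothing; so they satisfy the conditions that
    characterize its parts. *)
Lemma quasi_Levy_posE B : measurable B -> quasi_Levy_pos zeta B = pos_part zeta B.
Proof.
apply: (glues_unique (quasi_Levy_posP zeta)); split.
  exact: (measure0S mS0 measurable_nonintegers at0_nonzero_integers pos_part_null).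
move=> r B' mB' Br; rewrite pos_part_restr//.
by rewrite integral_levy_density_integers//; exact: pos_part_null.
Qed.

Lemma quasi_Levy_negE B : measurable B -> quasi_Levy_neg zeta B = neg_part zeta B.
Proof.
apply: (glues_unique (quasi_Levy_negP zeta)); split.
  exact: (measure0S mS0 measurable_nonintegers at0_nonzero_integers neg_part_null).
move=> r B' mB' Br; rewrite neg_part_restr//.
by rewrite integral_levy_density_integers//; exact: neg_part_null.
Qed.

Lemma quasi_Levy_tvE B : measurable B ->
  quasi_Levy_tv zeta B = (pos_part zeta B + neg_part zeta B)%E.
Proof.
have aE A : measure_add (pos_part zeta) (neg_part zeta) A = (pos_part zeta A + neg_part zeta A)%E.
  exact: measure_addE.
move=> mB; apply: (@etrans _ _ (measure_add (pos_part zeta) (neg_part zeta) B)); last exact: aE.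
apply: (glues_unique (quasi_Levy_tvP zeta)) => //; split.
  apply: (eq_trans (aE _)); rewrite (measure0S mS0 measurable_nonintegers at0_nonzero_integers pos_part_null).
  by rewrite (measure0S mS0 measurable_nonintegers at0_nonzero_integers neg_part_null) adde0.
move=> r A mA Ar; apply: (eq_trans (aE _)).
transitivity (pos_part (quasi_Levy_restr zeta r) A + neg_part (quasi_Levy_restr zeta r) A)%E.
  rewrite pos_part_restr// neg_part_restr//.
  rewrite (integral_levy_density_integers mA pos_part_null).
  by rewrite (integral_levy_density_integers mA neg_part_null).
by [].
Qed.

Lemma quasi_Levy_tv_null : quasi_Levy_tv zeta (~` nonzero_integers) = 0%E.
Proof.
by rewrite quasi_Levy_tvE ?pos_part_null ?neg_part_null ?adde0//; exact: measurable_nonintegers.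
Qed.

Lemma lattice_gaussian_variance : gaussian_variance zeta = 0.
Proof. by rewrite /gaussian_variance zeta_null//; exact: at0_nonzero_integers. Qed.

Lemma lattice_quasi_Levy_finite : quasi_Levy_finite zeta.
Proof.
have [pf nf] := finite_part zeta.
by rewrite /quasi_Levy_finite quasi_Levy_tvE// lte_add_pinfty.
Qed.

Lemma lattice_quasi_Levy_concentrated :
  quasi_Levy_concentrated zeta (range (fun n : int => n%:~R : R)).
Proof.
rewrite /quasi_Levy_concentrated.
apply: (measure0S _ measurable_nonintegers _ quasi_Levy_tv_null).
  by apply: measurableC; exact: measurable_integers.
by apply: subsetC; exact: subDsetl.
Qed.

Lemma quasi_Levy_cintegral_jump z :
  quasi_Levy_cintegral zeta setT (fun x => cexp ('i%C * (z * x)%:C) - 1) =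
  jump_exponent mp mn z.
Proof.
rewrite /quasi_Levy_cintegral (cintegral_eq_measure _ quasi_Levy_posE).
rewrite (cintegral_eq_measure _ quasi_Levy_negE).
have be := bmeasB (bmeas_cexp_i z) (bmeas_cst 1).
have := scintegral_measures mpfin mnfin lattice_zetaE be.
by rewrite /scintegral => ->; rewrite !charfun0E.
Qed.

Lemma lattice_drift : is_drift mu zeta k%:~R.
Proof.
split.
  have mI : measurable ([set x : R | `|x| < 1] : set (borelR R)).
    have -> : [set x : R | `|x| < 1] = `](- 1), 1[%classic.
      by apply/seteqP; split => x /=; rewrite in_itv/= ltr_norml.
    exact: measurable_itv.
  rewrite null_set_integral//.
    by apply/measurable_EFinP; exact: measurable_funTS.
  apply: (measure0S mI measurable_nonintegers _ quasi_Levy_tv_null) => x /= x1.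
  by move=> /nonzero_integers_norm; rewrite leNgt x1.
rewrite lattice_gaussian_variance.
have key (t z : R) : 'i%C * (t * z)%:C - (0 * z ^+ 2 / 2)%:C +
    quasi_Levy_cintegral zeta setT (fun x => cexp ('i%C * (z * x)%:C) - 1) =
    'i%C * (t * z)%:C + jump_exponent mp mn z.
  by rewrite quasi_Levy_cintegral_jump !mul0r subr0.
split=> [z|t ht]; first by rewrite key.
apply/eqP; rewrite -subr_eq0; apply/eqP; apply: cexp_i_lin_eq1 => z.
have := ht z; rewrite key muE => e.
have -> : 'i%C * ((k%:~R - t) * z)%:C = ('i%C * (k%:~R * z)%:C + jump_exponent mp mn z) -
    ('i%C * (t * z)%:C + jump_exponent mp mn z).
  by rewrite mulrBl rmorphB/=; ring.
by rewrite cexpB e divff// cexp_neq0.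
Qed.

Lemma lattice_quasi_Levy_extension : quasi_Levy_extension zeta zeta.
Proof.
split; first by rewrite zeta_null//; exact: at0_nonzero_integers.
move=> r B mB Br; rewrite /quasi_Levy.
rewrite (integral_levy_density_integers mB pos_part_null).
by rewrite (integral_levy_density_integers mB neg_part_null) -jordan_parts.
Qed.

Lemma lattice_dirac_series : is_dirac_series [set n : int | n != 0] b zeta.
Proof.
split.
  rewrite /summable; apply: (@le_lt_trans _ _ M%:E); last exact: ltry.
  apply: ge_ereal_sup => _ [A [finA AD] <-].
  rewrite fsbig_finite//= sumEFin lee_fin; apply: bM; exact: finmap.fset_uniq.
move=> B mB w; rewrite lattice_zetaE// mpE mnE.
congr (_ - _)%E; rewrite esum_mkcond [RHS]esum_mkcond; apply: eq_esum => n _.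
  rewrite funeposE /w diracE.
  have [nB|nB] := boolP (n \in [set n : int | B (n%:~R : R)]).
    rewrite (_ : (n%:~R : R) \in B); last by rewrite inE; move: nB; rewrite inE.
    rewrite mule1; case: eqVneq => [->|n0]; first by rewrite memNset//=; apply/negP; rewrite negbK.
    by rewrite mem_set// EFin_max.
  rewrite (_ : (n%:~R : R) \in B = false); last first.
    by apply/negbTE; move: nB; rewrite !notin_setE.
  by rewrite mule0 maxxx; case: ifP.
rewrite funenegE /w diracE.
have [nB|nB] := boolP (n \in [set n : int | B (n%:~R : R)]).
  rewrite (_ : (n%:~R : R) \in B); last by rewrite inE; move: nB; rewrite inE.
  rewrite mule1; case: eqVneq => [->|n0]; first by rewrite memNset//=; apply/negP; rewrite negbK.
  by rewrite mem_set// EFin_max.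
rewrite (_ : (n%:~R : R) \in B = false); last first.
  by apply/negbTE; move: nB; rewrite !notin_setE.
by rewrite mule0 oppe0 maxxx; case: ifP.
Qed.

End lattice_characteristic_pairs.

(** * The distinguished logarithm *)

Section distinguished_logarithm.
Context {R : realType}.
Local Notation cabs := (ComplexField.Normc.normc).
Local Notation leb := (@lebesgue_measure R).
Local Notation I02pi := (`[(0 : R), 2 * pi]%classic).

Lemma continuous_Im (g : R -> R[i]^o) : continuous g ->
  continuous (fun z => complex.Im (g z : R[i])).
Proof.
move=> cg z; apply/cvgrPdist_lt => e e0.
have e0C : (0 : R[i]) < e%:C by rewrite ltcR.
have /cvgrPdist_lt/(_ _ e0C) := cg z; apply: filterS => y h.
have : (cabs (g z - g y : R[i]))%:C < e%:C :> R[i] by exact: h.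
rewrite ltcR; apply: le_lt_trans; rewrite -cImN -cImD; exact: cabs_Im.
Qed.

Lemma cintegrable_idM_cisXz (n : int) : cintegrable leb I02pi (fun z => cis z ^ n * z%:C).
Proof.
have mI : measurable (I02pi : set (borelR R)) by exact: measurable_itv.
have ci (f : R -> R) : continuous f -> leb.-integrable I02pi (EFin \o f).
  move=> cf; apply: continuous_compact_integrable; first exact: segment_compact.
  exact: continuous_subspaceT.
have cid : continuous (fun z : R => z) by move=> z; exact: cvg_id.
split; apply: ci.
  under eq_fun do rewrite cisXz cexp_i cReM/= mulr0 subr0.
  by apply: continuous_mulf => //; exact: continuous_cos_lin.
under eq_fun do rewrite cisXz cexp_i cImM/= mulr0 add0r.
by apply: continuous_mulf => //; exact: continuous_sin_lin.
Qed.

Section exponent.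
Variables (mp mn : {measure set (borelR R) -> \bar R}) (M : R) (k : int) (f : R -> R[i]).
Hypothesis WJ : wiener M (jump_exponent mp mn).
Hypothesis fE : forall z, f z = cexp ('i%C * (k%:~R * z)%:C + jump_exponent mp mn z).

Lemma jump_exponent0 : jump_exponent mp mn 0 = 0.
Proof. by rewrite /jump_exponent !subrr. Qed.

(** The right-hand side is another continuous logarithm that vanishes at 0. *)
Lemma distinguished_logE (g : R -> R[i]^o) : distinguished_log f g ->
  forall z, g z = 'i%C * (k%:~R * z)%:C + jump_exponent mp mn z :> R[i].
Proof.
move=> [cg g0 gE] z; have [_ cJ] := wiener_continuous WJ.
pose D z : R[i] := (g z : R[i]) - ('i%C * (k%:~R * z)%:C + jump_exponent mp mn z).
have D0 : D 0 = 0 by rewrite /D g0 jump_exponent0 mulr0 mulr0 addr0 subrr.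
have D1 y : cexp (D y) = 1 by rewrite cexpB gE fE divff// cexp_neq0.
have cD : continuous (fun z => complex.Im (D z)).
  rewrite (_ : (fun z => _) = fun z => complex.Im (g z : R[i]) -
      (k%:~R * z + complex.Im (jump_exponent mp mn z))); last first.
    by apply/funext => y; rewrite /D cImD cImN cImD cImM/=; ring.
  apply: continuous_addf; first exact: continuous_Im.
  by apply: continuous_oppf; apply: continuous_addf => //; exact: continuous_lin.
by apply/eqP; rewrite -subr_eq0; apply/eqP; exact: (continuous_cexp_eq1 cD D0 D1 z).
Qed.

Lemma jump_exponent_periodic z : jump_exponent mp mn (z + 2 * pi) = jump_exponent mp mn z.
Proof. by have := wiener_periodic WJ z 1; rewrite mul1r. Qed.

Lemma distinguished_log_2pi (g : R -> R[i]^o) : distinguished_log f g ->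
  ((2 * pi)%:C * 'i%C)^-1 * (g (2 * pi) : R[i]) = k%:~R.
Proof.
move=> gl; rewrite (distinguished_logE gl).
have := jump_exponent_periodic 0; rewrite add0r jump_exponent0 => ->; rewrite addr0.
have p0 : (2 * pi)%:C * 'i%C != 0 :> R[i].
  rewrite mulf_neq0 -?cabs_eq0 ?cabs_i ?oner_eq0// cabs_real normr_eq0.
  by rewrite mulf_neq0// gt_eqF// pi_gt0.
apply: (mulfI p0); rewrite mulrA divff// mul1r rmorphM/= rmorph_int; ring.
Qed.

(** The summand [i k z] of the logarithm, which is not periodic, has [- k / n] as its
    integral against the character of index [n]. *)
Lemma distinguished_log_fourier (g : R -> R[i]^o) (n : int) : distinguished_log f g -> n != 0 ->
  fourier_coef (jump_exponent mp mn) n = k%:~R / n%:~R + ((2 * pi)^-1)%:C *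
    cintegral leb I02pi (fun z : R => cexp (- ('i%C * (n%:~R * z)%:C)) * g z).
Proof.
move=> gl n0; have mI : measurable (I02pi : set (borelR R)) by exact: measurable_itv.
have bJ := wiener_bmeas WJ.
have iJ : cintegrable leb I02pi (fun z => cis z ^ (- n) * jump_exponent mp mn z).
  by apply: bmeas_cintegrable => //; [exact: I02pi_fin|apply: bmeasM => //; exact: bmeas_cisXz].
have iz := cintegrableZ ('i%C * k%:~R) mI (cintegrable_idM_cisXz (- n)).
have -> : cintegral leb I02pi (fun z : R => cexp (- ('i%C * (n%:~R * z)%:C)) * g z) =
    cintegral leb I02pi (fun z => cis z ^ (- n) * jump_exponent mp mn z +
      'i%C * k%:~R * (cis z ^ (- n) * z%:C)).
  apply: eq_cintegral => z _; rewrite fourier_kernelE (distinguished_logE gl).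
  by rewrite rmorphM/= rmorph_int; move: (cis z ^ - n) => w; ring.
rewrite cintegralD// cintegralZ//; last exact: cintegrable_idM_cisXz.
rewrite cintegral_idM_cisXz// fourier_coefE.
have nC : n%:~R != 0 :> R[i] by rewrite intr_eq0.
have pC : (2 * pi)%:C != 0 :> R[i].
  by rewrite -cabs_eq0 cabs_real normr_eq0 mulf_neq0// gt_eqF// pi_gt0.
have -> : ((2 * pi)^-1)%:C = (2 * pi)%:C^-1 :> R[i] by rewrite fmorphV.
have -> : (2 * pi / n%:~R)%:C = (2 * pi)%:C / n%:~R :> R[i].
  by rewrite rmorphM/= fmorphV/= rmorph_int.
move: pC; move: (cintegral _ _ _) ((2 * pi)%:C : R[i]) => I p pC.
rewrite mulrDr addrCA -[LHS]addr0; congr (_ + _); symmetry.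
have ii : 'i%C * 'i%C = -1 :> R[i] by rewrite -expr2 sqr_i.
have -> : 'i%C * k%:~R * ('i%C * (p / n%:~R)) = ('i%C * 'i%C) * k%:~R * (p / n%:~R) by ring.
by rewrite ii; field; rewrite pC nC.
Qed.

End exponent.
End distinguished_logarithm.

(** * Quasi-infinitely divisible lattice distributions *)

Theorem theorem8p1 (R : realType) (c : R -> R) (a : int -> R)
    (mu : probability (borelR R) R) :
  representation_function c ->
  is_dirac_series setT a mu ->
  (quasi_infinitely_divisible c mu <-> forall z : R, charfun mu z != 0) /\
  forall (gamma : R) (zeta : {charge set (borelR R) -> \bar R}),
    characteristic_pair c mu zeta gamma ->
    [/\ gaussian_variance zeta = 0,
        quasi_Levy_finite zeta,
        quasi_Levy_concentrated zeta (range (fun n : int => n%:~R : R)),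
        exists k : int, is_drift mu zeta k%:~R &
        forall g : R -> R[i]^o, distinguished_log (charfun mu) g ->
        exists (k : int) (b : int -> R),
          let gt := fun z : R => (g z - 'i%C * (k%:~R * z)%:C) : R[i] in
          [/\ ((2 * pi)%:C * 'i%C)^-1 * (g (2 * pi) : R[i]) = k%:~R,
              is_drift mu zeta k%:~R,
              periodic gt (2 * pi),
              forall n : int, n != 0 ->
                (b n)%:C = fourier_coef gt n /\
                (b n)%:C = k%:~R / n%:~R + ((2 * pi)^-1)%:C *
                  cintegral lebesgue_measure `[0, 2 * pi]
                    (fun z : R => cexp (- ('i%C * (n%:~R * z)%:C)) * g z) &
              exists nu : {charge set (borelR R) -> \bar R},
                quasi_Levy_extension zeta nu /\
                is_dirac_series [set n : int | n != 0] b nu]].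
Proof.
move=> rep mua; have muZ := dirac_series_integer_valued mua.
have nonzero gamma (zeta : {charge set (borelR R) -> \bar R}) :
    characteristic_pair c mu zeta gamma -> forall z, charfun mu z != 0.
  by move=> cp z; rewrite cp cexp_neq0.
split.
  split=> [[gamma [zeta cp]]|mu0]; first exact: nonzero cp.
  have [k [M [b [mp [mn [WJ bE [mpE mpf mpZ] [mnE mnf mnZ] muE]]]]]] :=
    lattice_charfun_exponent muZ mu0.
  have [zeta [gamma [cp _]]] := lattice_characteristic_pair rep mpE mnE mpf mnf mpZ mnZ muE.
  by exists gamma, zeta.
move=> gamma zeta cp.
have [k [M [b [mp [mn [WJ bE [mpE mpf mpZ] [mnE mnf mnZ] muE]]]]]] :=
  lattice_charfun_exponent muZ (nonzero _ _ cp).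
have bM s : uniq s -> \sum_(n <- s) `|b n| <= M := (bE 0).2 s.
have drift := lattice_drift rep mpE mnE mpf mnf mpZ mnZ muE cp.
split.
- exact: (lattice_gaussian_variance rep mpE mnE mpf mnf mpZ mnZ muE cp).
- exact: (lattice_quasi_Levy_finite rep mpE mnE mpf mnf mpZ mnZ muE cp).
- exact: (lattice_quasi_Levy_concentrated rep mpE mnE mpf mnf mpZ mnZ muE cp).
- by exists k.
move=> g gl; exists k, b => gt.
have gtE : gt = jump_exponent mp mn.
  by apply/funext => z; rewrite /gt (distinguished_logE WJ muE gl) addrC addKr.
split.
- exact: (distinguished_log_2pi WJ muE gl).
- exact: drift.
- by move=> z; rewrite gtE (jump_exponent_periodic WJ).
- move=> n n0; rewrite gtE; split; first by case: (bE n).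
  by rewrite -(distinguished_log_fourier WJ muE gl n0); case: (bE n).
- exists zeta; split; first exact: (lattice_quasi_Levy_extension rep mpE mnE mpf mnf mpZ mnZ muE cp).
  exact: (lattice_dirac_series rep bM mpE mnE mpf mnf mpZ mnZ muE cp).
Qed.
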